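(* Let $F(\omega,\psi)$ be a nonnegative, symmetric, continuously differentiable function defined on the space of flags $\{(\omega,\psi):\ \omega\in\mathbf S^2,\ \psi\in\mathbf S_\omega\}$, where symmetric means $F(\omega,\psi)=F(\omega,\pi+\psi)=F(-\omega,\psi)$ for all flags. Put $$\overline F(\omega)=\frac1\pi\int_0^{2\pi}F(\omega,\psi)\,d\psi ,\qquad \omega\in\mathbf S^2 .$$ Then there exists a convex body $\mathbf B\subset\mathbb R^3$ with center of symmetry at the origin whose projection curvature radius satisfies $R(\omega,\psi)=F(\omega,\psi)$ for all $\omega\in\mathbf S^2$ and $\psi\in\mathbf S_\omega$ if and only if $$F(\omega,\psi)=\frac{\overline F(\omega)}2-\frac1{2\pi}\int_0^{\pi/2}\left(\int_0^{2\pi}\frac{\overline F((\nu,\phi)_\omega)\,\cos 2(\phi-\psi)}{\cos\nu}\,d\phi\right)d\nu$$ for all $\omega\in\mathbf S^2$ and all $\psi\in\mathbf S_\omega$ (the order of integration is important: first over $\phi$, then over $\nu$).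
   Context: $\mathbf S^2$ is the unit sphere in $\mathbb R^3$ (the space of spatial directions). For $\omega\in\mathbf S^2$, $\mathbf S_\omega\subset\mathbf S^2$ is the great circle with pole at $\omega$, i.e. the unit vectors orthogonal to $\omega$. A flag is a pair $(\omega,\psi)$ with $\omega\in\mathbf S^2$, $\psi\in\mathbf S_\omega$. Coordinates: for $\omega\in\mathbf S^2$, choose $\omega$ as North Pole and choose a reference point on the equator $\mathbf S_\omega$ (with a direction of rotation). $(\nu,\phi)_\omega$ denotes the point of $\mathbf S^2$ with latitude $\nu$ (so $\nu=0$ on the equator $\mathbf S_\omega$ and $\nu=\pi/2$ at $\omega$) and longitude $\phi\in[0,2\pi)$ measured from the reference point. A direction $\psi\in\mathbf S_\omega$ is identified with its longitude in this same system, i.e. $\psi=(0,\psi)_\omega$; with this identification $\pi+\psi$ denotes the direction opposite to $\psi$, $d\psi$ is integration with respect to the angle, and $\cos 2(\phi-\psi)$ is meaningful. The choice of reference point is immaterial. Projection curvature radius: a convex body is a nonempty compact convex set. For a convex body $\mathbf B\subset\mathbb R^3$ and a flag $(\omega,\psi)$, let $e(\omega,\psi)$ be the plane through the origin containing the directions $\omega$ and $\psi$, and let $\mathbf B(\omega,\psi)$ be the orthogonal projection of $\mathbf B$ onto $e(\omega,\psi)$. Then $R(\omega,\psi)$ is the curvature radius of the planar convex curve $\partial\mathbf B(\omega,\psi)$ at the point whose outer normal direction is $\omega$. As usual, the curvature radius as a function of the normal direction is $p+p''$, where $p(t)$ is the support function of the planar convex set $\mathbf B(\omega,\psi)$ as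 a function of the angle $t$ of the normal; here it is evaluated at the direction $\omega$, and the value $0$ is allowed. The bodies considered are sufficiently smooth for $R(\omega,\psi)$ to exist for every flag. *)

(* Defs.v *)
From HB Require Import structures.
From mathcomp Require Export all_boot all_order all_algebra.
From mathcomp Require Export all_classical all_reals all_analysis.
Export Order.TTheory GRing.Theory Num.Theory.
Export numFieldNormedType.Exports.

Set Implicit Arguments.
Unset Strict Implicit.
Unset Printing Implicit Defensive.

Local Open Scope ring_scope.
Local Open Scope classical_set_scope.

Section Geometry.
Context {R : realType}.
Implicit Types (x y u a b omega psi : 'rV[R]_3) (B : set 'rV[R]_3).

(* The library norm on ['rV[R]_3] is the max-norm, so the Euclidean sphere is
   defined from this inner product. *)
Definition dot x y : R := (x *m y^T) 0 0.

Definition sphere : set 'rV[R]_3 := [set omega | dot omega omega = 1].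

Definition great_circle omega : set 'rV[R]_3 :=
  [set psi | sphere psi /\ dot omega psi = 0].

Definition flag omega psi : Prop := sphere omega /\ great_circle omega psi.

(* For every pole [omega], [e omega = (a, b)] gives the reference point [a] on
   the equator (longitude 0) and the point [b] of longitude pi/2, which fixes
   the direction of rotation. Nothing is assumed off the sphere, and no
   regularity in [omega] is required. *)
Definition longitude_system (e : 'rV[R]_3 -> 'rV[R]_3 * 'rV[R]_3) : Prop :=
  forall omega, sphere omega ->
    [/\ great_circle omega (e omega).1, great_circle omega (e omega).2
      & dot (e omega).1 (e omega).2 = 0].

(* The point $(\nu,\phi)_\omega$. *)
Definition sphere_point (e : 'rV[R]_3 -> 'rV[R]_3 * 'rV[R]_3) omega
    (nu phi : R) : 'rV[R]_3 :=
  sin nu *: omega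
  + cos nu *: (cos phi *: (e omega).1 + sin phi *: (e omega).2).

Definition convex_body B : Prop := [/\ B !=set0, compact B & convex_set B].

Definition origin_symmetric B : Prop := forall x, B x -> B (- x).

Definition flag_projection omega psi x : 'rV[R]_3 :=
  dot x omega *: omega + dot x psi *: psi.

(* Support function of the planar set $B(\omega,\psi)$; the angle [t] of the
   normal is measured from [omega] towards [psi]. *)
Definition proj_support B omega psi (t : R) : R :=
  sup [set dot y (cos t *: omega + sin t *: psi)
      | y in flag_projection omega psi @` B].

(* [r] is the value at the normal direction [omega], i.e. at angle 0, of
   [p + p''], with [p] twice differentiable there. *)
Definition is_proj_curvature_radius B omega psi (r : R) : Prop :=
  let p := proj_support B omega psi in
  [/\ \forall t \near (0 : R), derivable p t 1,
      derivable (derive1 p) 0 1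
    & r = p 0 + derive1n 2 p 0].

End Geometry.

Section Flag_functions.
Context {R : realType}.
Implicit Types (F : 'rV[R]_3 -> 'rV[R]_3 -> R) (omega psi : 'rV[R]_3).

Definition flag_nonneg F : Prop :=
  forall omega psi, flag omega psi -> 0 <= F omega psi.

Definition flag_symmetric F : Prop :=
  forall omega psi, flag omega psi ->
    F omega psi = F omega (- psi) /\ F omega psi = F (- omega) psi.

(* In finite dimension, pointwise continuity of ['d G] is the same as its
   continuity in operator norm. *)
Definition C1_on (V : normedModType R) (U : set V) (G : V -> R) : Prop :=
  forall x, U x -> differentiable G x /\
    forall v, {for x, continuous (fun y => 'd G y v : R)}.

(* Functions of class C^1 on the flag manifold, viewed as a submanifold of
   [R^3 x R^3]: locally, restrictions of C^1 functions on open sets. *)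
Definition flag_C1 F : Prop :=
  forall omega psi, flag omega psi ->
    exists (U : set ('rV[R]_3 * 'rV[R]_3)) (G : 'rV[R]_3 * 'rV[R]_3 -> R),
      [/\ open U, U (omega, psi), C1_on U G
        & forall omega' psi', flag omega' psi' -> U (omega', psi') ->
            F omega' psi' = G (omega', psi')].

(* $\overline F$. *)
Definition flag_average (e : 'rV[R]_3 -> 'rV[R]_3 * 'rV[R]_3) F omega : R :=
  pi^-1 * \int[lebesgue_measure]_(t in `[0, 2 * pi])
            F omega (sphere_point e omega 0 t).

End Flag_functions.

(* Main.v *)
(* Let [h] be the support function of the body. On every great circle,
   parametrised by angle, [h] satisfies [p'' + p = F], where [F] is taken along
   the circle. At a fixed pole the second derivatives of [h] form a quadratic form,
   so [F omega] is half its trace plus the second Fourier coefficient of the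
   circle of directions, and the trace [F x u + F x v], for orthonormal tangents
   [u] and [v], is the average in the theorem.

   If [F] is the curvature of [h], take the second Fourier coefficient [A(nu)] of
   [h] on the parallel of latitude [nu] about [omega]. The one of the trace,
   divided by [cos nu], is the derivative of
   [A' / cos nu - 2 A sin nu / cos^2 nu], whose values at the equator and at the
   pole are [0] and minus twice the second Fourier coefficient of [F omega]; this
   is the formula.

   Conversely, the trace is even and Lipschitz, hence a uniform limit of even
   polynomials with bounded Lipschitz constants. Each of them is the trace of the
   curvature of an even polynomial, which can be found explicitly on even powers
   of linear forms. The formula holds for these curvatures, and the integral
   transform is continuous along such a sequence, so they converge uniformly
   to [F]. Solving [p'' + p = F] on half circles gives functions [h] and "slope of
   [h]", and in the limit [h] does not depend on the circle and the slope at a point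
   is linear in the direction. The points [h(u) u + grad h(u)] then witness that
   [h] is the support function of [{x | forall u, dot x u <= h u}], because
   [y'' + y >= 0] and [y 0 = y' 0 = 0] force [y >= 0] on [0, pi]. *)

From mathcomp Require Import ring lra.
Require Import Defs.

Set Implicit Arguments.
Unset Strict Implicit.
Unset Printing Implicit Defensive.

Local Open Scope ring_scope.
Local Open Scope classical_set_scope.

(** * Calculus on the real line *)

Section Real_line.
Context {R : realType}.
Implicit Types (f g df dg F : R -> R) (x y z a b c d k s t C L M T : R).

Notation mu := (@lebesgue_measure R).
Notation itg a b f := (\int[mu]_(x in `[a, b]) f x).

(** Continuous differentiability of [F] is turned, by compactness of the flag manifold, into one
    Lipschitz constant, and [h] is known to be twice differentiable only along each great circle.
    Mixed derivatives are therefore avoided. Exact identities come from second differences of [h]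
    over an arc with cosine [w] and sine [z]: their error is [O(z (1 - w))], and [z] tends to [0]
    after division by [1 - w]. The factor [1 / cos nu] is the obstacle to stability. The inner
    integral is [O(cos nu)] because [cos (2 (phi - t))] has mean zero and the trace is Lipschitz;
    uniform convergence of traces alone does not control their transforms. This is why the
    approximating polynomials must keep a Lipschitz bound independent of their degree, a property of
    Bernstein-type averages. Evenness of [h] removes the kernel of [p'' + p] on each great circle.
    Thus [h] and its slope are explicit integrals of the curvature, and these integrals pass to
    uniform limits. *)

Lemma isd_eq f x d d' : d' = d -> is_derive x (1 : R) f d' ->
  is_derive x (1 : R) f d.
Proof. by move=> <-. Qed.

Lemma isdD f g x a b : is_derive x (1 : R) f a -> is_derive x (1 : R) g b ->
  is_derive x (1 : R) (fun y => f y + g y) (a + b).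
Proof. by move=> fa gb; exact: is_deriveD. Qed.

Lemma isdB f g x a b : is_derive x (1 : R) f a -> is_derive x (1 : R) g b ->
  is_derive x (1 : R) (fun y => f y - g y) (a - b).
Proof. by move=> fa gb; exact: is_deriveB. Qed.

Lemma isdN f x a : is_derive x (1 : R) f a ->
  is_derive x (1 : R) (fun y => - f y) (- a).
Proof. by move=> fa; exact: is_deriveN. Qed.

Lemma isdM f g x a b : is_derive x (1 : R) f a -> is_derive x (1 : R) g b ->
  is_derive x (1 : R) (fun y => f y * g y) (f x * b + g x * a).
Proof. by move=> fa gb; exact: is_deriveM. Qed.

Lemma isdX f n x a : is_derive x (1 : R) f a ->
  is_derive x (1 : R) (fun y => f y ^+ n) (n%:R * f x ^+ n.-1 * a).
Proof.
move=> fa; have -> : (fun y => f y ^+ n) = f ^+ n by rewrite exprfctE.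
exact: is_deriveX.
Qed.

Lemma isdV f x a : f x != 0 -> is_derive x (1 : R) f a ->
  is_derive x (1 : R) (fun y => (f y)^-1) (- a / f x ^+ 2).
Proof.
move=> fx fa; apply: (isd_eq _ (@is_deriveV _ f x a 1 fx fa)).
by rewrite /GRing.scale /= mulNr mulrC -mulNr.
Qed.

Lemma isd_cst k x : is_derive x (1 : R) (fun=> k) 0.
Proof. exact: is_derive_cst. Qed.

Lemma isd_id x : is_derive x (1 : R) (fun y => y) 1.
Proof. exact: is_derive_id. Qed.

Lemma isd_comp f g x a b : is_derive x (1 : R) g b ->
  is_derive (g x) (1 : R) f a -> is_derive x (1 : R) (fun y => f (g y)) (a * b).
Proof.
by move=> gb fa; exact: (@is_derive1_comp _ f g x a b).
Qed.

Lemma isd_continuous f x a : is_derive x (1 : R) f a -> {for x, continuous f}.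
Proof. by case=> fx _; exact/differentiable_continuous/derivable1_diffP. Qed.

Lemma mean_value f df a b : a < b -> (forall x, is_derive x (1 : R) f (df x)) ->
  exists c, [/\ a < c, c < b & f b - f a = df c * (b - a)].
Proof.
move=> ab fdf; have [|c] := @MVT R f df a b ab.
  by apply: continuous_subspaceT => x; exact: isd_continuous (fdf x).
by rewrite in_itv/= => /andP[ac cb] fc; exists c.
Qed.

Lemma derive0_const f : (forall x, is_derive x (1 : R) f 0) ->
  forall x y, f x = f y.
Proof. by move=> f0 x y; exact: is_derive_0_is_cst. Qed.

Lemma lipschitz_derive f df M (fdf : forall x, is_derive x (1 : R) f (df x)) a b :
  (forall x, (a <= x <= b) || (b <= x <= a) -> `|df x| <= M) -> `|f b - f a| <= M * `|b - a|.
Proof.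
wlog ab : a b / a <= b => [H Mab|Mab].
  have [/H|/ltW ba] := leP a b; first exact.
  by rewrite distrC (distrC b); apply: H => // x hx; apply: Mab; rewrite orbC.
move: ab; rewrite le_eqVlt => /predU1P[->|ab].
  by rewrite !subrr normr0 mulr0.
have [c [ac cb ->]] := mean_value ab fdf.
by rewrite normrM ler_wpM2r// Mab// (ltW ac) (ltW cb).
Qed.

(** The mean value theorem for [f] minus its tangent at [s], whose derivative is at most [M |t|]
    between [s] and [s + t]. The constant [M] instead of [M / 2] is good enough. *)
Lemma taylor1 f df M s t (fdf : forall x, is_derive x (1 : R) f (df x)) :
  (forall x, `|df x - df s| <= M * `|x - s|) ->
  `|f (s + t) - f s - t * df s| <= M * t ^+ 2.
Proof.
move=> Mf.
have M0 : 0 <= M by have := le_trans (normr_ge0 _) (Mf (s + 1)); rewrite addrAC subrr add0r normr1 mulr1.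
pose g x := f x - df s * x.
have gd x : is_derive x (1 : R) g (df x - df s).
  apply: (isd_eq _ (isdB (fdf x) (isdM (isd_cst _ _) (isd_id _)))).
  by ring.
have := @lipschitz_derive g (fun x => df x - df s) (M * `|t|) gd s (s + t).
have -> : g (s + t) - g s = f (s + t) - f s - t * df s by rewrite /g; ring.
rewrite [s + t - s]addrC addKr -mulrA -expr2 real_normK ?num_real//; apply => x hx.
rewrite (le_trans (Mf x))// ler_wpM2l//.
by case/orP: hx => /andP[h1 h2]; rewrite ler_norml; apply/andP; have := ler_norm t; have := ler_norm (- t); rewrite normrN; lra.
Qed.

Lemma continuous_fD f g : continuous f -> continuous g ->
  continuous (fun x => f x + g x).
Proof. by move=> cf cg x; apply: continuousD; [exact: cf|exact: cg]. Qed.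

Lemma continuous_fB f g : continuous f -> continuous g ->
  continuous (fun x => f x - g x).
Proof. by move=> cf cg x; apply: continuousB; [exact: cf|exact: cg]. Qed.

Lemma continuous_fM f g : continuous f -> continuous g ->
  continuous (fun x => f x * g x).
Proof. by move=> cf cg x; apply: continuousM; [exact: cf|exact: cg]. Qed.

Lemma continuous_integrable f a b : continuous f ->
  mu.-integrable `[a, b] (EFin \o f).
Proof.
move=> cf; apply: continuous_compact_integrable; first exact: segment_compact.
exact: continuous_subspaceT.
Qed.

Lemma itgD f g a b : continuous f -> continuous g ->
  itg a b (fun x => f x + g x) = itg a b f + itg a b g.
Proof. by move=> cf cg; rewrite RintegralD//; exact: continuous_integrable. Qed.

Lemma itgB f g a b : continuous f -> continuous g ->
  itg a b (fun x => f x - g x) = itg a b f - itg a b g.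
Proof. by move=> cf cg; rewrite RintegralB//; exact: continuous_integrable. Qed.

Lemma itgZl k f a b : continuous f ->
  itg a b (fun x => k * f x) = k * itg a b f.
Proof. by move=> cf; rewrite RintegralZl//; exact: continuous_integrable. Qed.

Lemma itgZr k f a b : continuous f ->
  itg a b (fun x => f x * k) = itg a b f * k.
Proof. by move=> cf; rewrite RintegralZr//; exact: continuous_integrable. Qed.

Lemma eq_itg f g a b : (forall x, a <= x <= b -> f x = g x) ->
  itg a b f = itg a b g.
Proof. by move=> fg; apply: eq_Rintegral => x; rewrite inE/= in_itv/= => /fg. Qed.

Lemma itg_cst k a b : a <= b -> itg a b (fun=> k) = k * (b - a).
Proof.
move=> ab; rewrite Rintegral_cst// /= lebesgue_measure_itv/= lte_fin.
case: ltP => [_|ba]; first by rewrite -EFinD.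
by rewrite (@le_anti _ _ a b) ?subrr ?mulr0 // ab.
Qed.

Lemma normr_itg_le f M a b : a <= b -> mu.-integrable `[a, b] (EFin \o f) ->
  (forall x, a <= x <= b -> `|f x| <= M) -> `|itg a b f| <= M * (b - a).
Proof.
move=> ab fi fM; rewrite -(itg_cst M ab).
apply: (le_trans (le_normr_Rintegral _ fi)) => //.
apply: le_Rintegral => //.
- exact: integrable_norm.
- by apply: continuous_integrable => ?; exact: cst_continuous.
Qed.

Lemma itg_bound f M a b : a <= b -> continuous f ->
  (forall x, a <= x <= b -> `|f x| <= M) -> `|itg a b f| <= M * (b - a).
Proof. by move=> ab cf; apply: normr_itg_le => //; exact: continuous_integrable. Qed.

Lemma itg_ge0 f a b : (forall x, a <= x <= b -> 0 <= f x) -> 0 <= itg a b f.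
Proof. by move=> f0; apply: Rintegral_ge0 => x /=; rewrite in_itv/=; exact: f0. Qed.

Lemma itg_derive F f a b : a <= b -> (forall x, is_derive x (1 : R) F (f x)) ->
  continuous f -> itg a b f = F b - F a.
Proof.
move=> + Ff cf; rewrite le_eqVlt => /predU1P[->|ab].
  by rewrite set_itv1 Rintegral_set1 subrr.
have cF : continuous F by move=> x; exact: isd_continuous (Ff x).
rewrite /Rintegral (@continuous_FTC2 _ f F a b)//.
- exact: continuous_subspaceT.
- split => [x _||].
  + by case: (Ff x).
  + exact/cvg_at_right_filter/cF.
  + exact/cvg_at_left_filter/cF.
- by move=> x _; rewrite derive1E; case: (Ff x).
Qed.

Lemma primitive f : continuous f ->
  exists F, forall x, is_derive x (1 : R) F (f x).
Proof.
move=> cf; exists (fun x => itg 0 x f - itg x 0 f) => x.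
pose N := Num.min x 0 - 1.
have Nx : N < x by rewrite /N; rewrite ltrBlDr (le_lt_trans (_ : _ <= x))// ?ge_min ?lexx// ltrDl.
have N0 : N < 0 by rewrite /N; rewrite ltrBlDr (le_lt_trans (_ : _ <= 0))// ?ge_min ?lexx ?orbT// ltrDl.
have shiftN y z : N <= y -> y <= z -> itg y z f = itg N z f - itg N y f.
  move=> Ny yz; rewrite Rintegral_itvB ?bnd_simp//.
  - by rewrite Rintegral_itv_obnd_cbnd//; apply: integrableS (continuous_integrable N z cf) => //; apply: subset_itv; rewrite bnd_simp.
  - exact: continuous_integrable.
have [dF F'] : derivable (fun y => itg N y f) x 1 /\ (fun y => itg N y f)^`() x = f x.
  by apply: (@continuous_FTC1_closed _ f N x (x + 1)) => //; [rewrite ltrDl|exact: continuous_integrable|exact: cf].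
apply: (@near_eq_is_derive _ _ _ (fun y => itg N y f - itg N 0 f)).
  near=> y.
  have Ny : N <= y by near: y; apply: cvgr_ge; [exact: cvg_id|].
  have [y0|y0] := leP y 0.
    move: y0; rewrite le_eqVlt => /predU1P[->|y0].
      by rewrite !subrr.
    rewrite [X in _ = X - _](_ : _ = 0); last by rewrite set_itv_ge ?Rintegral_set0// bnd_simp -ltNge.
    by rewrite (shiftN y 0 Ny (ltW y0)) sub0r opprB.
  rewrite [X in _ = _ - X](_ : _ = 0); last by rewrite set_itv_ge ?Rintegral_set0// bnd_simp -ltNge.
  by rewrite (shiftN 0 y (ltW N0) (ltW y0)) subr0.
have dN : is_derive x (1 : R) (fun y => itg N y f) (f x).
  by apply: DeriveDef; [exact: dF|rewrite -derive1E].
by apply: (isd_eq _ (isdB dN (isd_cst _ _))); rewrite subr0.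
Unshelve. all: by end_near. Qed.

Lemma itg_shift f a b c : a <= b -> continuous f ->
  itg a b (fun x => f (x + c)) = itg (a + c) (b + c) f.
Proof.
move=> ab cf; have [F Ff] := primitive cf.
have -> : itg (a + c) (b + c) f = F (b + c) - F (a + c).
  by apply: itg_derive; rewrite ?lerD2r.
apply: (@itg_derive (fun x => F (x + c)) (fun x => f (x + c))) => // [x|].
  apply: (isd_eq _ (isd_comp (isdD (isd_id x) (isd_cst c x)) (Ff _))).
  by rewrite addr0 mulr1.
by move=> x; apply: continuous_comp; [apply: continuousD; [exact: cvg_id|exact: cst_continuous]|exact: cf].
Qed.

Lemma itg_periodic f a T : 0 <= T -> continuous f -> (forall x, f (x + T) = f x) ->
  itg 0 T (fun x => f (x + a)) = itg 0 T f.
Proof.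
move=> T0 cf fT; have [F Ff] := primitive cf.
have D x : is_derive x (1 : R) (fun x => F (T + x) - F x) 0.
  apply: (isd_eq _ (isdB (isd_comp (isdD (isd_cst T x) (isd_id x)) (Ff _)) (Ff x))).
  by rewrite add0r mulr1 (addrC T) fT subrr.
have E b d : b <= d -> itg b d f = F d - F b by move=> bd; exact: itg_derive.
rewrite itg_shift// !E//; last by rewrite lerD2r.
by rewrite add0r (derive0_const D a 0) addr0.
Qed.

(* The derivative of [y' sin (t - s) + y cos (t - s)] in [s] is
   [(y'' + y) sin (t - s)]. *)
Lemma oscillator_ge0 (y y1 y2 : R -> R) t : 0 <= t <= pi ->
  (forall x, is_derive x (1 : R) y (y1 x)) ->
  (forall x, is_derive x (1 : R) y1 (y2 x)) ->
  y 0 = 0 -> y1 0 = 0 -> (forall x, 0 <= x <= t -> 0 <= y2 x + y x) -> 0 <= y t.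
Proof.
move=> /andP[t0 tpi] dy dy1 y0 y10 pos.
move: t0; rewrite le_eqVlt => /predU1P[<-|t0]; first by rewrite y0.
pose g s := y1 s * sin (t - s) + y s * cos (t - s).
have dts x : is_derive x (1 : R) (fun x => t - x) (-1).
  by apply: (isd_eq _ (isdB (isd_cst t x) (isd_id x))); rewrite sub0r.
have dg x : is_derive x (1 : R) g ((y2 x + y x) * sin (t - x)).
  apply: (isd_eq _ (isdD (isdM (dy1 x) (isd_comp (dts x) (is_derive_sin _)))
    (isdM (dy x) (isd_comp (dts x) (is_derive_cos _))))).
  by ring.
have [c [c0 ct]] := mean_value t0 dg.
rewrite /g subrr sin0 cos0 mulr0 add0r mulr1 y0 y10 !mul0r addr0 !subr0 => ->.
apply: mulr_ge0; last exact: ltW.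
apply: mulr_ge0; first by rewrite pos// !ltW.
by apply: sin_ge0_pi; lra.
Qed.

(** [M (1 - cos t)] solves [y'' + y = M] with zero initial data, so its sum and its difference with
    [y] fall under [oscillator_ge0]. The factor [1 - cos t] matters: second differences are later
    divided by it. *)
Lemma oscillator_bound (y y1 y2 : R -> R) t M : 0 <= t <= pi ->
  (forall x, is_derive x (1 : R) y (y1 x)) ->
  (forall x, is_derive x (1 : R) y1 (y2 x)) ->
  y 0 = 0 -> y1 0 = 0 -> (forall x, 0 <= x <= t -> `|y2 x + y x| <= M) ->
  `|y t| <= M * (1 - cos t).
Proof.
move=> t0 dy dy1 y0 y10 My.
have dc x : is_derive x (1 : R) (fun x => M * (1 - cos x)) (M * sin x).
  apply: (isd_eq _ (isdM (isd_cst _ _) (isdB (isd_cst _ _) (is_derive_cos _)))).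
  by ring.
have ds x : is_derive x (1 : R) (fun x => M * sin x) (M * cos x).
  apply: (isd_eq _ (isdM (isd_cst _ _) (is_derive_sin _))).
  by ring.
rewrite ler_norml; apply/andP; split.
  have /= := @oscillator_ge0 _ _ _ t t0 (fun x => isdD (dc x) (dy x)) (fun x => isdD (ds x) (dy1 x)).
  rewrite y0 y10 cos0 sin0 subrr mulr0 addr0 addrC -lerBlDr sub0r; apply => // x /My; rewrite ler_norml => /andP[H1 H2].
  by lra.
have /= := @oscillator_ge0 _ _ _ t t0 (fun x => isdB (dc x) (dy x)) (fun x => isdB (ds x) (dy1 x)).
rewrite y0 y10 cos0 sin0 subrr mulr0 subr0.
rewrite subr_ge0; apply => // x /My; rewrite ler_norml => /andP[H1 H2].
by lra.
Qed.

Lemma is_derive_quadratic f s d C :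
  (forall t, `|f (s + t) - f s - t * d| <= C * t ^+ 2) -> is_derive s (1 : R) f d.
Proof.
move=> fC.
have C0 : 0 <= C by have := le_trans (normr_ge0 _) (fC 1); rewrite expr1n mulr1.
suff cv : (fun h => h^-1 *: ((f \o shift s) (h *: 1) - f s)) @ 0^' --> d.
  by apply: DeriveDef; [apply/cvg_ex; exists d|exact: cvg_lim].
apply/cvgrPdist_le => e e0; near=> h.
have h0 : h != 0 by near: h; exact: nbhs_dnbhs_neq.
have he : `|h| <= e / (C + 1).
  near: h; apply: dnbhs0_le; apply: divr_gt0 => //.
  by rewrite ltr_wpDl.
rewrite /= /GRing.scale/= mulr1 (addrC h).
have -> : d - h^-1 * (f (s + h) - f s) = - (h^-1 * (f (s + h) - f s - h * d)) by field.
rewrite normrN normrM normfV ler_pdivrMl ?normr_gt0//.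
apply: le_trans (fC h) _; rewrite -real_normK ?num_real// expr2 mulrA mulrC ler_wpM2l//.
apply: le_trans (_ : (C + 1) * `|h| <= _); first by rewrite ler_wpM2r// lerDl.
by rewrite mulrC -ler_pdivlMr// ltr_wpDl.
Unshelve. all: by end_near. Qed.

(** Differentiation under the integral sign: a quadratic remainder that is uniform in [x] survives
    integration and determines the derivative. *)
Lemma is_derive_itg (u u1 : R -> R -> R) C s a b : a <= b ->
  (forall s, continuous (u s)) -> continuous (u1 s) ->
  (forall t x, `|u (s + t) x - u s x - t * u1 s x| <= C * t ^+ 2) ->
  is_derive s (1 : R) (fun s => itg a b (u s)) (itg a b (u1 s)).
Proof.
move=> ab cu cu1 H; apply: (@is_derive_quadratic _ _ _ (C * (b - a))) => t.
have ctu : continuous (fun x => t * u1 s x).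
  by apply: continuous_fM => // ?; exact: cst_continuous.
rewrite -itgZl// -itgB; [|exact: cu|exact: cu].
rewrite -itgB//; last exact: continuous_fB.
rewrite mulrAC; apply: itg_bound => //.
exact: (continuous_fB (continuous_fB (cu _) (cu _)) ctu).
Qed.

Lemma lipschitz_continuous f L : (forall x y, `|f x - f y| <= L * `|x - y|) ->
  continuous f.
Proof.
move=> fL x; have L0 : 0 <= L.
  by have := le_trans (normr_ge0 _) (fL (x+1) x); rewrite addrAC subrr add0r normr1 mulr1.
apply/cvgrPdist_le => e e0; near=> y.
apply: le_trans (fL x y) _.
apply: le_trans (_ : (L + 1) * `|x - y| <= _); first by rewrite ler_wpM2r// lerDl.
rewrite mulrC -ler_pdivlMr ?ltr_wpDl//.
near: y; apply: cvgr_dist_le; first exact: cvg_id.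
by rewrite divr_gt0// ltr_wpDl.
Unshelve. all: by end_near. Qed.

Lemma itg_periodicN (f : R -> R) s (T : R) : 0 <= T -> continuous f ->
  (forall t, f (t + T) = f t) -> itg 0 T (fun x => f (s - x)) = itg 0 T f.
Proof.
move=> T0 cf fT; have [F Ff] := primitive cf.
have dB r : is_derive r (1 : R) (fun x => s - x) (- 1).
  by apply: (isd_eq _ (isdB (isd_cst s r) (isd_id r))); rewrite sub0r.
have dF r : is_derive r (1 : R) (fun x => - F (s - x)) (f (s - r)).
  by apply: (isd_eq _ (isdN (isd_comp (dB r) (Ff (s - r))))); ring.
have cfs : continuous (fun t => f (s - t)).
  move=> x; apply: continuous_comp; last exact: cf.
  by apply: continuousB; [exact: cst_continuous|exact: cvg_id].
have D r : is_derive r (1 : R) (fun x => F (x + T) - F x) 0.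
  apply: (isd_eq _ (isdB (isd_comp (isdD (isd_id r) (isd_cst T r)) (Ff _)) (Ff r))).
  by rewrite fT; ring.
rewrite (itg_derive T0 dF cfs) (itg_derive T0 Ff cf).
have := derive0_const D (s - T) 0; rewrite subrK add0r subr0.
by move=> <-; ring.
Qed.

Lemma itg_antiperiodic (f : R -> R) : continuous f ->
  (forall t, f (t + pi) = - f t) -> itg 0 (2 * pi) f = 0.
Proof.
move=> cf fpi; have pi0 := pi_ge0 R.
have : itg 0 (2 * pi) (fun x => f (x + pi)) = itg 0 (2 * pi) f.
  apply: itg_periodic => // [|x]; first by rewrite mulr_ge0.
  by rewrite mulr_natl mulr2n addrA !fpi opprK.
rewrite (@eq_itg _ (fun x => (-1) * f x)); last by move=> x _; rewrite fpi mulN1r.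
rewrite itgZl//; set I := itg _ _ _; lra.
Qed.

Lemma isd_unique (f : R -> R) s c d : is_derive s (1 : R) f c ->
  is_derive s (1 : R) f d -> c = d.
Proof. by move=> [_ <-] [_ <-]. Qed.

(** The passage to the limit behind the exact identities. In the second-difference arguments [z] is
    the sine of a small arc, and [z <= 2^-1] keeps its cosine away from [0]. *)
Lemma eq0_of_small d K : (forall z, 0 < z <= 2^-1 -> `|d| <= K * z) -> d = 0.
Proof.
move=> dK; apply/eqP; rewrite -normr_le0 leNgt; apply/negP => d0.
have K0 : 0 < K by have := dK 2^-1; rewrite lexx andbT invr_gt0 ltr0n => /(_ isT); lra.
pose z := Num.min 2^-1 (`|d| / (2 * K)).
have z0 : 0 < z by rewrite lt_min invr_gt0 ltr0n /= divr_gt0// mulr_gt0.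
have z1 : z <= 2^-1 by rewrite ge_min lexx.
have := dK z; rewrite z0 z1 => /(_ isT).
have : K * z <= `|d| / 2.
  have zK : z <= `|d| / (2 * K) by rewrite ge_min lexx orbT.
  apply: le_trans (ler_wpM2l (ltW K0) zK) _.
  by rewrite (_ : K * _ = `|d| / 2)//; field; rewrite gt_eqF.
lra.
Qed.

End Real_line.

(** * Flags and great circles *)

Section Euclidean.
Context {R : realType}.
Implicit Types (x y z u v a b : 'rV[R]_3) (s t k C : R).

Lemma dot_sum x y : dot x y = \sum_i x 0 i * y 0 i.
Proof. by rewrite /dot mxE; apply: eq_bigr => i _; rewrite mxE. Qed.

Lemma dotC x y : dot x y = dot y x.
Proof. by rewrite !dot_sum; apply: eq_bigr => i _; rewrite mulrC. Qed.

Lemma dotDl x y z : dot (x + y) z = dot x z + dot y z.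
Proof. by rewrite /dot mulmxDl mxE. Qed.

Lemma dotZl k x y : dot (k *: x) y = k * dot x y.
Proof. by rewrite /dot -scalemxAl mxE. Qed.

Lemma dotNl x y : dot (- x) y = - dot x y.
Proof. by rewrite -scaleN1r dotZl mulN1r. Qed.

Lemma dotDr x y z : dot x (y + z) = dot x y + dot x z.
Proof. by rewrite ![dot x _]dotC dotDl. Qed.

Lemma dotZr k x y : dot x (k *: y) = k * dot x y.
Proof. by rewrite ![dot x _]dotC dotZl. Qed.

Lemma dotNr x y : dot x (- y) = - dot x y.
Proof. by rewrite ![dot x _]dotC dotNl. Qed.

Definition dotE := (dotDl, dotDr, dotZl, dotZr, dotNl, dotNr).

Lemma dot0l x : dot 0 x = 0.
Proof. by rewrite -(scale0r (0 : 'rV[R]_3)) dotZl mul0r. Qed.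

Lemma dot_ge0 x : 0 <= dot x x.
Proof. by rewrite dot_sum sumr_ge0// => i _; rewrite -expr2 sqr_ge0. Qed.

Lemma dot_eq0 x : dot x x = 0 -> x = 0.
Proof.
rewrite dot_sum => /eqP; rewrite psumr_eq0 => [/allP x0|i _]; last first.
  by rewrite -expr2 sqr_ge0.
apply/rowP => i; rewrite mxE; apply/eqP.
by have := x0 i (mem_index_enum i); rewrite /= mulf_eq0 orbb.
Qed.

Lemma coord_le_norm x i : `|x 0 i| <= `|x|.
Proof.
rewrite [leRHS]mx_normrE.
exact: (le_bigmax _ (fun ij : 'I_1 * 'I_3 => `|x ij.1 ij.2|) (0, i)).
Qed.

Lemma norm_row_le x C : 0 <= C -> (forall i, `|x 0 i| <= C) -> `|x| <= C.
Proof.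
by move=> C0 xC; rewrite [leLHS]mx_normrE; apply: bigmax_le => // -[i j] _; rewrite ord1.
Qed.

Lemma sphere_norm_le1 x : sphere x -> `|x| <= 1.
Proof.
rewrite /sphere/= dot_sum => x1; apply: norm_row_le => // i.
rewrite -(ler_pXn2r (ltn0Sn 1)) ?nnegrE// expr1n -x1 real_normK ?num_real//.
rewrite (bigD1 i)//= expr2 lerDl sumr_ge0// => j _.
by rewrite -expr2 sqr_ge0.
Qed.

Lemma normr_dot_le x y : `|dot x y| <= 3 * `|x| * `|y|.
Proof.
rewrite dot_sum (le_trans (ler_norm_sum _ _ _))//.
apply: (le_trans (_ : _ <= \sum_(i < 3) `|x| * `|y|)).
  by apply: ler_sum => i _; rewrite normrM ler_pM// coord_le_norm.
by rewrite big_const_ord /= addr0 -mulrA; set k := _ * _; lra.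
Qed.

Lemma flag_dot x u : flag x u -> [/\ dot x x = 1, dot u u = 1, dot x u = 0 & dot u x = 0].
Proof. by move=> [x1 [u1 xu]]; split=> //; rewrite dotC. Qed.

Lemma flagP x u : dot x x = 1 -> dot u u = 1 -> dot x u = 0 -> flag x u.
Proof. by split. Qed.

Lemma flag_sym x u : flag x u -> flag u x.
Proof. by move=> /flag_dot[? ? ? ?]; exact: flagP. Qed.

Lemma flagN x u : flag x u -> flag x (- u).
Proof. by move=> /flag_dot[? ? xu ?]; apply: flagP; rewrite ?dotE ?opprK// xu oppr0. Qed.

Lemma flag_normN x u : flag x u -> flag (- x) u.
Proof. by move=> /flag_sym/flagN/flag_sym. Qed.

(** A great circle at unit speed, with velocity [circ u (- x) t]; point and velocity together are
    the flag [(x, u)] transported along the circle. *)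
Definition circ x u t : 'rV[R]_3 := cos t *: x + sin t *: u.

Lemma circ0 x u : circ x u 0 = x.
Proof. by rewrite /circ cos0 sin0 scale1r scale0r addr0. Qed.

Lemma circN x u t : circ (- x) (- u) t = - circ x u t.
Proof. by rewrite /circ !scalerN opprD. Qed.

Lemma circ_opp x u t : circ x u (- t) = circ x (- u) t.
Proof. by rewrite /circ cosN sinN scaleNr scalerN. Qed.

Lemma circD x u s t : circ x u (s + t) = circ (circ x u s) (circ u (- x) s) t.
Proof.
rewrite /circ cosD sinD; apply/rowP => i; rewrite !mxE; ring.
Qed.

Lemma circDpi x u t : circ x u (t + pi) = - circ x u t.
Proof. by rewrite /circ cosDpi sinDpi !scaleNr opprD. Qed.

Lemma circDpihalf x u t : circ x u (t + pi / 2) = circ u (- x) t.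
Proof. by rewrite /circ cosDpihalf sinDpihalf scalerN scaleNr addrC. Qed.

Lemma circ_pihalf x u : circ x u (pi / 2) = u.
Proof. by rewrite /circ cos_pihalf sin_pihalf scale0r add0r scale1r. Qed.

Lemma dot_circl x u t y : dot (circ x u t) y = cos t * dot x y + sin t * dot u y.
Proof. by rewrite /circ !dotE. Qed.

Lemma scale_circ k x u t : k *: circ x u t = (k * cos t) *: x + (k * sin t) *: u.
Proof. by rewrite /circ scalerDr !scalerA. Qed.

Lemma flag_circ x u t : flag x u -> flag (circ x u t) (circ u (- x) t).
Proof.
move=> /flag_dot[xx uu xu ux].
have ct := cos2Dsin2 t.
by apply: flagP; rewrite /circ !dotE xx uu xu ux; [rewrite -[RHS]ct; ring..|ring].
Qed.

Lemma sphere_circ x u t : flag x u -> sphere (circ x u t).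
Proof. by move=> /(flag_circ t)[]. Qed.

Lemma lipschitz_cos s t : `|cos s - cos t| <= `|s - t| :> R.
Proof.
rewrite -[leRHS]mul1r.
apply: (lipschitz_derive (@is_derive_cos R)) => x _.
by rewrite normrN sin_max.
Qed.

Lemma lipschitz_sin s t : `|sin s - sin t| <= `|s - t| :> R.
Proof.
rewrite -[leRHS]mul1r.
apply: (@lipschitz_derive _ sin cos) => x _.
exact: cos_max.
Qed.

Lemma circ_lipschitz x u s t : flag x u -> `|circ x u s - circ x u t| <= 2 * `|s - t|.
Proof.
move=> xu; have x1 := sphere_norm_le1 xu.1; have u1 := sphere_norm_le1 xu.2.1.
have -> : circ x u s - circ x u t = (cos s - cos t) *: x + (sin s - sin t) *: u.
  by rewrite /circ; apply/rowP => i; rewrite !mxE; ring.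
rewrite (le_trans (ler_normD _ _))// !normrZ mulr_natl mulr2n lerD//.
  by rewrite -[leRHS]mulr1 ler_pM// lipschitz_cos.
by rewrite -[leRHS]mulr1 ler_pM// lipschitz_sin.
Qed.

Lemma circ_dist x u y v t : `|circ x u t - circ y v t| <= `|x - y| + `|u - v|.
Proof.
have -> : circ x u t - circ y v t = cos t *: (x - y) + sin t *: (u - v).
  by rewrite /circ; apply/rowP => i; rewrite !mxE; ring.
by rewrite (le_trans (ler_normD _ _))// !normrZ lerD// ler_piMl ?cos_max ?sin_max.
Qed.

Lemma polar s t : s ^+ 2 + t ^+ 2 = 1 ->
  exists2 r : R, 0 <= r < 2 * pi & s = cos r /\ t = sin r.
Proof.
move=> st; have s1 : -1 <= s <= 1.
  by rewrite -ler_norml -(ler_pXn2r (ltn0Sn 1)) ?nnegrE// expr1n real_normK ?num_real//; have := sqr_ge0 t; lra.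
have t2 : t ^+ 2 = sin (acos s) ^+ 2 by rewrite sin2cos2 acosK ?in_itv//= -st; ring.
have pi0 := pi_gt0 R.
have a0 := acos_ge0 s1; have api := acos_lepi s1.
have sa : 0 <= sin (acos s) by apply: sin_ge0_pi; rewrite a0.
have [t0|t0] := leP 0 t.
  exists (acos s); first by rewrite a0/=; lra.
  rewrite acosK ?in_itv//; split => //; apply/eqP.
  by rewrite -(eqrXn2 (ltn0Sn 1))// t2.
have a_gt0 : 0 < acos s.
  rewrite lt_neqAle a0 andbT eq_sym; apply: contraTneq t0 => a0'.
  by rewrite -leNgt; move/eqP: t2; rewrite a0' sin0 expr0n sqrf_eq0 => /eqP ->.
exists (2 * pi - acos s); first by apply/andP; split; lra.
rewrite mulr_natl cosB sinB cos2pi sin2pi acosK ?in_itv//; split; first by ring.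
rewrite mul0r mul1r sub0r; apply/eqP; rewrite -eqr_oppLR -(eqrXn2 (ltn0Sn 1))// ?sqrrN ?t2// oppr_ge0 ltW//.
Qed.

Definition frame x a b : Prop := [/\ flag x a, flag x b & flag a b].

Lemma frame_decomp x a b y : frame x a b ->
  y = dot y x *: x + dot y a *: a + dot y b *: b.
Proof.
move=> [/flag_dot[xx aa xa ax] /flag_dot[_ bb xb bx] /flag_dot[_ _ ab ba]].
pose M : 'M[R]_3 := \matrix_(i, j) [tuple x; a; b]`_i 0 j.
have MMt : M *m M^T = 1%:M.
  apply/matrixP => i j; rewrite !mxE.
  have -> : \sum_k M i k * M^T k j = dot [tuple x; a; b]`_i [tuple x; a; b]`_j.
    by rewrite dot_sum; apply: eq_bigr => k _; rewrite !mxE.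
  by case: i => [[|[|[|]]]]//= ?; case: j => [[|[|[|]]]]//= ?.
have /mulmx1C MtM := MMt.
rewrite -[LHS]mulmx1 -MtM mulmxA.
have yM : y *m M^T = \row_i dot y [tuple x; a; b]`_i.
  by apply/rowP => i; rewrite !mxE dot_sum; apply: eq_bigr => k _; rewrite !mxE.
apply/rowP => j; rewrite yM !mxE !big_ord_recl big_ord0 !mxE /= addr0 -addrA.
by [].
Qed.

Lemma frame_great_circle x a b u : frame x a b -> flag x u ->
  exists2 t : R, 0 <= t < 2 * pi & u = circ a b t.
Proof.
move=> fr xu; have := frame_decomp u fr.
have [_ uu _ ux] := flag_dot xu; rewrite ux scale0r add0r => uE.
case: fr => [/flag_dot[_ aa _ _] /flag_dot[_ bb _ _] /flag_dot[_ _ ab ba]].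
have /polar[t t0 [ct st]] : dot u a ^+ 2 + dot u b ^+ 2 = 1.
  by rewrite -uu [in RHS]uE !dotE aa bb ab ba; ring.
by exists t => //; rewrite /circ -ct -st.
Qed.

Lemma frame_rot x a b t : frame x a b -> frame x (circ a b t) (circ b (- a) t).
Proof.
move=> [/flag_dot[xx aa xa ax] /flag_dot[_ bb xb bx] fab].
split; last exact: flag_circ.
  by apply: flagP => //; [exact: sphere_circ|rewrite /circ !dotE xa xb; ring].
apply: flagP => //; last by rewrite /circ !dotE xa xb; ring.
by have [_ [+ _]] := flag_circ t fab.
Qed.

(** The moving frame of spherical coordinates with pole [x]: the point of longitude [phi] and
    latitude [nu], then its northward and its eastward unit tangent. *)
Lemma frame_meridian x a b phi nu : frame x a b ->
  frame (circ (circ a b phi) x nu) (circ x (- circ a b phi) nu) (circ b (- a) phi).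
Proof.
move=> fr; have [xr /flag_dot[xx ee xe _] /flag_dot[_ _ re _]] := frame_rot phi fr.
have PT := flag_circ nu (flag_sym xr).
split=> //; apply: flagP => //.
- exact: PT.1.
- by rewrite dot_circl xe re; ring.
- exact: PT.2.1.
- by rewrite dot_circl dotNl xe re; ring.
Qed.

(** Two linear equations in three unknowns have a nonzero solution. With [y = x] this provides a
    tangent direction at [x], and with both vectors [0] a point of the sphere. *)
Lemma exists_common_tangent x y : exists u, [/\ sphere u, dot x u = 0 & dot y u = 0].
Proof.
pose A : 'M[R]_(3, 1 + 1) := row_mx x^T y^T.
have : kermx A != 0.
  rewrite -mxrank_eq0 mxrank_ker -lt0n subn_gt0.
  by rewrite (leq_ltn_trans (rank_leq_col A)).
case/rowV0Pn => v /sub_kermxP vA v0.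
have vxy : row_mx (v *m x^T) (v *m y^T) = row_mx (0 : 'M[R]_(1, 1)) (0 : 'M[R]_(1, 1)).
  by rewrite -mul_mx_row -/A vA row_mx0.
have [vx vy] := eq_row_mx vxy.
have vv : 0 < dot v v.
  rewrite lt_neqAle dot_ge0 andbT eq_sym; apply: contra v0 => /eqP/dot_eq0 ->.
  by rewrite eqxx.
exists ((Num.sqrt (dot v v))^-1 *: v); split.
- rewrite /sphere/= !dotE mulrA -expr2 exprVn sqr_sqrtr ?ltW// mulVf//.
  by rewrite gt_eqF.
- by rewrite dotC dotZl [dot v x](_ : _ = 0) ?mulr0// /dot vx mxE.
- by rewrite dotC dotZl [dot v y](_ : _ = 0) ?mulr0// /dot vy mxE.
Qed.

Lemma exists_frame x u : flag x u -> exists v, frame x u v.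
Proof.
move=> xu; have [v [v1 xv uv]] := exists_common_tangent x u.
have [xx uu _ _] := flag_dot xu.
by exists v; split => //; exact: flagP.
Qed.

Definition flag_lipschitz (q : 'rV[R]_3 -> 'rV[R]_3 -> R) C :=
  forall x u y v, flag x u -> flag y v ->
    `|q x u - q y v| <= C * (`|x - y| + `|u - v|).

Lemma flag_lipschitz_ge0 q C : flag_lipschitz q C -> 0 <= C.
Proof.
move=> qC.
have [u [u1 _ _]] := exists_common_tangent 0 0.
have [v [v1 uv _]] := exists_common_tangent u u.
have uv' : flag u v by exact: flagP.
have uu : dot (- u - u) (- u - u) = 4.
  by rewrite !dotE (u1 : dot u u = 1); ring.
have n0 : 0 < `|- u - u|.
  rewrite normr_gt0; apply/eqP => u0; move: uu; rewrite u0 dot0l => /eqP.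
  by rewrite eq_sym pnatr_eq0.
have := le_trans (normr_ge0 _) (qC _ _ _ _ (flag_normN uv') uv').
by rewrite subrr normr0 addr0 pmulr_lge0.
Qed.

Lemma flag_lipschitz_bounded q C : flag_lipschitz q C ->
  exists2 M, 0 <= M & forall x u, flag x u -> `|q x u| <= M.
Proof.
move=> qC; have C0 := flag_lipschitz_ge0 qC.
have [u [u1 _ _]] := exists_common_tangent 0 0.
have [v [v1 uv _]] := exists_common_tangent u u.
have uv' : flag u v by exact: flagP.
have bd x y : sphere x -> sphere y -> `|x - y| <= 2.
  move=> /sphere_norm_le1 x1 /sphere_norm_le1 y1.
  by rewrite (le_trans (ler_normB _ _))//; lra.
exists (`|q u v| + C * 4) => [|x w xw]; first by rewrite addr_ge0// mulr_ge0.
rewrite -[q x w](subrK (q u v)) addrC (le_trans (ler_normD _ _))// lerD2l.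
rewrite (le_trans (qC _ _ _ _ xw uv'))// ler_wpM2l//.
have := bd _ _ xw.1 u1; have := bd _ _ xw.2.1 v1; lra.
Qed.

End Euclidean.

(** * The curvature form of an even function *)

Section Curvature.
Context {R : realType}.
Implicit Types (x y u v a b : 'rV[R]_3) (s t w z C K d : R).

Notation mu := (@lebesgue_measure R).
Notation itg a b f := (\int[mu]_(x in `[a, b]) f x).

(* A function [h] on the sphere together with its curvature function
   [q x u = h x + (second derivative of h at x along u)]. *)
Record curvature_pair (h : 'rV[R]_3 -> R) (q : 'rV[R]_3 -> 'rV[R]_3 -> R) : Prop := {
  curv_even : forall x, sphere x -> h (- x) = h x;
  curv_lip : exists C, flag_lipschitz q C;
  curv_ode : forall x u, flag x u -> exists p1 : R -> R,
    (forall t, is_derive t (1 : R) (fun t => h (circ x u t)) (p1 t)) /\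
    (forall t, is_derive t (1 : R) p1
       (q (circ x u t) (circ u (- x) t) - h (circ x u t))) }.

Section Pair.
Variables (h : 'rV[R]_3 -> R) (q : 'rV[R]_3 -> 'rV[R]_3 -> R).
Hypothesis hq : curvature_pair h q.

Lemma circ_near x u t : flag x u -> 0 <= cos t -> `|circ x u t - x| <= 2 * `|sin t|.
Proof.
move=> xu c0; have x1 := sphere_norm_le1 xu.1; have u1 := sphere_norm_le1 xu.2.1.
have -> : circ x u t - x = (cos t - 1) *: x + sin t *: u.
  by rewrite /circ; apply/rowP => i; rewrite !mxE; ring.
rewrite (le_trans (ler_normD _ _))// !normrZ.
have sc : `|cos t - 1| <= `|sin t|.
  rewrite -(ler_pXn2r (ltn0Sn 1)) ?nnegrE// !real_normK ?num_real// sin2cos2.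
  have := cos_le1 t; nra.
have := normr_ge0 (sin t); have := normr_ge0 (cos t - 1).
have := normr_ge0 x; have := normr_ge0 u; nra.
Qed.

Section Lip.
Variable C : R.
Hypothesis qC : flag_lipschitz q C.

Lemma curvature_circ_near x u t : flag x u -> 0 <= cos t ->
  `|q (circ x u t) (circ u (- x) t) - q x u| <= 4 * C * `|sin t|.
Proof.
move=> xu c0; have C0 := flag_lipschitz_ge0 qC.
rewrite (le_trans (qC (flag_circ t xu) xu))//.
rewrite (_ : 4 * C * _ = C * (4 * `|sin t|)); last by ring.
rewrite ler_wpM2l//.
have := circ_near xu c0; have := circ_near (flagN (flag_sym xu)) c0; lra.
Qed.

(** The function of [t] being estimated vanishes at [0] together with its derivative. For it,
    [y'' + y] is [k t + k (- t) - 2 q x u], at most [8 C sin t] on the interval, and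
    [oscillator_bound] supplies the factor [1 - cos t]. *)
Lemma second_difference_circ x u t : flag x u -> 0 <= t <= pi / 2 ->
  `|h (circ x u t) + h (circ x u (- t)) - 2 * cos t * h x
    - 2 * (1 - cos t) * q x u| <= 8 * C * sin t * (1 - cos t).
Proof.
move=> xu /andP[t0 t2]; have C0 := flag_lipschitz_ge0 qC.
have [p1 [dp dp1]] := curv_ode hq xu.
have pi0 := pi_gt0 R.
pose k t := q (circ x u t) (circ u (- x) t).
pose p t := h (circ x u t).
have dneg s : is_derive s (1 : R) (fun s => - s) (-1) by exact: (isdN (isd_id s)).
have dy s : is_derive s (1 : R)
    (fun t => p t + p (- t) - 2 * cos t * p 0 - 2 * (1 - cos t) * q x u)
    (p1 s - p1 (- s) + 2 * sin s * p 0 - 2 * sin s * q x u).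
  apply: (isd_eq _ (isdB (isdB (isdD (dp s) (isd_comp (dneg s) (dp (- s))))
     (isdM (isdM (isd_cst 2 s) (is_derive_cos s)) (isd_cst (p 0) s)))
     (isdM (isdM (isd_cst 2 s) (isdB (isd_cst 1 s) (is_derive_cos s))) (isd_cst (q x u) s)))).
  by ring.
have dy1 s : is_derive s (1 : R)
    (fun s => p1 s - p1 (- s) + 2 * sin s * p 0 - 2 * sin s * q x u)
    ((k s - p s) + (k (- s) - p (- s)) + 2 * cos s * p 0 - 2 * cos s * q x u).
  apply: (isd_eq _ (isdB (isdD (isdB (dp1 s) (isd_comp (dneg s) (dp1 (- s))))
     (isdM (isdM (isd_cst 2 s) (is_derive_sin s)) (isd_cst (p 0) s)))
     (isdM (isdM (isd_cst 2 s) (is_derive_sin s)) (isd_cst (q x u) s)))).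
  by rewrite /k /p; ring.
have := @oscillator_bound _ _ _ _ t (8 * C * sin t) _ dy dy1.
rewrite /= /p oppr0 circ0 cos0 sin0; apply.
- lra.
- ring.
- ring.
- move=> s /andP[s0 st].
  have cs : 0 <= cos s by apply: cos_ge0_pihalf; lra.
  have cNs : 0 <= cos (- s) by rewrite cosN.
  have ss : `|sin s| <= sin t.
    rewrite ger0_norm ?sin_ge0_pi//; last by lra.
    move: st; rewrite le_eqVlt => /predU1P[->//|st].
    by rewrite ltW// ltr_sin ?in_itv//=; lra.
  have h1 := curvature_circ_near xu cs.
  have h2 := curvature_circ_near xu cNs.
  rewrite sinN normrN in h2.
  rewrite (_ : _ + _ = (k s - q x u) + (k (- s) - q x u)); last by rewrite /k; ring.
  rewrite (le_trans (ler_normD _ _))//.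
  have : 4 * C * `|sin s| <= 4 * C * sin t by rewrite ler_wpM2l// mulr_ge0.
  rewrite /k; lra.
Qed.

(** Cosine and sine replace the angle: later the same points are reached along different great
    circles, where [w] and [z] are easier to express than the arc. *)
Lemma second_difference x u w z : flag x u -> 0 <= w -> w ^+ 2 + z ^+ 2 = 1 ->
  `|h (w *: x + z *: u) + h (w *: x - z *: u) - 2 * w * h x
    - 2 * (1 - w) * q x u| <= 8 * C * `|z| * (1 - w).
Proof.
move=> xu w0 wz.
wlog z0 : z wz / 0 <= z.
  have [|/ltW z0 H] := leP 0 z; first by move=> z0; apply.
  have := H (- z); rewrite sqrrN oppr_ge0 scaleNr opprK normrN => /(_ wz z0).
  by rewrite [h (w *: x - z *: u) + _]addrC.
have w1 : -1 <= w <= 1 by nra.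
have pi0 := pi_gt0 R.
have cw : cos (acos w) = w by rewrite acosK ?in_itv.
have a0 : 0 <= acos w <= pi / 2.
  rewrite acos_ge0//= leNgt; apply/negP => aw.
  suff : w < 0 by lra.
  rewrite -cw -(@cos_pihalf R) ltr_cos ?in_itv//= ?acos_ge0 ?acos_lepi//; lra.
have sz : sin (acos w) = z.
  rewrite sin_acos// (_ : 1 - w ^+ 2 = z ^+ 2); last by rewrite -wz; ring.
  by rewrite sqrtr_sqr ger0_norm.
have := second_difference_circ xu a0.
by rewrite circ_opp /circ cw sz scalerN [`|z|]ger0_norm.
Qed.

End Lip.

(** Second differences along [u] and [- u] coincide, while the terms with [q] carry the factor
    [1 - w]; dividing by it leaves an error [O(z)]. *)
Lemma curvatureN x u : flag x u -> q x (- u) = q x u.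
Proof.
move=> xu; have [C qC] := curv_lip hq; have C0 := flag_lipschitz_ge0 qC.
apply/eqP; rewrite -subr_eq0; apply/eqP; apply: (@eq0_of_small _ _ (8 * C)) => z /andP[z0 z1].
pose w := Num.sqrt (1 - z ^+ 2).
have w0 : 0 <= w by exact: sqrtr_ge0.
have wz : w ^+ 2 + z ^+ 2 = 1 by rewrite sqr_sqrtr ?subrK//; nra.
have w1 : 0 < 1 - w by nra.
have := second_difference qC xu w0 wz.
have := second_difference qC (flagN xu) w0 wz.
rewrite scalerN opprK (gtr0_norm z0) [h (w *: x - _) + _]addrC.
set S := h _ + _ - _ => H1 H2.
rewrite -(ler_pM2r w1) -[X in _ * X](gtr0_norm w1) -normrM.
move: H1 H2; rewrite !ler_norml => /andP[a1 a2] /andP[b1 b2]; lra.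
Qed.

(** The parallelogram law that makes [q x] a quadratic form. The points [w x + z (c a + s b)], with
    all choices of signs of [c] and [s], form a rectangle symmetric about [x], with diagonals in the
    directions [circ a b t] and [circ a (- b) t]. Its sides parallel to [a] are centred above
    [w' x + z' b] and [w' x - z' b], which are themselves symmetric about [x] in the direction [b].
    Second differences along the diagonals, the sides and the midline compare the same values of
    [h]. *)
Lemma curvature_rhombus x a b t : frame x a b ->
  q x (circ a b t) + q x (circ a (- b) t) =
  2 * cos t ^+ 2 * q x a + 2 * sin t ^+ 2 * q x b.
Proof.
move=> [xa xb ab]; have [C qC] := curv_lip hq; have C0 := flag_lipschitz_ge0 qC.
have [M M0 qM] := flag_lipschitz_bounded qC.
apply/eqP; rewrite -subr_eq0; apply/eqP.
apply: (@eq0_of_small _ _ (40 * C + 4 * M)) => z /andP[z0 z1].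
set c := cos t; set s := sin t; have cs : c ^+ 2 + s ^+ 2 = 1 := cos2Dsin2 t.
pose w := Num.sqrt (1 - z ^+ 2).
have w0 : 0 <= w by exact: sqrtr_ge0.
have wz : w ^+ 2 + z ^+ 2 = 1 by rewrite sqr_sqrtr ?subrK//; nra.
have w2 : 2^-1 <= w by nra.
have w1 : 0 < 1 - w by nra.
(* [k] is the length of [w x + z s b], the midpoint of a side, and [w' x + z' b] is its radial
   projection to the sphere; seen from there, the corners lie at an arc with cosine [k] and sine
   [z c]. *)
pose k := Num.sqrt (w ^+ 2 + (z * s) ^+ 2).
have k0 : 0 <= k by exact: sqrtr_ge0.
have kE : k ^+ 2 = w ^+ 2 + (z * s) ^+ 2 by rewrite sqr_sqrtr// addr_ge0// sqr_ge0.
have wk : w <= k by rewrite -(ler_pXn2r (ltn0Sn 1))// kE lerDl sqr_ge0.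
have kz : k ^+ 2 + (z * c) ^+ 2 = 1 by rewrite kE -[RHS]wz -[X in _ = _ + X]mulr1 -cs; ring.
have k1 : k <= 1 by have := sqr_ge0 (z * c); nra.
have kgt0 : 0 < k by lra.
pose w' := w / k; pose z' := z * s / k.
have w'0 : 0 <= w' by rewrite divr_ge0.
have wz' : w' ^+ 2 + z' ^+ 2 = 1.
  by rewrite !expr_div_n -mulrDl -kE divff// expf_neq0// gt_eqF.
have kw' : k * w' = w by rewrite /w'; field; rewrite gt_eqF.
have kz' : k * z' = z * s by rewrite /z'; field; rewrite gt_eqF.
have [xx aa xa0 ax0] := flag_dot xa; have [_ bb xb0 bx0] := flag_dot xb.
have [_ _ ab0 ba0] := flag_dot ab.
have fm e : e ^+ 2 = z' ^+ 2 -> flag (w' *: x + e *: b) a.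
  move=> e2; apply: flagP => //; rewrite !dotE ?xx ?bb ?xa0 ?ba0 ?xb0 ?bx0; last by ring.
  by rewrite -[RHS]wz' -e2; ring.
have xup : flag x (circ a b t).
  by apply: flagP => //; [exact: sphere_circ|rewrite /circ !dotE xa0 xb0; ring].
have xum : flag x (circ a (- b) t).
  by apply: flagP => //; [apply: sphere_circ; exact: flagN|rewrite /circ !dotE xa0 xb0; ring].
have S1 := second_difference qC xup w0 wz.
have S1' := second_difference qC xum w0 wz.
have S2 := second_difference qC (fm z' erefl) k0 kz.
have S2' := second_difference qC (fm (- z') (sqrrN z')) k0 kz.
have S3 := second_difference qC xb w'0 wz'.
have e1 : k *: (w' *: x + z' *: b) + (z * c) *: a = w *: x + z *: circ a b t.
  by rewrite scalerDr !scalerA kw' kz' /circ -/c -/s; apply/rowP => i; rewrite !mxE; ring.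
have e2 : k *: (w' *: x + z' *: b) - (z * c) *: a = w *: x - z *: circ a (- b) t.
  by rewrite scalerDr !scalerA kw' kz' /circ -/c -/s; apply/rowP => i; rewrite !mxE; ring.
have e3 : k *: (w' *: x + - z' *: b) + (z * c) *: a = w *: x + z *: circ a (- b) t.
  by rewrite scalerDr !scalerA mulrN kw' kz' /circ -/c -/s; apply/rowP => i; rewrite !mxE; ring.
have e4 : k *: (w' *: x + - z' *: b) - (z * c) *: a = w *: x - z *: circ a b t.
  by rewrite scalerDr !scalerA mulrN kw' kz' /circ -/c -/s; apply/rowP => i; rewrite !mxE; ring.
rewrite e1 e2 in S2; rewrite e3 e4 in S2'.
have near e : e ^+ 2 = z' ^+ 2 -> `|q (w' *: x + e *: b) a - q x a| <= 4 * C * z.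
  move=> e2'; rewrite (le_trans (qC _ _ _ _ (fm e e2') xa))//.
  rewrite subrr normr0 addr0 (_ : 4 * C * z = C * (4 * z)); last by ring.
  rewrite ler_wpM2l//.
  have -> : w' *: x + e *: b - x = (w' - 1) *: x + e *: b.
    by apply/rowP => i; rewrite !mxE; ring.
  have ez : `|e| = `|z'| by apply/eqP; rewrite -(eqrXn2 (ltn0Sn 1))// !real_normK ?num_real// e2'.
  have z'2 : `|z'| <= 2 * z.
    rewrite /z' normrM (gtr0_norm (_ : 0 < k^-1)) ?invr_gt0// ler_pdivrMr//.
    rewrite normrM (gtr0_norm z0); have := sin_max t; rewrite -/s; nra.
  have w'1 : `|w' - 1| <= `|z'|.
    rewrite -(ler_pXn2r (ltn0Sn 1)) ?nnegrE// !real_normK ?num_real//.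
    have : w' <= 1 by have := sqr_ge0 z'; nra.
    by nra.
  have x1 := sphere_norm_le1 xa.1; have b1 := sphere_norm_le1 xb.2.1.
  rewrite (le_trans (ler_normD _ _))// !normrZ ez.
  have := normr_ge0 z'; have := normr_ge0 (w' - 1); have := normr_ge0 x; have := normr_ge0 b; nra.
have N1 := near z' erefl; have N2 := near (- z') (sqrrN z').
have zs : `|z * s| <= z by rewrite normrM (gtr0_norm z0); have := sin_max t; rewrite -/s; nra.
have zc : `|z * c| <= z by rewrite normrM (gtr0_norm z0); have := cos_max t; rewrite -/c; nra.
have S3' : `|2 * k * (h (w' *: x + z' *: b) + h (w' *: x - z' *: b)) - 4 * w * h x
    - 4 * (k - w) * q x b| <= 32 * C * z * (1 - w).
  rewrite (_ : _ - _ = 2 * k * (h (w' *: x + z' *: b) + h (w' *: x - z' *: b) - 2 * w' * h x - 2 * (1 - w') * q x b)); last by rewrite -[w in LHS]kw'; ring.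
  rewrite normrM (ger0_norm (_ : 0 <= 2 * k)); last by clear -k0; lra.
  have kz'n : k * `|z'| <= z by rewrite -(ger0_norm k0) -normrM kz'.
  have w'k : 1 - w' <= 2 * (1 - w).
    by rewrite -(ler_pM2l kgt0) mulrBr mulr1 kw'; nra.
  have w'1 : 0 <= 1 - w' by have := sqr_ge0 z'; nra.
  apply: (@le_trans _ _ (2 * k * (8 * C * `|z'| * (1 - w')))).
    by rewrite ler_wpM2l// mulr_ge0.
  rewrite (_ : 2 * k * _ = 16 * C * (k * `|z'|) * (1 - w')); last by ring.
  have CC : 16 * C * (k * `|z'|) <= 16 * C * z by rewrite ler_wpM2l// mulr_ge0.
  apply: (@le_trans _ _ (16 * C * z * (1 - w'))); first by rewrite ler_wpM2r.
  rewrite (_ : 32 * C * z * (1 - w) = 16 * C * z * (2 * (1 - w))); last by ring.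
  by rewrite ler_wpM2l// !mulr_ge0// ltW.
have CM : 8 * C * `|z * c| * (1 - k) <= 8 * C * z * (1 - w).
  rewrite ler_pM ?mulr_ge0//; [by clear -k1; lra| |by clear -wk; lra].
  by rewrite ler_wpM2l// mulr_ge0.
have NN e : `|e| <= 4 * C * z -> `|2 * (1 - k) * e| <= 8 * C * z * (1 - w).
  move=> eC; rewrite normrM (ger0_norm (_ : 0 <= 2 * (1 - k))); last by clear -k1; lra.
  rewrite (_ : 8 * C * z * (1 - w) = (2 * (1 - w)) * (4 * C * z)); last by ring.
  by rewrite ler_pM//; clear -k1 wk; lra.
have := NN _ N1; have := NN _ N2.
move: S1 S1' S2 S2' S3'.
rewrite (gtr0_norm z0) scaleNr.
set A := h (w *: x + z *: circ a b t); set B := h (w *: x - z *: circ a b t).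
set A' := h (w *: x + z *: circ a (- b) t); set B' := h (w *: x - z *: circ a (- b) t).
set P := h (w' *: x + z' *: b); set Q := h (w' *: x - z' *: b).
set qp := q x (circ a b t); set qm := q x (circ a (- b) t).
set q1 := q (w' *: x + z' *: b) a; set q2 := q (w' *: x - z' *: b) a.
move=> S1 S1' S2 S2' S3' E1 E2.
(* Adding [S2], [S2'], [S3'] and subtracting [S1], [S1'] cancels every value of [h]; [E1] and [E2]
   move the curvatures at the midpoints to [x]. The errors add up to [16 + 16 + 32 + 16 = 80]. *)
have main : `|2 * (1 - w) * (qp + qm) - 4 * (k - w) * q x b - 4 * (1 - k) * q x a| <= 80 * C * z * (1 - w).
  have {}S2 := le_trans S2 CM; have {}S2' := le_trans S2' CM.
  move: S1 S1' S2 S2' S3' E1 E2; rewrite !ler_norml.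
  have : 0 <= C * z * (1 - w) by rewrite !mulr_ge0// ltW.
  set r := C * z * (1 - w); have rE n : n * C * z * (1 - w) = n * r by rewrite /r; ring.
  rewrite !rE.
  by move=> r0 /andP[? ?] /andP[? ?] /andP[? ?] /andP[? ?] /andP[? ?] /andP[? ?] /andP[? ?]; lra.
(* Since [1 - k^2 = c^2 (1 - w^2)], the weights [1 - k] and [k - w] are [c^2 (1 - w)] and
   [s^2 (1 - w)] up to an error [z (1 - w)]. *)
have kc : `|(1 - k) - c ^+ 2 * (1 - w)| <= z * (1 - w).
  have -> : (1 - k) - c ^+ 2 * (1 - w) = - (c ^+ 2 * (1 - w) * (k - w) / (1 + k)).
    have -> : c ^+ 2 * (1 - w) * (k - w) / (1 + k) = c ^+ 2 * (1 - w) - (c ^+ 2 * (1 - w) * (1 + w)) / (1 + k).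
      by field; rewrite gt_eqF//; clear -k0; lra.
    have -> : c ^+ 2 * (1 - w) * (1 + w) = (1 - k) * (1 + k).
      have -> : (1 - k) * (1 + k) = 1 - k ^+ 2 by ring.
      have -> : c ^+ 2 * (1 - w) * (1 + w) = c ^+ 2 * (1 - w ^+ 2) by ring.
      have -> : 1 - w ^+ 2 = z ^+ 2 by rewrite -[1 in LHS]wz; ring.
      by rewrite -[1 in RHS]kz; ring.
    by field; rewrite gt_eqF//; clear -k0; lra.
  have p2 : 0 <= k - w by rewrite subr_ge0.
  have p3 : 0 <= (1 + k)^-1 by rewrite invr_ge0 addr_ge0.
  rewrite normrN ger0_norm; last first.
    by apply: mulr_ge0 p3; apply: mulr_ge0 p2; exact: mulr_ge0 (sqr_ge0 c) (ltW w1).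
  rewrite ler_pdivrMr ?ltr_pwDl//.
  have c1 : c ^+ 2 <= 1 by have := sqr_ge0 s; clear -cs; lra.
  have kwz : k - w <= z by clear -k1 w0 wz z0 z1; nra.
  have cw : c ^+ 2 * (1 - w) <= 1 - w by rewrite ler_piMl// ltW.
  apply: le_trans (ler_pM (mulr_ge0 (sqr_ge0 c) (ltW w1)) p2 cw kwz) _.
  rewrite [z * (1 - w)]mulrC ler_peMr ?lerDl//.
  by rewrite mulr_ge0// ltW.
have ab1 := qM _ _ xa; have ab2 := qM _ _ xb.
rewrite -(ler_pM2r w1) -[X in _ * X <= _](gtr0_norm w1) -normrM.
set e := (1 - k) - c ^+ 2 * (1 - w) in kc.
rewrite (_ : _ * (1 - w) = 2^-1 * (2 * (1 - w) * (qp + qm) - 4 * (k - w) * q x b - 4 * (1 - k) * q x a)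
   + 2 * e * (q x a - q x b)); last first.
  rewrite /e; have -> : s ^+ 2 = 1 - c ^+ 2 by rewrite -cs; ring.
  by field.
rewrite (le_trans (ler_normD _ _))//.
rewrite normrM (ger0_norm (_ : 0 <= 2^-1)) ?invr_ge0// [`|2 * e * _|]normrM [`|2 * e|]normrM [`|2|]ger0_norm//.
have H2 : `|q x a - q x b| <= 2 * M by rewrite (le_trans (ler_normB _ _))// mulr_natl mulr2n lerD.
have : 2 * `|e| * `|q x a - q x b| <= 2 * (z * (1 - w)) * (2 * M).
  by rewrite ler_pM ?mulr_ge0// ler_pM2l.
clear -main; lra.
Qed.

End Pair.
End Curvature.

(** * Functions recovered from their curvature *)

Section Slope.
Context {R : realType}.
Implicit Types (x y u v a b : 'rV[R]_3) (s t w z C K d : R).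

Notation mu := (@lebesgue_measure R).
Notation itg a b f := (\int[mu]_(x in `[a, b]) f x).

Lemma flag_lipschitz_comp (f : 'rV[R]_3 -> 'rV[R]_3 -> R) C (g1 g2 : R -> 'rV[R]_3) :
  flag_lipschitz f C -> (forall s, flag (g1 s) (g2 s)) ->
  (forall s t, `|g1 s - g1 t| <= 2 * `|s - t|) ->
  (forall s t, `|g2 s - g2 t| <= 2 * `|s - t|) ->
  forall s t, `|f (g1 s) (g2 s) - f (g1 t) (g2 t)| <= 4 * C * `|s - t|.
Proof.
move=> fC fg l1 l2 s t; have C0 := flag_lipschitz_ge0 fC.
rewrite (le_trans (fC _ _ _ _ (fg s) (fg t)))//.
rewrite (_ : 4 * C * _ = C * (4 * `|s - t|)); last by ring.
by rewrite ler_wpM2l//; have := l1 s t; have := l2 s t; lra.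
Qed.

Lemma flag_lipschitz_circ (f : 'rV[R]_3 -> 'rV[R]_3 -> R) C x u s t :
  flag_lipschitz f C -> flag x u ->
  `|f (circ x u s) (circ u (- x) s) - f (circ x u t) (circ u (- x) t)| <= 4 * C * `|s - t|.
Proof.
move=> fC xu; apply: (flag_lipschitz_comp (g1 := circ x u) (g2 := circ u (- x)) fC).
- by move=> r; exact: flag_circ.
- by move=> r r'; exact: circ_lipschitz.
- by move=> r r'; apply: circ_lipschitz; exact: flagN (flag_sym xu).
Qed.

Lemma continuous_flag_circ (f : 'rV[R]_3 -> 'rV[R]_3 -> R) C x u :
  flag_lipschitz f C -> flag x u ->
  continuous (fun t => f (circ x u t) (circ u (- x) t)).
Proof.
move=> fC xu; apply: (@lipschitz_continuous _ _ (4 * C)) => s t.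
exact: flag_lipschitz_circ.
Qed.

Lemma circ_tangentD x u s t :
  circ u (- x) (s + t) = circ (circ u (- x) s) (- circ x u s) t.
Proof. by rewrite circD circN. Qed.

(* A solution of [p'' + p = k] with [p], [k] of period pi satisfies
   [2 p(0) = \int_0^pi k(s) sin s ds] and [- 2 p'(0) = \int_0^pi k(s) cos s ds]. *)
Definition half_turn (q : 'rV[R]_3 -> 'rV[R]_3 -> R) x u : R :=
  2^-1 * itg 0 pi (fun s => q (circ x u s) (circ u (- x) s) * sin s).

Definition slope (q : 'rV[R]_3 -> 'rV[R]_3 -> R) x u : R :=
  - 2^-1 * itg 0 pi (fun s => q (circ x u s) (circ u (- x) s) * cos s).

Lemma itg_circ_dist (q q' : 'rV[R]_3 -> 'rV[R]_3 -> R) (k : R -> R) C C' x u y v e :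
  flag_lipschitz q C -> flag_lipschitz q' C' -> flag x u -> flag y v ->
  continuous k -> (forall s, `|k s| <= 1) ->
  (forall s, `|q (circ x u s) (circ u (- x) s) - q' (circ y v s) (circ v (- y) s)| <= e) ->
  `|itg 0 pi (fun s => q (circ x u s) (circ u (- x) s) * k s) -
    itg 0 pi (fun s => q' (circ y v s) (circ v (- y) s) * k s)| <= 4 * e.
Proof.
move=> qC qC' xu yv ck k1 qq'.
have c1 := continuous_flag_circ qC xu; have c2 := continuous_flag_circ qC' yv.
rewrite -itgB; [|exact: continuous_fM..].
have e0 : 0 <= e := le_trans (normr_ge0 _) (qq' 0).
apply: (@le_trans _ _ (e * (pi - 0))).
  apply: itg_bound; [exact: pi_ge0|by apply: continuous_fB; exact: continuous_fM|].
  move=> s _; rewrite -mulrBl normrM -[leRHS]mulr1 ler_pM//; exact: qq'.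
rewrite subr0 mulrC ler_wpM2r//.
by have := @pihalf_lt2 R; lra.
Qed.

Lemma half_turn_dist (q q' : 'rV[R]_3 -> 'rV[R]_3 -> R) C C' x u y v e :
  flag_lipschitz q C -> flag_lipschitz q' C' -> flag x u -> flag y v ->
  (forall s, `|q (circ x u s) (circ u (- x) s) - q' (circ y v s) (circ v (- y) s)| <= e) ->
  `|half_turn q x u - half_turn q' y v| <= 2 * e.
Proof.
move=> qC qC' xu yv qq'; rewrite /half_turn -mulrBr normrM ger0_norm ?invr_ge0//.
have := itg_circ_dist qC qC' xu yv (@continuous_sin R) (@sin_max R) qq'; lra.
Qed.

Lemma slope_dist (q q' : 'rV[R]_3 -> 'rV[R]_3 -> R) C C' x u y v e :
  flag_lipschitz q C -> flag_lipschitz q' C' -> flag x u -> flag y v ->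
  (forall s, `|q (circ x u s) (circ u (- x) s) - q' (circ y v s) (circ v (- y) s)| <= e) ->
  `|slope q x u - slope q' y v| <= 2 * e.
Proof.
move=> qC qC' xu yv qq'; rewrite /slope -mulrBr mulNr normrN normrM ger0_norm ?invr_ge0//.
have := itg_circ_dist qC qC' xu yv (@continuous_cos R) (@cos_max R) qq'; lra.
Qed.

Lemma circ_flag_dist (q : 'rV[R]_3 -> 'rV[R]_3 -> R) C x u y v s :
  flag_lipschitz q C -> flag x u -> flag y v ->
  `|q (circ x u s) (circ u (- x) s) - q (circ y v s) (circ v (- y) s)|
    <= 2 * C * (`|x - y| + `|u - v|).
Proof.
move=> qC xu yv; have C0 := flag_lipschitz_ge0 qC.
rewrite (le_trans (qC _ _ _ _ (flag_circ s xu) (flag_circ s yv)))//.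
rewrite (_ : 2 * C * _ = C * (2 * (`|x - y| + `|u - v|))); last by ring.
rewrite ler_wpM2l//.
have := circ_dist x u y v s; have := circ_dist u (- x) v (- y) s.
by rewrite -opprD normrN; lra.
Qed.

Lemma half_turn_lipschitz (q : 'rV[R]_3 -> 'rV[R]_3 -> R) C :
  flag_lipschitz q C -> flag_lipschitz (half_turn q) (4 * C).
Proof.
move=> qC x u y v xu yv.
have := half_turn_dist qC qC xu yv (fun s => circ_flag_dist s qC xu yv).
by rewrite !mulrA -natrM.
Qed.

Lemma slope_lipschitz (q : 'rV[R]_3 -> 'rV[R]_3 -> R) C :
  flag_lipschitz q C -> flag_lipschitz (slope q) (4 * C).
Proof.
move=> qC x u y v xu yv.
have := slope_dist qC qC xu yv (fun s => circ_flag_dist s qC xu yv).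
by rewrite !mulrA -natrM.
Qed.

Section Pair.
Variables (h : 'rV[R]_3 -> R) (q : 'rV[R]_3 -> 'rV[R]_3 -> R).
Hypothesis hq : curvature_pair h q.

(** Solutions of [p'' + p = 0] change sign under a half turn, so evenness of [h] leaves a single
    solution on each great circle. Integrating [k sin] and [k cos] over half a turn makes [h] and
    its derivative explicit in [q]; both inherit Lipschitz bounds and stability under uniform
    limits. *)
Lemma curvature_primitive x u : flag x u ->
  [/\ h x = half_turn q x u,
      forall t, is_derive t (1 : R) (fun t => h (circ x u t))
        (slope q (circ x u t) (circ u (- x) t))
    & forall t, is_derive t (1 : R) (fun t => slope q (circ x u t) (circ u (- x) t))
        (q (circ x u t) (circ u (- x) t) - h (circ x u t))].
Proof.
move=> xu; have [C qC] := curv_lip hq; have pi0 := pi_ge0 R.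
have [p1 [dp dp1]] := curv_ode hq xu.
have dsh r t : is_derive t (1 : R) (fun t => r + t) 1.
  by apply: (isd_eq _ (isdD (isd_cst r t) (isd_id t))); rewrite add0r.
have ppi t : h (circ x u (t + pi)) = h (circ x u t).
  by rewrite circDpi (curv_even hq)//; exact: sphere_circ.
have p1pi t : p1 (t + pi) = p1 t.
  apply: isd_unique (dp t).
  have := isd_comp (dsh pi t) (dp (pi + t)); rewrite mulr1 addrC.
  by under eq_fun do rewrite addrC ppi.
pose k t := q (circ x u t) (circ u (- x) t).
have ck : continuous k by exact: continuous_flag_circ qC xu.
have ck' t : continuous (fun s => k (t + s)).
  move=> s; apply: continuous_comp; last exact: ck.
  by apply: continuousD; [exact: cst_continuous|exact: cvg_id].
have kE t s : q (circ (circ x u t) (circ u (- x) t) s) (circ (circ u (- x) t) (- circ x u t) s) = k (t + s).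
  by rewrite -circD -circ_tangentD.
have p1E t : p1 t = slope q (circ x u t) (circ u (- x) t).
  rewrite /slope (eq_itg (g := fun s => k (t + s) * cos s)); last by move=> s _; rewrite kE.
  have dF s : is_derive s (1 : R) (fun s => p1 (t + s) * cos s + h (circ x u (t + s)) * sin s) (k (t + s) * cos s).
    apply: (isd_eq _ (isdD (isdM (isd_comp (dsh t s) (dp1 (t + s))) (is_derive_cos s))
       (isdM (isd_comp (dsh t s) (dp (t + s))) (is_derive_sin s)))).
    by rewrite /k; ring.
  rewrite (itg_derive pi0 dF); last by apply: continuous_fM => //; exact: continuous_cos.
  by rewrite p1pi cospi sinpi addr0 cos0 sin0; field.
split.
- rewrite /half_turn -/k.
  have dF s : is_derive s (1 : R) (fun s => p1 s * sin s - h (circ x u s) * cos s) (k s * sin s).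
    apply: (isd_eq _ (isdB (isdM (dp1 s) (is_derive_sin s)) (isdM (dp s) (is_derive_cos s)))).
    by rewrite /k; ring.
  rewrite (itg_derive pi0 dF); last by apply: continuous_fM => //; exact: continuous_sin.
  have := p1pi 0; have := ppi 0; rewrite add0r circ0 => -> ->.
  by rewrite cospi sinpi cos0 sin0; field.
- by move=> t; rewrite -p1E.
- by move=> t; under eq_fun do rewrite -p1E.
Qed.

Lemma slopeN x u : flag x u -> slope q x (- u) = - slope q x u.
Proof.
move=> xu; have [_ d1 _] := curvature_primitive xu.
have [_ d2 _] := curvature_primitive (flagN xu).
have := d2 0; rewrite !circ0.
have := isd_comp (isdN (isd_id 0)) (d1 (- 0)); rewrite oppr0 !circ0 mulrN1.
under eq_fun do rewrite circ_opp.
by move=> e1 e2; exact: isd_unique e2 e1.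
Qed.

Lemma slope_normN x u : flag x u -> slope q (- x) u = - slope q x u.
Proof.
move=> xu; rewrite -(slopeN xu).
have [_ d1 _] := curvature_primitive (flagN xu).
have [_ d2 _] := curvature_primitive (flag_normN xu).
have := d1 0; have := d2 0; rewrite !circ0.
have -> : (fun t => h (circ (- x) u t)) = (fun t => h (circ x (- u) t)).
  apply/funext => t; rewrite -(curv_even hq (sphere_circ t (flagN xu))).
  by rewrite -circN opprK.
by move=> e1 e2; exact: isd_unique e1 e2.
Qed.

Section Frame.
Variables (x a b : 'rV[R]_3) (fr : frame x a b).

Let k t := q x (circ a b t).

Lemma flag_frame_circ t : flag x (circ a b t).
Proof. by have [] := frame_rot t fr. Qed.

Lemma continuous_frame_curvature : continuous k.
Proof.
have [C qC] := curv_lip hq; apply: (@lipschitz_continuous _ _ (4 * C)).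
apply: (flag_lipschitz_comp (g1 := fun=> x) (g2 := circ a b) qC).
- exact: flag_frame_circ.
- by move=> s t; rewrite subrr normr0 mulr_ge0.
- by move=> s t; apply: circ_lipschitz; case: fr.
Qed.

Lemma frame_curvatureDpi t : k (t + pi) = k t.
Proof. by rewrite /k circDpi (curvatureN hq)//; exact: flag_frame_circ. Qed.

Lemma frame_curvatureD2pi t : k (t + 2 * pi) = k t.
Proof. by rewrite mulr_natl mulr2n addrA !frame_curvatureDpi. Qed.

Lemma frame_rhombus t s :
  k (t + s) + k (t - s) = 2 * cos s ^+ 2 * k t + 2 * sin s ^+ 2 * k (t + pi / 2).
Proof.
rewrite /k circDpihalf 2!circD circ_opp.
exact: (curvature_rhombus hq s (frame_rot t fr)).
Qed.

Let dsin2 s : is_derive s (1 : R) (fun s => sin (2 * s)) (2 * cos (2 * s)).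
Proof.
apply: (isd_eq _ (isd_comp (isdM (isd_cst 2 s) (isd_id s)) (is_derive_sin (2 * s)))).
by ring.
Qed.

Let dcos2 s : is_derive s (1 : R) (fun s => cos (2 * s)) (- 2 * sin (2 * s)).
Proof.
apply: (isd_eq _ (isd_comp (isdM (isd_cst 2 s) (isd_id s)) (is_derive_cos (2 * s)))).
by ring.
Qed.

Let sin4pi : sin (2 * (2 * pi)) = 0 :> R.
Proof. by rewrite mulr_natl sin_mulr2n mulr_natl sin2pi mulr0 mul0rn. Qed.

Let cos2E s : cos (2 * s) = cos s ^+ 2 - sin s ^+ 2 :> R.
Proof. by rewrite mulr_natl cos_mulr2n sin2cos2; ring. Qed.

(** By [frame_rhombus] the folded function [k (t + s) + k (t - s)] is [k t + k (t + pi / 2)] plus a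
    multiple of [cos (2 s)], which integrates to [0]; folding doubles the integral of [k]. *)
Lemma frame_average t :
  pi^-1 * itg 0 (2 * pi) k = k t + k (t + pi / 2).
Proof.
have pi0 := pi_gt0 R; have pi2 : 0 <= 2 * pi :> R by lra.
have ck := continuous_frame_curvature.
have e1 := itg_periodic t pi2 ck frame_curvatureD2pi.
have e2 := itg_periodicN t pi2 ck frame_curvatureD2pi.
have ct : continuous (fun s => k (s + t)).
  move=> s; apply: continuous_comp; last exact: ck.
  by apply: continuousD; [exact: cvg_id|exact: cst_continuous].
have ct' : continuous (fun s => k (t - s)).
  move=> s; apply: continuous_comp; last exact: ck.
  by apply: continuousB; [exact: cst_continuous|exact: cvg_id].
have := itgD 0 (2 * pi) ct ct'.
rewrite {}e1 {}e2.
rewrite (eq_itg (g := fun s => k t + k (t + pi / 2) + (k t - k (t + pi / 2)) * cos (2 * s))); last first.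
  move=> s _; rewrite [s + t]addrC frame_rhombus cos2E.
  by rewrite sin2cos2; ring.
have dF s : is_derive s (1 : R)
    (fun s => (k t + k (t + pi / 2)) * s + (k t - k (t + pi / 2)) * (2^-1 * sin (2 * s)))
    (k t + k (t + pi / 2) + (k t - k (t + pi / 2)) * cos (2 * s)).
  apply: (isd_eq _ (isdD (isdM (isd_cst _ s) (isd_id s)) (isdM (isd_cst _ s) (isdM (isd_cst _ s) (dsin2 s))))).
  by field.
rewrite (itg_derive pi2 dF); last first.
  move=> s; apply: (@isd_continuous _ _ s).
rewrite sin4pi !mulr0 sin0.
by move=> E; apply: (mulfI (lt0r_neq0 pi0)); rewrite mulrA divff ?gt_eqF// mul1r; lra.
Qed.

(** A quadratic form on the circle has only the harmonics of order [0] and [2]. Centring the weight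
    at [t] and folding removes the sine part, and what is left is the integral of
    [cos (2 s) ^+ 2]. *)
Lemma frame_curvature_fourier t :
  k t = pi^-1 * itg 0 (2 * pi) k / 2 +
    pi^-1 * itg 0 (2 * pi) (fun s => k s * cos (2 * (s - t))).
Proof.
have pi0 := pi_gt0 R; have pi2 : 0 <= 2 * pi :> R by lra.
have ck := continuous_frame_curvature.
have cB : continuous (fun s => s - t).
  by move=> s; apply: continuousB; [exact: cvg_id|exact: cst_continuous].
have cB' : continuous (fun s => t - s).
  by move=> s; apply: continuousB; [exact: cst_continuous|exact: cvg_id].
have cD : continuous (fun s => s + t).
  by move=> s; apply: continuousD; [exact: cvg_id|exact: cst_continuous].
have cc : continuous (fun s : R => cos (2 * s)) by move=> s; exact: isd_continuous (dcos2 s).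
pose g s := k s * cos (2 * (s - t)).
have cg : continuous g.
  apply: continuous_fM => // s.
  by apply: (@continuous_comp _ _ _ (fun s => s - t) (fun s => cos (2 * s))); [exact: cB|exact: cc].
have gp s : g (s + 2 * pi) = g s.
  rewrite /g frame_curvatureD2pi; congr (_ * _).
  rewrite (_ : 2 * _ = 2 * (s - t) + pi *+ 2 + pi *+ 2); last by rewrite -mulr_natl; ring.
  by rewrite !cosD2pi.
have e1 := itg_periodic t pi2 cg gp; have e2 := itg_periodicN t pi2 cg gp.
have := itgD 0 (2 * pi) (f := fun s => g (s + t)) (g := fun s => g (t - s)).
rewrite {}e1 {}e2.
rewrite (eq_itg (g := fun s => (k t + k (t + pi / 2)) * cos (2 * s) + (k t - k (t + pi / 2)) * cos (2 * s) ^+ 2)); last first.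
  move=> s _; rewrite /g [s + t]addrC (addrC t s) addrK [t - s]addrC -addrA subrr addr0 mulrN cosN.
  rewrite -mulrDl [s + t]addrC [- s + t]addrC frame_rhombus cos2E.
  rewrite (_ : _ * k t + _ = (k t + k (t + pi / 2)) * 1 + (k t - k (t + pi / 2)) * (cos s ^+ 2 - sin s ^+ 2)).
    by ring.
  by rewrite sin2cos2; ring.
have dF s : is_derive s (1 : R)
    (fun s => (k t + k (t + pi / 2)) * (2^-1 * sin (2 * s)) + (k t - k (t + pi / 2)) * (2^-1 * s + 4^-1 * (sin (2 * s) * cos (2 * s))))
    ((k t + k (t + pi / 2)) * cos (2 * s) + (k t - k (t + pi / 2)) * cos (2 * s) ^+ 2).
  apply: (isd_eq _ (isdD (isdM (isd_cst _ s) (isdM (isd_cst _ s) (dsin2 s)))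
    (isdM (isd_cst _ s) (isdD (isdM (isd_cst _ s) (isd_id s)) (isdM (isd_cst _ s) (isdM (dsin2 s) (dcos2 s))))))).
  have := cos2Dsin2 (2 * s); set C2 := cos _; set S2 := sin _ => E.
  have -> : S2 * (- 2 * S2) = - 2 * (1 - C2 ^+ 2) by rewrite -E; ring.
  by field.
rewrite (itg_derive pi2 dF); last first.
  move=> s; apply: (@isd_continuous _ _ s).
rewrite sin4pi !mulr0 sin0 => E.
have {E}-> : itg 0 (2 * pi) (fun s => k s * cos (2 * (s - t))) = pi / 2 * (k t - k (t + pi / 2)).
  have c1 : continuous (fun s => g (s + t)) by move=> s; apply: (@continuous_comp _ _ _ (fun s => s + t) g); [exact: cD|exact: cg].
  have c2 : continuous (fun s => g (t - s)) by move=> s; apply: (@continuous_comp _ _ _ (fun s => t - s) g); [exact: cB'|exact: cg].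
  by have := E c1 c2; rewrite -/g; lra.
rewrite (frame_average t) 2!mulrA mulVf ?gt_eqF// mul1r.
by field.
Qed.

End Frame.
End Pair.
End Slope.

(** * The hemisphere integral *)

Section Reals.
Context {R : realType}.
Implicit Types (s t w z C K d x nu : R).

Notation mu := (@lebesgue_measure R).
Notation itg a b f := (\int[mu]_(x in `[a, b]) f x).

(** Meant for a primitive that is singular at the pole, hence the hypotheses on the segment only. *)
Lemma itg_derive_on (F f : R -> R) (a b : R) : a < b ->
  (forall x, a <= x <= b -> is_derive x (1 : R) F (f x)) ->
  (forall x, a <= x <= b -> {for x, continuous f}) -> itg a b f = F b - F a.
Proof.
move=> ab Ff cf.
have cF x : a <= x <= b -> {for x, continuous F} by move=> /Ff; exact: isd_continuous.
rewrite /Rintegral (@continuous_FTC2 _ f F a b)//.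
- by apply: continuous_in_subspaceT => x; rewrite inE/= in_itv/=; exact: cf.
- split => [x||].
  + by rewrite in_itv/= => /andP[/ltW ax /ltW xb]; have [|] := Ff x; rewrite ?ax.
  + by apply/cvg_at_right_filter/cF; rewrite lexx ltW.
  + by apply/cvg_at_left_filter/cF; rewrite lexx ltW.
- move=> x; rewrite in_itv/= => /andP[/ltW ax /ltW xb].
  by rewrite derive1E; have [|] := Ff x; rewrite ?ax.
Qed.

(** Turns second-difference estimates into a derivative: they concern [w < 1] with an error
    [o(1 - w)], so the derivative at [1] is read off from the left, along [w = sqrt (1 - z^2)]. *)
Lemma left_derivative_limit (f : R -> R) d K M : 0 <= M ->
  is_derive (1 : R) (1 : R) f d -> f 1 = 0 ->
  (forall w z, 0 < w -> 0 < z <= 2^-1 -> w ^+ 2 + z ^+ 2 = 1 ->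
     `|f w - (1 - w) * K| <= M * z * (1 - w)) -> d = - K.
Proof.
move=> M0 [/cvg_ex[l fl] dE] f1 H.
have {dE}ld : l = d by rewrite -dE; apply/esym/cvg_lim.
rewrite ld in fl; apply/eqP; rewrite -subr_eq0 opprK; apply/eqP.
apply: (@eq0_of_small _ _ (M + 1)) => z /andP[z0 z1].
have /cvgrPdist_le/(_ z z0)[e /= e0 He] := fl.
pose z' := Num.min z (e / 2).
have z'0 : 0 < z' by rewrite lt_min z0 divr_gt0.
have z'z : z' <= z by rewrite ge_min lexx.
have z'e : z' <= e / 2 by rewrite ge_min lexx orbT.
pose w := Num.sqrt (1 - z' ^+ 2).
have w0 : 0 <= w by exact: sqrtr_ge0.
have wz : w ^+ 2 + z' ^+ 2 = 1 by rewrite sqr_sqrtr ?subrK//; nra.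
have w1 : 0 < 1 - w by nra.
have wp : 0 < w by nra.
have wz' : 1 - w <= z' by nra.
have z'1 : 0 < z' <= 2^-1 by rewrite z'0 (le_trans z'z).
have := H w z' wp z'1 wz.
have := He (w - 1).
rewrite /ball /= /GRing.scale /= mulr1 subrK f1 subr0 sub0r opprB gtr0_norm//.
rewrite (_ : 1 - w < e); last by lra.
rewrite subr_eq0 (_ : w != 1); last by rewrite lt_eqF//; lra.
move=> /(_ isT isT) H1 H2.
have {}H2 : `|(w - 1)^-1 * f w + K| <= M * z'.
  rewrite (_ : _ + K = - ((1 - w)^-1 * (f w - (1 - w) * K))); last first.
    have h1 : w - 1 != 0 by rewrite lt_eqF// subr_lt0 -subr_gt0.
    have h2 : 1 - w != 0 by rewrite gt_eqF.
    by field; rewrite ?h1 ?h2.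
  by rewrite normrN normrM gtr0_norm ?invr_gt0// ler_pdivrMl// [X in _ <= X]mulrC.
rewrite (_ : d + K = (d - (w - 1)^-1 * f w) + ((w - 1)^-1 * f w + K)); last by ring.
rewrite (le_trans (ler_normD _ _))//.
have : M * z' <= M * z by rewrite ler_wpM2l.
lra.
Qed.

Lemma sin_ge_half s : 0 <= s <= 2^-1 -> s / 2 <= sin s.
Proof.
move=> /andP[s0 s1].
have dh r : is_derive r (1 : R) (fun r => sin r - r / 2) (cos r - 2^-1).
  by apply: (isd_eq _ (isdB (is_derive_sin r) (isdM (isd_id r) (isd_cst 2^-1 r)))); ring.
move: s0; rewrite le_eqVlt => /predU1P[<-|s0]; first by rewrite sin0 mul0r.
have [c [c0 cs]] := mean_value s0 dh.
rewrite sin0 mul0r subrr !subr0 -subr_ge0 => ->.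
apply: mulr_ge0; last exact: ltW.
have := lipschitz_cos 0 c; rewrite cos0 sub0r normrN (gtr0_norm c0) ler_norml; lra.
Qed.

Lemma cos_quotient_continuous (N : R -> R) nu : continuous N ->
  - (pi / 2) < nu < pi / 2 -> {for nu, continuous (fun nu => N nu / cos nu)}.
Proof.
move=> cN nu2; apply: continuousM; first exact: cN.
by apply: continuousV; [rewrite gt_eqF// cos_gt0_pihalf|exact: continuous_cos].
Qed.

Lemma cos_quotient_bound (N : R -> R) K nu : 0 <= K ->
  (forall nu, 0 <= nu <= pi / 2 -> `|N nu| <= K * cos nu) ->
  0 <= nu <= pi / 2 -> `|N nu / cos nu| <= K.
Proof.
move=> K0 NK nu2; have pi0 := pi_ge0 R.
have c0 : 0 <= cos nu by apply: cos_ge0_pihalf; lra.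
rewrite normrM normfV (ger0_norm c0).
(* Where [cos nu = 0] the quotient is [0], by the convention for inverses. *)
move: c0; rewrite le_eqVlt => /predU1P[<-|c0]; first by rewrite invr0 mulr0.
by rewrite ler_pdivrMr// NK.
Qed.

Lemma cos_quotient_integrable (N : R -> R) K : 0 <= K -> continuous N ->
  (forall nu, 0 <= nu <= pi / 2 -> `|N nu| <= K * cos nu) ->
  mu.-integrable `[0, pi / 2] (EFin \o (fun nu => N nu / cos nu)).
Proof.
move=> K0 cN NK; have pi0 := pi_gt0 R.
apply: measurable_bounded_integrable => //.
- by rewrite /= lebesgue_measure_itv/=; case: ifPn => _ //; rewrite -EFinD ltry.
(* The quotient may jump at the pole. Dropping the endpoint [pi / 2] does not affect measurability,
   and the rest lies in an open interval on which the quotient is continuous. *)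
- apply/measurable_realfun.measurable_fun_itv_bndo_bndcP.
  apply: (@measurable_funS _ _ _ _ `](- (pi / 2)), (pi / 2)[) => //.
    by apply: subset_itv; rewrite bnd_simp//; lra.
  apply: measurable_realfun.open_continuous_measurable_fun; first exact: interval_open.
  by move=> nu; rewrite inE/= in_itv/=; exact: cos_quotient_continuous.
- exists K; split; first exact: num_real.
  move=> M HM nu /=; rewrite in_itv/= => nu2.
  exact: le_trans (cos_quotient_bound K0 NK nu2) (ltW HM).
Qed.

End Reals.

(** * Second Fourier coefficients on the parallels about a pole *)

Section Forward.
Context {R : realType}.
Implicit Types (s t w z C K d nu phi : R).

Notation mu := (@lebesgue_measure R).
Notation itg a b f := (\int[mu]_(x in `[a, b]) f x).

Variables (h : 'rV[R]_3 -> R) (q : 'rV[R]_3 -> 'rV[R]_3 -> R).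
Hypothesis hq : curvature_pair h q.
Variables (x a b : 'rV[R]_3) (fr : frame x a b) (t0 : R).
Variable C : R.
Hypothesis qC : flag_lipschitz q C.

Let rho phi := circ a b phi.
Let P phi nu := circ (rho phi) x nu.
Let T phi nu := circ x (- rho phi) nu.
Let E phi := circ b (- a) phi.
Let c phi : R := cos (2 * (phi - t0)).

Let C0 : 0 <= C := flag_lipschitz_ge0 qC.

Let pi2 : 0 <= 2 * pi :> R.
Proof. by rewrite mulr_ge0// pi_ge0. Qed.

Let flag_xr phi : flag x (rho phi).
Proof. exact: flag_frame_circ fr phi. Qed.

Let flag_rx phi : flag (rho phi) x.
Proof. exact: flag_sym (flag_xr phi). Qed.

Let flag_PT phi nu : flag (P phi nu) (T phi nu).
Proof. exact: flag_circ. Qed.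

Let frame_PTE phi nu : frame (P phi nu) (T phi nu) (E phi).
Proof. exact: frame_meridian. Qed.

Let flag_PE phi nu : flag (P phi nu) (E phi).
Proof. by case: (frame_PTE phi nu). Qed.

Let rho_lip phi psi : `|rho phi - rho psi| <= 2 * `|phi - psi|.
Proof. by apply: circ_lipschitz; case: fr. Qed.

Let P_lip nu phi psi : `|P phi nu - P psi nu| <= 2 * `|phi - psi|.
Proof.
apply: le_trans (circ_dist (rho phi) x (rho psi) x nu) _.
by rewrite subrr normr0 addr0.
Qed.

Let T_lip nu phi psi : `|T phi nu - T psi nu| <= 2 * `|phi - psi|.
Proof.
apply: le_trans (circ_dist x (- rho phi) x (- rho psi) nu) _.
by rewrite subrr normr0 add0r -opprD normrN.
Qed.

Let E_lip phi psi : `|E phi - E psi| <= 2 * `|phi - psi|.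
Proof. by apply: circ_lipschitz; case: fr => _ _ /flag_sym/flagN. Qed.

Let P_lip_nu phi nu nu' : `|P phi nu - P phi nu'| <= 2 * `|nu - nu'|.
Proof. exact: circ_lipschitz. Qed.

Let cont_PT (f : 'rV[R]_3 -> 'rV[R]_3 -> R) K nu : flag_lipschitz f K ->
  continuous (fun phi => f (P phi nu) (T phi nu)).
Proof.
move=> fK; apply: (@lipschitz_continuous _ _ (4 * K)).
exact: (flag_lipschitz_comp (g1 := fun phi => P phi nu) (g2 := fun phi => T phi nu) fK).
Qed.

Let cont_PE nu : continuous (fun phi => q (P phi nu) (E phi)).
Proof.
apply: (@lipschitz_continuous _ _ (4 * C)).
exact: (flag_lipschitz_comp (g1 := fun phi => P phi nu) (g2 := E) qC).
Qed.

Let hE phi nu : h (P phi nu) = half_turn q (P phi nu) (T phi nu).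
Proof. by have [->] := curvature_primitive hq (flag_PT phi nu). Qed.

Let cont_h nu : continuous (fun phi => h (P phi nu)).
Proof.
under eq_fun do rewrite hE; exact: cont_PT (half_turn_lipschitz qC).
Qed.

Let dc phi : is_derive phi (1 : R) c (- 2 * sin (2 * (phi - t0))).
Proof.
apply: (isd_eq _ (isd_comp (isdM (isd_cst 2 phi) (isdB (isd_id phi) (isd_cst t0 phi))) (is_derive_cos _))).
by ring.
Qed.

Let cont_c : continuous c.
Proof. by move=> phi; exact: isd_continuous (dc phi). Qed.

Let c_le1 phi : `|c phi| <= 1.
Proof. exact: cos_max. Qed.

Let cDpi phi : c (phi + pi) = c phi.
Proof.
rewrite /c (_ : 2 * _ = 2 * (phi - t0) + pi *+ 2) ?cosD2pi//.
by rewrite -mulr_natl; ring.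
Qed.

Let c_int : itg 0 (2 * pi) c = 0.
Proof.
have dF s : is_derive s (1 : R) (fun s => 2^-1 * sin (2 * (s - t0))) (c s).
  apply: (isd_eq _ (isdM (isd_cst _ s) (isd_comp (isdM (isd_cst 2 s) (isdB (isd_id s) (isd_cst t0 s))) (is_derive_sin _)))).
  by rewrite /c; field.
rewrite (itg_derive pi2 dF cont_c).
rewrite (_ : 2 * (2 * pi - t0) = 2 * (0 - t0) + pi *+ 2 + pi *+ 2).
  by rewrite !sinD2pi subrr.
by rewrite -mulr_natl; ring.
Qed.

(* The coefficient of [cos (2 (phi - t0))] on the parallel of latitude [nu], for
   [h], for its derivative in [nu], and for the curvatures of [h] along and
   across the meridian. *)
Let AA nu := itg 0 (2 * pi) (fun phi => h (P phi nu) * c phi).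
Let A1 nu := itg 0 (2 * pi) (fun phi => slope q (P phi nu) (T phi nu) * c phi).
Let GG nu := itg 0 (2 * pi) (fun phi => q (P phi nu) (T phi nu) * c phi).
Let KK nu := itg 0 (2 * pi) (fun phi => q (P phi nu) (E phi) * c phi).

Let weigh r phi K : `|r| <= K -> `|r * c phi| <= K.
Proof. by move=> rK; rewrite normrM -[leRHS]mulr1 ler_pM. Qed.

Let dAA nu : is_derive nu (1 : R) AA (A1 nu).
Proof.
apply: (@is_derive_itg _ (fun nu phi => h (P phi nu) * c phi)
  (fun nu phi => slope q (P phi nu) (T phi nu) * c phi) (4 * (4 * C))) => //.
- by move=> s; exact: continuous_fM (@cont_h s) cont_c.
- exact: continuous_fM (@cont_PT _ _ nu (slope_lipschitz qC)) cont_c.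
- move=> t phi; rewrite mulrA -!mulrBl; apply: weigh.
  have [_ d1 _] := curvature_primitive hq (flag_rx phi).
  apply: (taylor1 (f := fun nu => h (P phi nu)) t d1) => s.
  exact: flag_lipschitz_circ (slope_lipschitz qC) (flag_rx phi).
Qed.

Let dA1 nu : is_derive nu (1 : R) A1 (GG nu - AA nu).
Proof.
have -> : GG nu - AA nu = itg 0 (2 * pi) (fun phi => (q (P phi nu) (T phi nu) - h (P phi nu)) * c phi).
  rewrite /GG /AA -itgB; [|exact: continuous_fM (@cont_PT _ _ nu qC) cont_c|exact: continuous_fM (@cont_h nu) cont_c].
  by apply: eq_itg => phi _; rewrite mulrBl.
apply: (@is_derive_itg _ (fun nu phi => slope q (P phi nu) (T phi nu) * c phi)
  (fun nu phi => (q (P phi nu) (T phi nu) - h (P phi nu)) * c phi) (4 * C + 4 * (4 * C))) => //.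
- by move=> s; exact: continuous_fM (@cont_PT _ _ s (slope_lipschitz qC)) cont_c.
- exact: continuous_fM (continuous_fB (@cont_PT _ _ nu qC) (@cont_h nu)) cont_c.
- move=> t phi.
  have fct (r1 r2 r3 k : R) : r1 * k - r2 * k - t * (r3 * k) = (r1 - r2 - t * r3) * k by ring.
  rewrite fct; apply: weigh.
  have [_ _ d2] := curvature_primitive hq (flag_rx phi).
  apply: (taylor1 (f := fun nu => slope q (P phi nu) (T phi nu)) t d2) => s.
  have e1 := flag_lipschitz_circ s nu qC (flag_rx phi).
  have e2 := flag_lipschitz_circ s nu (half_turn_lipschitz qC) (flag_rx phi).
  rewrite -/(P phi s) -/(P phi nu) -/(T phi s) -/(T phi nu) -!hE in e1 e2 *.
  rewrite (_ : _ - _ = (q (P phi s) (T phi s) - q (P phi nu) (T phi nu)) - (h (P phi s) - h (P phi nu))); last by ring.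
  rewrite (le_trans (ler_normB _ _))// mulrDl lerD//.
Qed.

Let P_pihalf phi : P phi (pi / 2) = x.
Proof. exact: circ_pihalf. Qed.

Let T_pihalf phi : T phi (pi / 2) = - rho phi.
Proof. exact: circ_pihalf. Qed.

Let AA_pihalf : AA (pi / 2) = 0.
Proof.
rewrite /AA (eq_itg (g := fun phi => h x * c phi)) => [|phi _]; last by rewrite P_pihalf.
by rewrite itgZl// c_int mulr0.
Qed.

Let rhoDpi phi : rho (phi + pi) = - rho phi.
Proof. exact: circDpi. Qed.

Let A1_pihalf : A1 (pi / 2) = 0.
Proof.
apply: itg_antiperiodic; first exact: continuous_fM (@cont_PT _ _ _ (slope_lipschitz qC)) cont_c.
move=> phi; rewrite !P_pihalf !T_pihalf cDpi rhoDpi opprK (slopeN hq)//.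
by rewrite mulNr opprK.
Qed.

(** Evenness of [h] enters: antipodal points of the equator share the northward tangent [x] and have
    opposite slopes there, while [c] has period [pi]. *)
Let A1_0 : A1 0 = 0.
Proof.
apply: itg_antiperiodic; first exact: continuous_fM (@cont_PT _ _ _ (slope_lipschitz qC)) cont_c.
move=> phi; rewrite /P /T !circ0 cDpi rhoDpi (slope_normN hq)//.
by rewrite mulNr.
Qed.

Let A0 := itg 0 (2 * pi) (fun phi => q x (rho phi) * c phi).

Let GG_pihalf : GG (pi / 2) = A0.
Proof.
by apply: eq_itg => phi _; rewrite P_pihalf T_pihalf (curvatureN hq).
Qed.

Let itg_lip (k : R -> R -> R) M : (forall nu, continuous (k nu)) ->
  (forall nu nu' phi, `|k nu phi - k nu' phi| <= M * `|nu - nu'|) ->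
  forall nu nu', `|itg 0 (2 * pi) (fun phi => k nu phi * c phi) -
     itg 0 (2 * pi) (fun phi => k nu' phi * c phi)| <= 2 * pi * M * `|nu - nu'|.
Proof.
move=> ck kM nu nu'.
rewrite -itgB; [|exact: continuous_fM (@ck _) cont_c..].
rewrite (_ : 2 * pi * M * _ = M * `|nu - nu'| * (2 * pi - 0)); last by ring.
apply: itg_bound => //.
  by apply: continuous_fB; exact: continuous_fM (@ck _) cont_c.
by move=> phi _; rewrite -mulrBl; apply: weigh.
Qed.

Let GG_lip nu nu' : `|GG nu - GG nu'| <= 2 * pi * (4 * C) * `|nu - nu'|.
Proof.
apply: (itg_lip (k := fun nu phi => q (P phi nu) (T phi nu))) => [s|s s' phi].
  exact: cont_PT qC.
exact: flag_lipschitz_circ.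
Qed.

Let KK_lip nu nu' : `|KK nu - KK nu'| <= 2 * pi * (4 * C) * `|nu - nu'|.
Proof.
apply: (itg_lip (k := fun nu phi => q (P phi nu) (E phi))) => [s|s s' phi].
  exact: cont_PE.
apply: (flag_lipschitz_comp (g1 := P phi) (g2 := fun=> E phi) qC) => //.
by move=> r r'; rewrite subrr normr0 mulr_ge0.
Qed.

(* Two points of the parallel of latitude [asin (w sin nu)], at longitudes
   [phi + tau] and [phi - tau], lie on the great circle through [P phi nu]
   perpendicular to the meridian. *)
Let parallel_points w z nu : 0 < cos nu -> 0 < w -> w ^+ 2 + z ^+ 2 = 1 ->
  exists2 tau, cos (2 * tau) = 2 * (w * cos nu) ^+ 2 / (1 - (w * sin nu) ^+ 2) - 1
  & forall phi, w *: P phi nu + z *: E phi = P (phi + tau) (asin (w * sin nu))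
       /\ w *: P phi nu - z *: E phi = P (phi - tau) (asin (w * sin nu)).
Proof.
move=> cnu w0 wz; set S := sin nu; set cn := cos nu.
have cS : cn ^+ 2 = 1 - S ^+ 2 by rewrite /cn cos2sin2.
have dE : (w * cn) ^+ 2 + z ^+ 2 = 1 - (w * S) ^+ 2.
  by rewrite -[1 in RHS]wz !exprMn cS; ring.
have d0 : 0 < 1 - (w * S) ^+ 2 by rewrite -dE; apply: ltr_pwDl; rewrite ?sqr_ge0// exprn_gt0// mulr_gt0.
have wS : -1 <= w * S <= 1 by rewrite -ler_norml -(ler_pXn2r (ltn0Sn 1)) ?nnegrE// expr1n real_normK ?num_real//; lra.
pose D := Num.sqrt (1 - (w * S) ^+ 2).
have D0 : 0 < D by rewrite sqrtr_gt0.
have DD : D ^+ 2 = 1 - (w * S) ^+ 2 by rewrite sqr_sqrtr// ltW.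
have /polar[tau _ [ct st]] : (w * cn / D) ^+ 2 + (z / D) ^+ 2 = 1.
  by rewrite !expr_div_n -mulrDl dE DD divff// gt_eqF.
exists tau.
  by rewrite mulr_natl cos_mulr2n -ct expr_div_n DD; ring.
have Dct : D * cos tau = w * cn by rewrite -ct; field; rewrite gt_eqF.
have Dst : D * sin tau = z by rewrite -st; field; rewrite gt_eqF.
have cas : cos (asin (w * S)) = D by rewrite cos_asin.
have sas : sin (asin (w * S)) = w * S by rewrite asinK ?in_itv.
move=> psi; split; rewrite /P [circ (rho (_ + _)) x _]/circ cas sas /rho.
  rewrite circD [D *: _]scale_circ Dct Dst -/(E psi) [circ _ x nu]/circ -/S -/cn.
  by apply/rowP => i; rewrite !mxE; ring.
rewrite circD circ_opp [D *: _]scale_circ Dct Dst -/(E psi) [circ _ x nu]/circ -/S -/cn.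
by apply/rowP => i; rewrite !mxE; ring.
Qed.

(* In spherical coordinates the curvature across the meridian is
   [h_phiphi / cos^2 nu - tan nu h_nu + h], and the second derivative in [phi]
   multiplies the coefficient by [-4]. *)
Let KK_eq nu : - (pi / 2) < nu < pi / 2 ->
  KK nu = - 4 * AA nu / cos nu ^+ 2 - sin nu / cos nu * A1 nu + AA nu.
Proof.
move=> nu2; have cnu := cos_gt0_pihalf nu2.
have pi0 := pi_gt0 R.
(* [w] is the cosine of the arc travelled east and west from the parallel of latitude [nu].
   Integrating the second difference of [h] against [c] shifts the weight by [tau] and [- tau],
   which produces the factor [cos (2 tau)]. [Psi w] is half the result, and its derivative at
   [w = 1] is [- KK nu]. *)
pose Psi w := (2 * (w * cos nu) ^+ 2 / (1 - (w * sin nu) ^+ 2) - 1) * AA (asin (w * sin nu)) - w * AA nu.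
have aS : asin (1 * sin nu) = nu.
  by rewrite mul1r sinK// in_itv/=; move: nu2 => /andP[/ltW -> /ltW ->].
have S1 : -1 < 1 * sin nu < 1.
  rewrite mul1r -ltr_norml -(ltr_pXn2r (ltn0Sn 1)) ?nnegrE// expr1n real_normK ?num_real//.
  by rewrite sin2cos2; have := exprn_gt0 2 cnu; lra.
have den : 1 - (1 * sin nu) ^+ 2 = cos nu ^+ 2 by rewrite mul1r cos2sin2.
have den0 : 1 - (1 * sin nu) ^+ 2 != 0 by rewrite den expf_neq0// gt_eqF.
have dS k : is_derive (1 : R) (1 : R) (fun w => w * k) k.
  by apply: (isd_eq _ (isdM (isd_id (1 : R)) (isd_cst k 1))); ring.
have dPsi : is_derive (1 : R) (1 : R) Psi (4 * AA nu / cos nu ^+ 2 + sin nu / cos nu * A1 nu - AA nu).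
  apply: (isd_eq _ (isdB (isdM (isdB (isdM (isdM (isd_cst 2 1) (isdX 2 (dS (cos nu))))
      (isdV (f := fun w => 1 - (w * sin nu) ^+ 2) den0 (isdB (isd_cst 1 1) (isdX 2 (dS (sin nu)))))) (isd_cst 1 1))
      (isd_comp (isd_comp (dS (sin nu)) (is_derive1_asin S1)) (dAA (asin (1 * sin nu)))))
     (isdM (isd_id 1) (isd_cst (AA nu) 1)))).
  rewrite aS den /= !mul1r sqrtr_sqr (gtr0_norm cnu) expr1.
  have -> : 2%:R * sin nu * sin nu = 2 * (1 - cos nu ^+ 2) by rewrite -sin2cos2; ring.
  by field; rewrite gt_eqF.
have Psi1 : Psi 1 = 0 by rewrite /Psi aS den !mul1r; field; rewrite gt_eqF.
have := @left_derivative_limit _ Psi _ (KK nu) (8 * pi * C) _ dPsi Psi1.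
have C8 : 0 <= 8 * pi * C by rewrite !mulr_ge0// ltW.
move=> /(_ C8) H.
rewrite -[LHS]opprK -H; first by ring.
move=> w z w0 /andP[z0 z1] wz.
have [tau ctau PP] := parallel_points cnu w0 wz.
rewrite /Psi -ctau; set nu' := asin (w * sin nu).
have cg : continuous (fun phi => h (P phi nu')) by exact: cont_h.
have rho2pi psi : P (psi + 2 * pi) nu' = P psi nu'.
  by rewrite /P mulr_natl mulr2n addrA !rhoDpi opprK.
have c2pi psi : c (psi + 2 * pi) = c psi.
  by rewrite mulr_natl mulr2n addrA !cDpi.
have cs s : continuous (fun phi : R => phi + s).
  by move=> phi; apply: continuousD; [exact: cvg_id|exact: cst_continuous].
have ccs s : continuous (fun phi => c (phi + s)).
  by move=> phi; apply: (@continuous_comp _ _ _ (fun phi => phi + s) c); [exact: cs|exact: cont_c].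
have sh s : itg 0 (2 * pi) (fun phi => h (P (phi + s) nu') * c phi) = itg 0 (2 * pi) (fun phi => h (P phi nu') * c (phi - s)).
  rewrite -[RHS](@itg_periodic _ _ s)//.
  - by apply: eq_itg => phi _; rewrite addrK.
  - exact: continuous_fM.
  - by move=> phi; rewrite rho2pi -addrAC c2pi.
have chs s : continuous (fun phi => h (P (phi + s) nu')).
  by move=> phi; apply: (@continuous_comp _ _ _ (fun phi => phi + s) (fun phi => h (P phi nu'))); [exact: cs|exact: cg].
have EE : itg 0 (2 * pi) (fun phi => (h (P (phi + tau) nu') + h (P (phi - tau) nu') - 2 * w * h (P phi nu) - 2 * (1 - w) * q (P phi nu) (E phi)) * c phi)
   = 2 * cos (2 * tau) * AA nu' - 2 * w * AA nu - 2 * (1 - w) * KK nu.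
  have cA1 := continuous_fM (chs tau) cont_c; have cA2 := continuous_fM (chs (- tau)) cont_c.
  have cA3 : continuous (fun phi => 2 * w * (h (P phi nu) * c phi)).
    by apply: continuous_fM; [exact: cst_continuous|exact: continuous_fM (@cont_h nu) cont_c].
  have cA4 : continuous (fun phi => 2 * (1 - w) * (q (P phi nu) (E phi) * c phi)).
    by apply: continuous_fM; [exact: cst_continuous|exact: continuous_fM (@cont_PE nu) cont_c].
  transitivity (itg 0 (2 * pi) (fun phi => h (P (phi + tau) nu') * c phi + h (P (phi - tau) nu') * c phi
      - 2 * w * (h (P phi nu) * c phi) - 2 * (1 - w) * (q (P phi nu) (E phi) * c phi))).
    by apply: eq_itg => phi _; ring.
  rewrite itgB//; last by apply: continuous_fB => //; exact: continuous_fD.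
  rewrite itgB//; last exact: continuous_fD.
  have e3 := @itgZl _ (2 * w) _ 0 (2 * pi) (continuous_fM (@cont_h nu) cont_c).
  have e4 := @itgZl _ (2 * (1 - w)) _ 0 (2 * pi) (continuous_fM (@cont_PE nu) cont_c).
  have e7 := itgD 0 (2 * pi) cA1 cA2.
  rewrite e7 (sh tau) (sh (- tau)) e3 e4; congr (_ - _ - _); rewrite opprK.
  have cB1 := continuous_fM cg (ccs (- tau)); have cB2 := continuous_fM cg (ccs tau).
  have e5 := itgD 0 (2 * pi) cB1 cB2.
  have e6 := @itgZl _ (2 * cos (2 * tau)) _ 0 (2 * pi) (continuous_fM cg cont_c).
  rewrite -e5 -e6.
  apply: eq_itg => phi _; rewrite -mulrDr /c.
  rewrite (_ : 2 * (phi - tau - t0) = 2 * (phi - t0) - 2 * tau); last by ring.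
  rewrite (_ : 2 * (phi + tau - t0) = 2 * (phi - t0) + 2 * tau); last by ring.
  by rewrite cosB cosD; ring.
have bd : `|2 * cos (2 * tau) * AA nu' - 2 * w * AA nu - 2 * (1 - w) * KK nu| <= 8 * C * z * (1 - w) * (2 * pi - 0).
  rewrite -EE; apply: itg_bound => //.
    apply: continuous_fM cont_c; apply: continuous_fB.
      apply: continuous_fB; first exact: continuous_fD.
      by apply: continuous_fM; [exact: cst_continuous|exact: cont_h].
    by apply: continuous_fM; [exact: cst_continuous|exact: cont_PE].
  move=> phi _; apply: weigh.
  have [<- <-] := PP phi.
  by have := second_difference hq qC (flag_PE phi nu) (ltW w0) wz; rewrite (gtr0_norm z0).
rewrite -(ler_pM2l (ltr0n R 2 : 0 < 2)) -{1}(ger0_norm (ler0n R 2)) -normrM.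
rewrite [X in `|X| <= _](_ : _ = 2 * cos (2 * tau) * AA nu' - 2 * w * AA nu - 2 * (1 - w) * KK nu); last by ring.
by rewrite (le_trans bd)// subr0 le_eqVlt; apply/orP; left; apply/eqP; ring.
Qed.

(* [V] is a primitive of the integrand [j], so that the integral over the
   hemisphere reduces to the boundary values [0] at the equator and [- 2 A0] at
   the pole. *)
Let V nu := A1 nu / cos nu - 2 * AA nu * sin nu / cos nu ^+ 2.
Let j nu := (GG nu + KK nu) / cos nu.

Let dV nu : - (pi / 2) < nu < pi / 2 -> is_derive nu (1 : R) V (j nu).
Proof.
move=> nu2; have cnu := cos_gt0_pihalf nu2.
have c0 : cos nu != 0 by rewrite gt_eqF.
have c20 : cos nu ^+ 2 != 0 by rewrite expf_neq0.
apply: (isd_eq _ (isdB (isdM (dA1 nu) (isdV c0 (is_derive_cos nu)))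
  (isdM (isdM (isdM (isd_cst 2 nu) (dAA nu)) (is_derive_sin nu)) (isdV (f := fun y => cos y ^+ 2) c20 (isdX 2 (is_derive_cos nu)))))).
rewrite /j (KK_eq nu2) /= expr1.
have -> : 2 * AA nu * sin nu * (- (2%:R * cos nu * - sin nu) / (cos nu ^+ 2) ^+ 2) =
   2 * AA nu * (1 - cos nu ^+ 2) * (2 * cos nu / (cos nu ^+ 2) ^+ 2).
  by rewrite -sin2cos2; ring.
by field.
Qed.

Let dP nu phi : 0 <= cos nu -> 0 <= sin nu ->
  `|P phi nu - x| <= 2 * cos nu /\ `|T phi nu + rho phi| <= 2 * cos nu.
Proof.
move=> c0 s0.
have cE : cos (pi / 2 - nu) = sin nu by rewrite -cosN opprB cosBpihalf.
have sE : sin (pi / 2 - nu) = cos nu by rewrite -[pi / 2 - nu]opprB sinN sinBpihalf opprK.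
have PE : P phi nu = circ x (rho phi) (pi / 2 - nu) by rewrite /P /circ cE sE addrC.
have TE : T phi nu = circ (- rho phi) x (pi / 2 - nu) by rewrite /T /circ cE sE addrC.
split; first rewrite PE.
  by rewrite (le_trans (circ_near (flag_xr phi) _)) ?cE// sE ger0_norm.
have -> : T phi nu + rho phi = circ (- rho phi) x (pi / 2 - nu) - (- rho phi) by rewrite TE opprK.
apply: le_trans (circ_near (flag_normN (flag_rx phi)) _) _; first by rewrite cE.
by rewrite sE ger0_norm.
Qed.

(** The trace [m] at the pole is the same for all longitudes, so subtracting it leaves the
    coefficient unchanged, the weight having mean zero. The rest is at most [6 C cos nu] pointwise:
    [4] along the meridian, and [2] across it, where [E phi] stays fixed. *)
Let J_bound nu : 0 <= cos nu -> 0 <= sin nu ->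
  `|GG nu + KK nu| <= 12 * pi * C * cos nu.
Proof.
move=> c0 s0.
have cont0 : continuous (fun phi => q x (rho phi)) by exact: (@continuous_frame_curvature _ _ _ hq _ _ _ fr).
pose m := pi^-1 * itg 0 (2 * pi) (fun phi => q x (rho phi)).
have cG := continuous_fM (@cont_PT _ _ nu qC) cont_c; have cK := continuous_fM (@cont_PE nu) cont_c.
have cm : continuous (fun phi => m * c phi).
  by apply: continuous_fM => //; exact: cst_continuous.
have -> : GG nu + KK nu = itg 0 (2 * pi) (fun phi => q (P phi nu) (T phi nu) * c phi + q (P phi nu) (E phi) * c phi - m * c phi).
  rewrite itgB//; last exact: continuous_fD.
  by rewrite itgZl// c_int mulr0 subr0 itgD.
rewrite (_ : 12 * pi * C * cos nu = 6 * C * cos nu * (2 * pi - 0)); last by ring.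
apply: itg_bound => //; first by apply: continuous_fB => //; exact: continuous_fD.
move=> phi _; rewrite -mulrDl -mulrBl; apply: weigh.
have -> : m = q x (rho phi) + q x (E phi).
  by rewrite /m (frame_average hq fr phi) circDpihalf.
rewrite -(curvatureN hq (flag_xr phi)).
have xE : flag x (E phi) by case: (frame_rot phi fr).
have [e1 e2] := dP phi c0 s0.
have f1 := qC (flag_PT phi nu) (flagN (flag_xr phi)).
have f2 := qC (flag_PE phi nu) xE.
rewrite opprK in f1; rewrite subrr normr0 addr0 in f2.
rewrite (_ : _ - _ = (q (P phi nu) (T phi nu) - q x (- rho phi)) + (q (P phi nu) (E phi) - q x (E phi))); last by ring.
rewrite (le_trans (ler_normD _ _))//.
have g1 : C * (`|P phi nu - x| + `|T phi nu + rho phi|) <= C * (4 * cos nu) by rewrite ler_wpM2l//; lra.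
have g2 : C * `|P phi nu - x| <= C * (2 * cos nu) by rewrite ler_wpM2l.
lra.
Qed.

Let pi0 : 0 < pi :> R := pi_gt0 R.

Let GK_bound nu : 0 <= nu <= pi / 2 -> `|GG nu + KK nu| <= 12 * pi * C * cos nu.
Proof.
move=> nu2; apply: J_bound; first by apply: cos_ge0_pihalf; lra.
by apply: sin_ge0_pi; lra.
Qed.

Let GK_continuous : continuous (fun nu => GG nu + KK nu).
Proof.
exact: continuous_fD (lipschitz_continuous GG_lip) (lipschitz_continuous KK_lip).
Qed.

Let j_continuous nu : - (pi / 2) < nu < pi / 2 -> {for nu, continuous j}.
Proof. exact: cos_quotient_continuous GK_continuous. Qed.

Let j_bound nu : 0 <= nu <= pi / 2 -> `|j nu| <= 12 * pi * C.
Proof.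
have K0 : 0 <= 12 * pi * C by rewrite !mulr_ge0// ltW.
exact: cos_quotient_bound K0 GK_bound.
Qed.

Let j_integrable : mu.-integrable `[0, pi / 2] (EFin \o j).
Proof. by apply: cos_quotient_integrable GK_bound => //; rewrite !mulr_ge0// ltW. Qed.

(** With [r] the distance from the pole, [AA - A0 (1 - cos r)] solves [y'' + y = O(r)] with zero
    initial data. Bounds for [y] and [y1] give the expansions of [AA] and [A1] at the pole, whose
    main terms combine to [- 2 A0] in [V]. With [M = 8 pi C] the errors [6 M + 2 M] account for
    [64]. *)
Let V_limit s : 0 < s <= 2^-1 ->
  `|V (pi / 2 - s) + 2 * A0| <= (`|A0| + 64 * pi * C) * s.
Proof.
move=> s2.
have pih := @pihalf_ge1 R.
pose M := 8 * pi * C.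
have M0 : 0 <= M by rewrite !mulr_ge0// ltW.
have dneg r : is_derive r (1 : R) (fun r => pi / 2 - r) (-1).
  by apply: (isd_eq _ (isdB (isd_cst (pi / 2) r) (isd_id r))); rewrite sub0r.
pose y r := AA (pi / 2 - r) - A0 * (1 - cos r).
pose y1 r := - A1 (pi / 2 - r) - A0 * sin r.
pose y2 r := GG (pi / 2 - r) - AA (pi / 2 - r) - A0 * cos r.
have dy r : is_derive r (1 : R) y (y1 r).
  apply: (isd_eq _ (isdB (isd_comp (dneg r) (dAA (pi / 2 - r))) (isdM (isd_cst A0 r) (isdB (isd_cst 1 r) (is_derive_cos r))))).
  by rewrite /y1; ring.
have dy1 r : is_derive r (1 : R) y1 (y2 r).
  apply: (isd_eq _ (isdB (isdN (isd_comp (dneg r) (dA1 (pi / 2 - r)))) (isdM (isd_cst A0 r) (is_derive_sin r)))).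
  by rewrite /y2; ring.
have y0 : y 0 = 0 by rewrite /y subr0 cos0 AA_pihalf; ring.
have y10 : y1 0 = 0 by rewrite /y1 subr0 sin0 A1_pihalf; ring.
have ode r : 0 <= r -> `|y2 r + y r| <= M * r.
  move=> r0; rewrite (_ : _ + _ = GG (pi / 2 - r) - GG (pi / 2)); last by rewrite GG_pihalf /y2 /y; ring.
  rewrite (le_trans (GG_lip _ _))// (_ : _ - r - _ = - r); last by ring.
  by rewrite normrN (ger0_norm r0) /M le_eqVlt; apply/orP; left; apply/eqP; ring.
have yb r : 0 <= r <= s -> `|y r| <= M * s * (1 - cos r).
  move=> r0; apply: (oscillator_bound _ dy dy1 y0 y10); first lra.
  move=> r' r'0; rewrite (le_trans (ode r' _))//; first by case/andP: r'0.
  by rewrite ler_wpM2l//; lra.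
have y1b : `|y1 s| <= 3 * M * s ^+ 2.
  have := @lipschitz_derive _ y1 y2 (3 * M * s) dy1 0 s.
  rewrite y10 !subr0 (gtr0_norm (_ : 0 < s)); last lra.
  rewrite (_ : _ * s * s = 3 * M * s ^+ 2); last by ring.
  apply => r /orP[|] r0; last lra.
  have h1 := yb r r0; have h2 := ode r (proj1 (andP r0)).
  have h3 : M * s * (1 - cos r) <= M * s * 2.
    by rewrite ler_wpM2l//; [rewrite mulr_ge0//; lra|have := cos_geN1 r; lra].
  have h4 : M * r <= M * s by rewrite ler_wpM2l//; lra.
  rewrite -[y2 r](addrK (y r)) (le_trans (ler_normB _ _))//; lra.
have ys := yb s; rewrite lexx andbT (_ : 0 <= s) in ys; last lra.
have {}ys := ys isT.
have ss := @sin_ge_half R s; rewrite (_ : 0 <= s <= 2^-1) in ss; last lra.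
have {}ss := ss isT.
have sp : 0 < sin s by lra.
have cc : 1 - s <= cos s.
  have := lipschitz_cos 0 s; rewrite cos0 sub0r normrN (gtr0_norm (_ : 0 < s)); last lra.
  by rewrite ler_norml; lra.
have c1 := cos_le1 s.
have cp : 0 < 1 + cos s by lra.
have sinE : sin s ^+ 2 = (1 - cos s) * (1 + cos s) by rewrite sin2cos2; ring.
have cE : cos (pi / 2 - s) = sin s by rewrite -cosN opprB cosBpihalf.
have sE : sin (pi / 2 - s) = cos s by rewrite -[pi / 2 - s]opprB sinN sinBpihalf opprK.
have mc : 0 < 1 - cos s by rewrite -(pmulr_lgt0 _ cp) -sinE exprn_gt0.
have -> : V (pi / 2 - s) + 2 * A0 = A0 * (1 - cos s) / (1 + cos s) - y1 s / sin s
    - 2 * cos s / (1 + cos s) * (y s / (1 - cos s)).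
  rewrite /V cE sE.
  have -> : AA (pi / 2 - s) = y s + A0 * (1 - cos s) by rewrite /y; ring.
  have -> : A1 (pi / 2 - s) = - y1 s - A0 * sin s by rewrite /y1; ring.
  rewrite sinE; field.
  by rewrite !gt_eqF.
have b1 : `|A0 * (1 - cos s) / (1 + cos s)| <= `|A0| * s.
  rewrite -mulrA normrM ler_wpM2l// ger0_norm; last by apply: divr_ge0; exact: ltW.
  rewrite ler_pdivrMr//; have : s <= s * (1 + cos s) by rewrite ler_peMr//; lra.
  lra.
have b2 : `|y1 s / sin s| <= 6 * M * s.
  rewrite normrM normfV (gtr0_norm sp) ler_pdivrMr// (le_trans y1b)//.
  have : 6 * M * s * (s / 2) <= 6 * M * s * sin s by rewrite ler_wpM2l// !mulr_ge0//; lra.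
  by apply: le_trans; rewrite le_eqVlt; apply/orP; left; apply/eqP; field.
have b3 : `|2 * cos s / (1 + cos s) * (y s / (1 - cos s))| <= 2 * (M * s).
  rewrite normrM ler_pM//.
    rewrite ger0_norm; first by rewrite ler_pdivrMr//; lra.
    by rewrite divr_ge0//; lra.
  by rewrite normrM normfV (gtr0_norm mc) ler_pdivrMr.
rewrite (le_trans (ler_normB _ _))// (_ : _ * s = `|A0| * s + 6 * M * s + 2 * (M * s)); last by rewrite /M; ring.
by rewrite lerD// (le_trans (ler_normB _ _))// lerD.
Qed.

(** [V] has no meaningful value at the pole, where its denominators vanish, so the integral is cut
    at [pi / 2 - s]: the cap contributes [O(s)] because [j] is bounded, and [V_limit] evaluates the
    rest. *)
Let hemisphere_j :
  itg 0 (pi / 2) j = - 2 * itg 0 (2 * pi) (fun phi => q x (circ a b phi) * cos (2 * (phi - t0))).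
Proof.
rewrite -/A0; apply/eqP; rewrite -subr_eq0; apply/eqP.
have pih := @pihalf_ge1 R.
apply: (@eq0_of_small _ _ (12 * pi * C + (`|A0| + 64 * pi * C))) => s s2.
have /andP[s0 s1] := s2.
have sub : itg 0 (pi / 2) j - itg 0 (pi / 2 - s) j = \int[mu]_(t in `](pi / 2 - s), pi / 2]) j t.
  have r1 : 0 <= pi / 2 - s by lra.
  have r2 : pi / 2 - s <= pi / 2 by lra.
  by apply: Rintegral_itvB => //; rewrite bnd_simp.
have E1 : itg 0 (pi / 2 - s) j = V (pi / 2 - s).
  have dVj r : 0 <= r <= pi / 2 - s -> is_derive r (1 : R) V (j r) by move=> r0; apply: dV; lra.
  have cj r : 0 <= r <= pi / 2 - s -> {for r, continuous j} by move=> r0; apply: j_continuous; lra.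
  have s3 : 0 < pi / 2 - s by lra.
  by rewrite (itg_derive_on s3 dVj cj) /V A1_0 sin0 mulr0 !mul0r !subr0.
have E2 : `|itg 0 (pi / 2) j - itg 0 (pi / 2 - s) j| <= 12 * pi * C * s.
  rewrite sub Rintegral_itv_obnd_cbnd; last first.
    by apply: integrableS j_integrable => //; apply: subset_itv; rewrite bnd_simp//; lra.
  rewrite (_ : 12 * pi * C * s = 12 * pi * C * (pi / 2 - (pi / 2 - s))); last by ring.
  apply: normr_itg_le; first lra.
    by apply: integrableS j_integrable => //; apply: subset_itv; rewrite bnd_simp//; lra.
  by move=> r r0; apply: j_bound; lra.
have := V_limit s2; rewrite -E1 => E3.
rewrite (_ : _ - _ = (itg 0 (pi / 2) j - itg 0 (pi / 2 - s) j) + (itg 0 (pi / 2 - s) j + 2 * A0)); last by ring.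
by rewrite (le_trans (ler_normD _ _))// [leRHS]mulrDl lerD.
Qed.

Lemma hemisphere_integral :
  itg 0 (pi / 2) (fun nu => itg 0 (2 * pi) (fun phi =>
     (q (circ (circ a b phi) x nu) (circ x (- circ a b phi) nu)
      + q (circ (circ a b phi) x nu) (circ b (- a) phi)) * cos (2 * (phi - t0)) / cos nu))
  = - 2 * itg 0 (2 * pi) (fun phi => q x (circ a b phi) * cos (2 * (phi - t0))).
Proof.
rewrite -hemisphere_j; apply: eq_itg => nu _.
have cG := continuous_fM (@cont_PT _ _ nu qC) cont_c; have cK := continuous_fM (@cont_PE nu) cont_c.
have e1 := itgD 0 (2 * pi) cG cK.
have e2 := @itgZr _ (cos nu)^-1 _ 0 (2 * pi) (continuous_fD cG cK).
rewrite /j /GG /KK -e1 -e2; apply: eq_itg => phi _.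
by rewrite -mulrDl.
Qed.

End Forward.

(** * The transform of the mean curvature *)

Section Transform.
Context {R : realType}.
Implicit Types (x y u v a b omega psi : 'rV[R]_3) (s t w z C K L d nu phi eps : R).

Notation mu := (@lebesgue_measure R).
Notation itg a b f := (\int[mu]_(x in `[a, b]) f x).

Variables (e : 'rV[R]_3 -> 'rV[R]_3 * 'rV[R]_3).
Hypothesis e_longitude : longitude_system e.

Lemma integrable_itvB (f g : R -> R) (s t : R) :
  mu.-integrable `[s, t] (EFin \o f) -> mu.-integrable `[s, t] (EFin \o g) ->
  mu.-integrable `[s, t] (EFin \o (fun r => f r - g r)).
Proof.
move=> fi gi; rewrite (_ : EFin \o _ = (EFin \o f) \- (EFin \o g))%E//.
by apply: integrableB.
Qed.

Definition hemisphere_transform (f : 'rV[R]_3 -> R) omega t : R :=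
  f omega / 2
  - (2 * pi)^-1 *
    \int[mu]_(nu in `[0, pi / 2])
      \int[mu]_(phi in `[0, 2 * pi])
        (f (sphere_point e omega nu phi) * cos (2 * (phi - t)) / cos nu).

Lemma longitude_frame omega : sphere omega -> frame omega (e omega).1 (e omega).2.
Proof.
move=> o1; have [[a1 oa] [b1 ob] ab] := e_longitude o1.
by split; exact: flagP.
Qed.

Lemma sphere_pointE omega nu phi :
  sphere_point e omega nu phi = circ (circ (e omega).1 (e omega).2 phi) omega nu.
Proof. by rewrite /sphere_point /circ addrC. Qed.

Lemma sphere_point0 omega t :
  sphere_point e omega 0 t = circ (e omega).1 (e omega).2 t.
Proof. by rewrite sphere_pointE circ0. Qed.

Lemma flag_sphere_point omega t : sphere omega -> flag omega (sphere_point e omega 0 t).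
Proof. by move=> o1; rewrite sphere_point0; exact: flag_frame_circ (longitude_frame o1) t. Qed.

Lemma sphere_sphere_point omega nu phi : sphere omega ->
  sphere (sphere_point e omega nu phi).
Proof.
move=> o1; rewrite sphere_pointE; apply: sphere_circ; apply: flag_sym.
exact: flag_frame_circ (longitude_frame o1) phi.
Qed.

Lemma flag_sphere_pointP omega psi : flag omega psi ->
  exists2 t : R, 0 <= t < 2 * pi & psi = sphere_point e omega 0 t.
Proof.
move=> op; have [t t2 ->] := frame_great_circle (longitude_frame op.1) op.
by exists t => //; rewrite sphere_point0.
Qed.

Lemma flag_average_trace h q x u v : curvature_pair h q -> frame x u v ->
  flag_average e q x = q x u + q x v.
Proof.
move=> hq fr'; have [xu xv uv] := fr'; have fr := longitude_frame xu.1.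
have -> : flag_average e q x = pi^-1 * itg 0 (2 * pi) (fun t => q x (circ (e x).1 (e x).2 t)).
  by congr (_ * _); apply: eq_Rintegral => t _; rewrite sphere_point0.
have [t _ ut] := frame_great_circle fr xu.
rewrite (frame_average hq fr t) -ut; congr (_ + _); rewrite circDpihalf.
(* The tangent of longitude [t + pi / 2] is perpendicular to [u], so it is [v] or [- v];
   [curvatureN] absorbs the sign. *)
have xw := flag_frame_circ fr (t + pi / 2); rewrite circDpihalf in xw.
have [s _ wE] := frame_great_circle fr' xw.
have uw : dot u (circ (e x).2 (- (e x).1) t) = 0.
  by case: fr => _ _ /(flag_circ t)/flag_dot[_ _ + _]; rewrite ut.
have [uu vv uv0 vu0] := flag_dot uv.
have cs0 : cos s = 0 by move: uw; rewrite wE dotC dot_circl uu vu0; lra.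
have : sin s ^+ 2 = 1 by rewrite sin2cos2 cs0; ring.
rewrite wE /circ cs0 scale0r add0r => /eqP; rewrite sqrf_eq1 => /orP[] /eqP ->.
  by rewrite scale1r.
by rewrite scaleN1r (curvatureN hq).
Qed.

Lemma curvature_formula h q omega t : curvature_pair h q -> sphere omega ->
  q omega (sphere_point e omega 0 t) = hemisphere_transform (flag_average e q) omega t.
Proof.
move=> hq o1; have [C qC] := curv_lip hq; have pi0 := pi_gt0 R.
have fr := longitude_frame o1.
have E := hemisphere_integral hq fr t qC.
have -> : hemisphere_transform (flag_average e q) omega t = flag_average e q omega / 2
   - (2 * pi)^-1 * (- 2 * itg 0 (2 * pi) (fun phi => q omega (circ (e omega).1 (e omega).2 phi) * cos (2 * (phi - t)))).
  rewrite -E; congr (_ - _ * _); apply: eq_Rintegral => nu _; apply: eq_Rintegral => phi _.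
  by rewrite sphere_pointE (flag_average_trace hq (frame_meridian phi nu fr)).
have -> : flag_average e q omega = pi^-1 * itg 0 (2 * pi) (fun t => q omega (circ (e omega).1 (e omega).2 t)).
  by congr (_ * _); apply: eq_Rintegral => s _; rewrite sphere_point0.
rewrite sphere_point0 (frame_curvature_fourier hq fr t); congr (_ + _).
rewrite mulNr mulrN opprK mulrA; congr (_ * _).
by rewrite invfM mulrAC mulVf ?mul1r.
Qed.

Definition sphere_lipschitz (f : 'rV[R]_3 -> R) L :=
  forall x y, sphere x -> sphere y -> `|f x - f y| <= L * `|x - y|.

(** * Controlling the denominator at the pole *)

Section Bound.
Variables (f : 'rV[R]_3 -> R) (L : R) (fL : sphere_lipschitz f L) (L0 : 0 <= L).
Variables (omega : 'rV[R]_3) (o1 : sphere omega) (t0 : R).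

Let c phi : R := cos (2 * (phi - t0)).
Definition meridian_fourier nu :=
  itg 0 (2 * pi) (fun phi => f (sphere_point e omega nu phi) * c phi).

Let fr := longitude_frame o1.

Let pi2 : 0 <= 2 * pi :> R.
Proof. by rewrite mulr_ge0// pi_ge0. Qed.

Let c_le1 phi : `|c phi| <= 1.
Proof. exact: cos_max. Qed.

Let weigh r phi K : `|r| <= K -> `|r * c phi| <= K.
Proof. by move=> rK; rewrite normrM -[leRHS]mulr1 ler_pM. Qed.

Lemma cos_fourier_derive phi :
  is_derive phi (1 : R) (fun phi => 2^-1 * sin (2 * (phi - t0))) (cos (2 * (phi - t0))).
Proof.
apply: (isd_eq _ (isdM (isd_cst _ phi) (isd_comp (isdM (isd_cst 2 phi) (isdB (isd_id phi) (isd_cst t0 phi))) (is_derive_sin _)))).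
by field.
Qed.

Let cont_c : continuous c.
Proof.
move=> phi.
exact: (isd_continuous (isd_comp (isdM (isd_cst 2 phi) (isdB (isd_id phi) (isd_cst t0 phi))) (is_derive_cos _))).
Qed.

Let c_int : itg 0 (2 * pi) c = 0.
Proof.
rewrite (itg_derive pi2 cos_fourier_derive cont_c).
rewrite (_ : 2 * (2 * pi - t0) = 2 * (0 - t0) + pi *+ 2 + pi *+ 2).
  by rewrite !sinD2pi subrr.
by rewrite -mulr_natl; ring.
Qed.

Let fP_continuous nu : continuous (fun phi => f (sphere_point e omega nu phi)).
Proof.
apply: (@lipschitz_continuous _ _ (2 * L)) => phi psi.
apply: le_trans (fL (sphere_sphere_point _ _ o1) (sphere_sphere_point _ _ o1)) _.
rewrite (_ : 2 * L * _ = L * (2 * `|phi - psi|)); last by ring.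
rewrite ler_wpM2l// !sphere_pointE.
apply: le_trans (circ_dist _ _ _ _ _) _.
by rewrite subrr normr0 addr0; apply: circ_lipschitz; case: fr.
Qed.

Lemma meridian_fourier_continuous : continuous meridian_fourier.
Proof.
apply: (@lipschitz_continuous _ _ (2 * L * (2 * pi - 0))) => nu nu'.
have c1 := continuous_fM (@fP_continuous nu) cont_c.
have c2 := continuous_fM (@fP_continuous nu') cont_c.
rewrite /meridian_fourier -itgB// mulrAC; apply: itg_bound => //.
  exact: continuous_fB.
move=> phi _; rewrite -mulrBl; apply: weigh.
apply: le_trans (fL (sphere_sphere_point _ _ o1) (sphere_sphere_point _ _ o1)) _.
rewrite (_ : 2 * L * _ = L * (2 * `|nu - nu'|)); last by ring.
rewrite ler_wpM2l// !sphere_pointE; apply: circ_lipschitz.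
exact: flag_sym (flag_frame_circ fr phi).
Qed.

(** Subtracting the constant [f omega] costs nothing because the weight has mean zero. Points of
    latitude [nu] are within [2 cos nu] of the pole, so the Lipschitz constant supplies the factor
    that cancels the denominator. *)
Lemma meridian_fourier_bound nu : 0 <= nu <= pi / 2 ->
  `|meridian_fourier nu| <= 4 * pi * L * cos nu.
Proof.
move=> nu2; have pi0 := pi_ge0 R.
have c0 : 0 <= cos nu by apply: cos_ge0_pihalf; lra.
have s0 : 0 <= sin nu by apply: sin_ge0_pi; lra.
have c1 := continuous_fM (@fP_continuous nu) cont_c.
have c2 : continuous (fun phi => f omega * c phi).
  by apply: continuous_fM cont_c => s; exact: cst_continuous.
have -> : meridian_fourier nu = itg 0 (2 * pi) (fun phi => f (sphere_point e omega nu phi) * c phi - f omega * c phi).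
  by rewrite itgB// (itgZl _ _ _ cont_c) c_int mulr0 subr0.
rewrite (_ : 4 * pi * L * cos nu = L * (2 * cos nu) * (2 * pi - 0)); last by ring.
apply: itg_bound => //; first exact: continuous_fB.
move=> phi _; rewrite -mulrBl; apply: weigh.
apply: le_trans (fL (sphere_sphere_point _ _ o1) o1) _.
rewrite ler_wpM2l//.
have cE : cos (pi / 2 - nu) = sin nu by rewrite -cosN opprB cosBpihalf.
have sE : sin (pi / 2 - nu) = cos nu by rewrite -[pi / 2 - nu]opprB sinN sinBpihalf opprK.
have -> : sphere_point e omega nu phi = circ omega (circ (e omega).1 (e omega).2 phi) (pi / 2 - nu).
  by rewrite sphere_pointE /circ cE sE addrC.
apply: le_trans (circ_near (flag_frame_circ fr phi) _) _; first by rewrite cE.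
by rewrite sE ger0_norm.
Qed.

Let pi0 : 0 < pi :> R := pi_gt0 R.
Let K0 : 0 <= 4 * pi * L.
Proof. by rewrite !mulr_ge0// ltW. Qed.

Definition meridian_quotient nu := meridian_fourier nu / cos nu.

Lemma meridian_quotient_bound nu : 0 <= nu <= pi / 2 ->
  `|meridian_quotient nu| <= 4 * pi * L.
Proof. exact: cos_quotient_bound K0 meridian_fourier_bound. Qed.

Lemma meridian_quotient_integrable :
  mu.-integrable `[0, pi / 2] (EFin \o meridian_quotient).
Proof. exact: cos_quotient_integrable K0 meridian_fourier_continuous meridian_fourier_bound. Qed.

Lemma hemisphere_transformE :
  hemisphere_transform f omega t0 =
  f omega / 2 - (2 * pi)^-1 * itg 0 (pi / 2) meridian_quotient.
Proof.
congr (_ - _ * _); apply: eq_Rintegral => nu _.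
have c1 := continuous_fM (@fP_continuous nu) cont_c.
exact: (itgZr _ _ _ c1).
Qed.

Lemma meridian_quotient_dist (g : 'rV[R]_3 -> R) d nu :
  (forall nu, continuous (fun phi => g (sphere_point e omega nu phi) * c phi)) ->
  (forall y, sphere y -> `|f y - g y| <= d) -> 0 < cos nu ->
  `|meridian_fourier nu - itg 0 (2 * pi) (fun phi => g (sphere_point e omega nu phi) * c phi)|
    <= 2 * pi * d.
Proof.
move=> cg fg cnu; have c1 := continuous_fM (@fP_continuous nu) cont_c.
rewrite -itgB// (_ : 2 * pi * d = d * (2 * pi - 0)); last by ring.
apply: itg_bound => //; first exact: continuous_fB.
move=> phi _; rewrite -mulrBl; apply: weigh; apply: fg.
exact: sphere_sphere_point.
Qed.

Lemma meridian_integrand_continuous nu :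
  continuous (fun phi => f (sphere_point e omega nu phi) * c phi).
Proof. exact: continuous_fM (@fP_continuous nu) cont_c. Qed.

End Bound.

(** The segment is cut at [pi / 2 - s]. Below the cut [cos nu >= s / 2], whence the requirement of
    closeness [s^2]; above it the common Lipschitz bound acts on a segment of length [s]. The
    constant collects [1] from the value at the pole, [4] from below and [4 L] from above the
    cut. *)
Lemma hemisphere_transform_dist f g L s omega t : 0 <= L ->
  sphere_lipschitz f L -> sphere_lipschitz g L -> sphere omega -> 0 < s <= 2^-1 ->
  (forall y, sphere y -> `|f y - g y| <= s ^+ 2) ->
  `|hemisphere_transform f omega t - hemisphere_transform g omega t| <= (5 + 4 * L) * s.
Proof.
move=> L0 fL gL o1 s2 fg; have /andP[s0 s1] := s2.
have pi0 := pi_gt0 R; have pih := @pihalf_ge1 R; have pi4 := @pihalf_lt2 R.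
rewrite (hemisphere_transformE fL L0 o1) (hemisphere_transformE gL L0 o1).
set mf := meridian_quotient f omega t; set mg := meridian_quotient g omega t.
have imf := meridian_quotient_integrable fL L0 o1 t.
have img := meridian_quotient_integrable gL L0 o1 t.
have imB := integrable_itvB imf img.
have bB nu : 0 <= nu <= pi / 2 -> `|mf nu - mg nu| <= 8 * pi * L.
  move=> nu2; have h1 := meridian_quotient_bound fL L0 o1 t nu2.
  have h2 := meridian_quotient_bound gL L0 o1 t nu2.
  by rewrite (le_trans (ler_normB _ _))//; rewrite /mf /mg; lra.
have ss := sin_ge_half (introT andP (conj (ltW s0) s1)).
have bs nu : 0 <= nu <= pi / 2 - s -> `|mf nu - mg nu| <= 4 * pi * s.
  move=> nu2.
  have cs : s / 2 <= cos nu.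
    have -> : cos nu = sin (pi / 2 - nu) by rewrite -[pi / 2 - nu]opprB sinN sinBpihalf opprK.
    apply: le_trans ss _.
    have : s <= pi / 2 - nu by lra.
    rewrite le_eqVlt => /predU1P[->//|sn].
    by rewrite ltW// ltr_sin ?in_itv//=; lra.
  have c0 : 0 < cos nu by lra.
  have D := meridian_quotient_dist fL L0 o1 (fun nu => @meridian_integrand_continuous _ _ gL L0 _ o1 t nu) fg c0.
  rewrite -mulrBl normrM normfV (gtr0_norm c0) ler_pdivrMr// (le_trans D)//.
  rewrite (_ : 2 * pi * s ^+ 2 = 4 * pi * s * (s / 2)); last by field.
  by rewrite ler_wpM2l// !mulr_ge0// ltW.
have r1 : 0 <= pi / 2 - s by lra.
have r2 : pi / 2 - s <= pi / 2 by lra.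
have sub : itg 0 (pi / 2) (fun nu => mf nu - mg nu) - itg 0 (pi / 2 - s) (fun nu => mf nu - mg nu) =
    \int[mu]_(nu in `](pi / 2 - s), pi / 2]) (mf nu - mg nu).
  by apply: Rintegral_itvB => //; rewrite bnd_simp.
have sub0 : mu.-integrable `](pi / 2 - s), pi / 2] (EFin \o (fun nu => mf nu - mg nu)).
  by apply: integrableS imB => //; apply: subset_itv; rewrite bnd_simp//; lra.
have sub1 : mu.-integrable `[pi / 2 - s, pi / 2] (EFin \o (fun nu => mf nu - mg nu)).
  by apply: integrableS imB => //; apply: subset_itv; rewrite bnd_simp//; lra.
have sub2 : mu.-integrable `[0, pi / 2 - s] (EFin \o (fun nu => mf nu - mg nu)).
  by apply: integrableS imB => //; apply: subset_itv; rewrite bnd_simp//; lra.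
have b1 : `|itg 0 (pi / 2) (fun nu => mf nu - mg nu) - itg 0 (pi / 2 - s) (fun nu => mf nu - mg nu)| <= 8 * pi * L * s.
  rewrite sub Rintegral_itv_obnd_cbnd// (_ : 8 * pi * L * s = 8 * pi * L * (pi / 2 - (pi / 2 - s))); last by ring.
  by apply: normr_itg_le => // nu nu2; apply: bB; lra.
have b2 : `|itg 0 (pi / 2 - s) (fun nu => mf nu - mg nu)| <= 4 * pi * s * (pi / 2 - s - 0).
  exact: normr_itg_le.
have b3 : 4 * pi * s * (pi / 2 - s - 0) <= 8 * pi * s.
  rewrite (_ : 8 * pi * s = 4 * pi * s * 2); last by ring.
  by rewrite ler_wpM2l// ?mulr_ge0// ?ltW//; lra.
have E : itg 0 (pi / 2) mf - itg 0 (pi / 2) mg = itg 0 (pi / 2) (fun nu => mf nu - mg nu) by rewrite RintegralB.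
rewrite (_ : _ - _ - _ = 2^-1 * (f omega - g omega) - (2 * pi)^-1 * (itg 0 (pi / 2) mf - itg 0 (pi / 2) mg)); last by ring.
have h0 : `|itg 0 (pi / 2) mf - itg 0 (pi / 2) mg| <= 2 * pi * ((4 + 4 * L) * s).
  have tri (r3 r4 : R) : `|r3| <= `|r3 - r4| + `|r4| by rewrite -{1}(subrK r4 r3) ler_normD.
  rewrite E; apply: le_trans (tri _ (itg 0 (pi / 2 - s) (fun nu => mf nu - mg nu))) _.
  rewrite (_ : 2 * pi * _ = 8 * pi * L * s + 8 * pi * s); last by ring.
  by rewrite lerD// (le_trans b2).
have h1 : `|2^-1 * (f omega - g omega)| <= s.
  rewrite normrM ger0_norm ?invr_ge0//; have := fg _ o1; nra.
have h2 : `|(2 * pi)^-1 * (itg 0 (pi / 2) mf - itg 0 (pi / 2) mg)| <= (4 + 4 * L) * s.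
  have p2 : 0 < 2 * pi :> R by rewrite mulr_gt0.
  by rewrite normrM gtr0_norm ?invr_gt0// ler_pdivrMl.
rewrite (le_trans (ler_normB _ _))// (_ : (5 + 4 * L) * s = s + (4 + 4 * L) * s); last by ring.
exact: lerD.
Qed.

End Transform.

(** * Even polynomials as traces of curvature forms *)

Section Solvable.
Context {R : realType}.
Implicit Types (x y u v a b : 'rV[R]_3) (s t k C : R) (j m n : nat).
Implicit Types (f g h : 'rV[R]_3 -> R) (q : 'rV[R]_3 -> 'rV[R]_3 -> R).

Definition flag_lip q := exists C, flag_lipschitz q C.

Lemma flag_lip_cst k : flag_lip (fun _ _ => k).
Proof. by exists 0 => x u y v _ _; rewrite subrr normr0 mul0r. Qed.

Lemma flag_lip_dot1 a : flag_lip (fun x _ => dot a x).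
Proof.
exists (3 * `|a|) => x u y v _ _.
rewrite -dotNr -dotDr (le_trans (normr_dot_le _ _))//.
by rewrite ler_wpM2l ?mulr_ge0// lerDl.
Qed.

Lemma flag_lip_dot2 a : flag_lip (fun _ u => dot a u).
Proof.
exists (3 * `|a|) => x u y v _ _.
rewrite -dotNr -dotDr (le_trans (normr_dot_le _ _))//.
by rewrite ler_wpM2l ?mulr_ge0// lerDr.
Qed.

Lemma flag_lipD q q' : flag_lip q -> flag_lip q' ->
  flag_lip (fun x u => q x u + q' x u).
Proof.
move=> [C qC] [C' qC']; exists (C + C') => x u y v xu yv.
rewrite (_ : _ - _ = (q x u - q y v) + (q' x u - q' y v)); last by ring.
by rewrite (le_trans (ler_normD _ _))// mulrDl lerD// ?qC ?qC'.
Qed.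

Lemma flag_lipM q q' : flag_lip q -> flag_lip q' ->
  flag_lip (fun x u => q x u * q' x u).
Proof.
move=> [C qC] [C' qC'].
have [M M0 qM] := flag_lipschitz_bounded qC.
have [M' M'0 qM'] := flag_lipschitz_bounded qC'.
exists (C * M' + M * C') => x u y v xu yv.
rewrite (_ : _ - _ = (q x u - q y v) * q' x u + q y v * (q' x u - q' y v)); last by ring.
rewrite (le_trans (ler_normD _ _))// !normrM mulrDl lerD//.
  by rewrite mulrAC ler_pM// ?qC ?qM'.
by rewrite -mulrA ler_pM// ?qM ?qC'.
Qed.

Lemma flag_lipX q n : flag_lip q -> flag_lip (fun x u => q x u ^+ n).
Proof.
move=> qL; elim: n => [|n IH]; first by under eq_fun do under eq_fun do rewrite expr0; exact: flag_lip_cst.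
under eq_fun do under eq_fun do rewrite exprS.
exact: flag_lipM.
Qed.

(** [g] stands for the gradient of an extension of [h] to the space. It makes the slope of [h]
    linear in the direction, a property that is later carried over to the limit. *)
Definition gradient_along h (g : 'rV[R]_3 -> 'rV[R]_3) := forall x u, flag x u ->
  forall t, is_derive t (1 : R) (fun t => h (circ x u t))
    (dot (g (circ x u t)) (circ u (- x) t)).

(* [f] is the trace of the curvature form of an even function, i.e.
   [f = Delta h + 2 h] on the sphere. *)
Definition solvable f := exists h q (g : 'rV[R]_3 -> 'rV[R]_3), [/\ curvature_pair h q, gradient_along h g
  & forall x u v, frame x u v -> q x u + q x v = f x].

Lemma solvable_ext f f' : (forall x, sphere x -> f x = f' x) -> solvable f -> solvable f'.
Proof.
move=> ff' [h [q [g [hq hg qf]]]]; exists h, q, g; split=> // x u v fr.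
by rewrite (qf _ _ _ fr) ff'//; case: fr => -[].
Qed.

Lemma solvableD f f' : solvable f -> solvable f' -> solvable (fun x => f x + f' x).
Proof.
move=> [h [q [g [hq hg qf]]]] [h' [q' [g' [hq' hg' qf']]]].
exists (fun x => h x + h' x), (fun x u => q x u + q' x u), (fun x => g x + g' x); split.
- split.
  + by move=> x x1; rewrite (curv_even hq)// (curv_even hq').
  + exact: flag_lipD (curv_lip hq) (curv_lip hq').
  + move=> x u xu; have [p [dp dp1]] := curv_ode hq xu.
    have [p' [dp' dp1']] := curv_ode hq' xu.
    exists (fun t => p t + p' t); split=> t; first exact: isdD.
    by apply: (isd_eq _ (isdD (dp1 t) (dp1' t))); ring.
- by move=> x u xu t; rewrite dotDl; apply: isdD; [exact: hg|exact: hg'].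
- by move=> x u v fr; rewrite -(qf _ _ _ fr) -(qf' _ _ _ fr); ring.
Qed.

Lemma solvableZ k f : solvable f -> solvable (fun x => k * f x).
Proof.
move=> [h [q [g [hq hg qf]]]].
exists (fun x => k * h x), (fun x u => k * q x u), (fun x => k *: g x); split.
- split.
  + by move=> x x1; rewrite (curv_even hq).
  + exact: flag_lipM (flag_lip_cst k) (curv_lip hq).
  + move=> x u xu; have [p [dp dp1]] := curv_ode hq xu.
    exists (fun t => k * p t); split=> t.
      by apply: (isd_eq _ (isdM (isd_cst k t) (dp t))); ring.
    by apply: (isd_eq _ (isdM (isd_cst k t) (dp1 t))); ring.
- move=> x u xu t; rewrite dotZl.
  by apply: (isd_eq _ (isdM (isd_cst k t) (hg _ _ xu t))); ring.
- by move=> x u v fr; rewrite -(qf _ _ _ fr); ring.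
Qed.

Lemma is_derive_dot_circ a x u t :
  is_derive t (1 : R) (fun t => dot a (circ x u t)) (dot a (circ u (- x) t)).
Proof.
have -> : (fun t => dot a (circ x u t)) = (fun t => cos t * dot a x + sin t * dot a u).
  by apply/funext => r; rewrite /circ !dotE.
apply: (isd_eq _ (isdD (isdM (is_derive_cos t) (isd_cst (dot a x) t))
  (isdM (is_derive_sin t) (isd_cst (dot a u) t)))).
by rewrite /circ !dotE; ring.
Qed.

(** [p'' + p] along a great circle for the power [j] of a linear form. For [j < 2] the truncated
    exponent [j.-2] is harmless, as its coefficient vanishes. *)
Definition power_curvature a j x u : R :=
  j%:R * (j%:R - 1) * dot a x ^+ j.-2 * dot a u ^+ 2 - (j%:R - 1) * dot a x ^+ j.

Lemma power_curvature_pair a j : ~~ odd j ->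
  curvature_pair (fun x => dot a x ^+ j) (power_curvature a j).
Proof.
move=> jo; split.
- by move=> x _; rewrite dotNr exprNn -signr_odd (negbTE jo) expr0 mul1r.
- apply: flag_lipD.
    apply: flag_lipM; last exact: flag_lipX (flag_lip_dot2 a).
    by apply: flag_lipM; [exact: flag_lip_cst|exact: flag_lipX (flag_lip_dot1 a)].
  have -> : (fun x _ : 'rV[R]_3 => - ((j%:R - 1) * dot a x ^+ j)) = (fun x _ => (1 - j%:R) * dot a x ^+ j).
    by apply/funext => x; apply/funext => _; ring.
  by apply: flag_lipM; [exact: flag_lip_cst|exact: flag_lipX (flag_lip_dot1 a)].
- move=> x u xu; exists (fun t => j%:R * dot a (circ x u t) ^+ j.-1 * dot a (circ u (- x) t)).
  split=> t; first exact: (isdX j (is_derive_dot_circ a x u t)).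
  have d2 := is_derive_dot_circ a u (- x) t.
  apply: (isd_eq _ (isdM (isdM (isd_cst j%:R t) (isdX j.-1 (is_derive_dot_circ a x u t))) d2)).
  rewrite circN dotNr /power_curvature; case: j {jo} => [|[|j]]; rewrite /= ?expr0; [ring|ring|].
  by rewrite !exprS -[j.+2%:R]natr1 -[j.+1%:R]natr1; ring.
Qed.

Lemma power_gradient a j :
  gradient_along (fun x => dot a x ^+ j) (fun x => (j%:R * dot a x ^+ j.-1) *: a).
Proof.
move=> x u xu t; rewrite dotZl.
exact: (isdX j (is_derive_dot_circ a x u t)).
Qed.

Lemma frame_dot a x u v : frame x u v ->
  dot a a = dot a x ^+ 2 + dot a u ^+ 2 + dot a v ^+ 2.
Proof. by move=> fr; rewrite {2}(frame_decomp a fr) !dotE; ring. Qed.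

Lemma power_trace a j x u v : frame x u v ->
  power_curvature a j x u + power_curvature a j x v =
  j%:R * (j%:R - 1) * dot a a * dot a x ^+ j.-2 - (j%:R - 1) * (j%:R + 2) * dot a x ^+ j.
Proof.
move=> fr; rewrite (frame_dot a fr) /power_curvature.
case: j => [|[|j]]; rewrite /= ?expr0 ?expr1; [ring|ring|].
by rewrite !exprS; ring.
Qed.

(** Triangular recursion: the trace belonging to the power [j] combines the powers [j] and [j - 2].
    The coefficient [(j - 1) (j + 2)] of the former vanishes for [j = 1] alone, since curvature does
    not see linear functions; even powers stay clear of it. *)
Lemma solvable_even_power a m : solvable (fun x => dot a x ^+ m.*2).
Proof.
elim: m => [|m IH].
  apply: (@solvable_ext (fun x => 2^-1 * (2 * dot a x ^+ 0))) => [x _|].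
    by rewrite expr0; field.
  apply: solvableZ; exists (fun x => dot a x ^+ 0), (power_curvature a 0), (fun x => (0%:R * dot a x ^+ 0) *: a); split.
  - exact: power_curvature_pair.
  - exact: power_gradient.
  - by move=> x u v fr; rewrite (power_trace a 0 fr) /= expr0; ring.
rewrite doubleS; set j := m.*2.+2.
have jo : ~~ odd j by rewrite /j /= odd_double.
have S : solvable (fun x => j%:R * (j%:R - 1) * dot a a * dot a x ^+ m.*2 - (j%:R - 1) * (j%:R + 2) * dot a x ^+ j).
  exists (fun x => dot a x ^+ j), (power_curvature a j), (fun x => (j%:R * dot a x ^+ j.-1) *: a); split.
  - exact: power_curvature_pair.
  - exact: power_gradient.
  - by move=> x u v fr; rewrite (power_trace a j fr).
have j1 : j%:R - 1 != 0 :> R by rewrite subr_eq0 pnatr_eq1.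
have j2 : j%:R + 2 != 0 :> R by rewrite gt_eqF// ltr_wpDl.
pose c : R := ((j%:R - 1) * (j%:R + 2))^-1.
have := solvableD (solvableZ (- c) S) (solvableZ (c * (j%:R * (j%:R - 1) * dot a a)) IH).
apply: solvable_ext => x _; rewrite /c.
have := mulf_neq0 j1 j2; set P : R := _ * (_ + 2) => P0.
by field.
Qed.

(** These functions are the polynomials on the space. Powers of linear forms are chosen as
    generators because their even parts are solvable; closure under multiplication by linear forms
    is [power_span_linear]. *)
Inductive power_span : ('rV[R]_3 -> R) -> Prop :=
| power_span_pow a j : power_span (fun x => dot a x ^+ j)
| power_spanD f g : power_span f -> power_span g -> power_span (fun x => f x + g x)
| power_spanZ k f : power_span f -> power_span (fun x => k * f x).

Lemma power_span_cst k : power_span (fun=> k).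
Proof.
have := power_spanZ k (power_span_pow 0 0).
by under eq_fun do rewrite expr0 mulr1.
Qed.

Lemma power_span_sum n (F : 'I_n -> 'rV[R]_3 -> R) :
  (forall i, power_span (F i)) -> power_span (fun x => \sum_i F i x).
Proof.
elim: n F => [|n IH] F FP.
  by under eq_fun do rewrite big_ord0; exact: power_span_cst.
under eq_fun do rewrite big_ord_recl.
by apply: power_spanD => //; apply: (IH (fun i => F (lift ord0 i))) => i; exact: FP.
Qed.

Lemma solvable_even_part f : power_span f -> solvable (fun x => f x + f (- x)).
Proof.
elim=> [a j|g g' _ S _ S'|k g _ S].
- apply: (@solvable_ext (fun x => (1 + (-1) ^+ odd j) * dot a x ^+ j)) => [x _|].
    by rewrite dotNr [in RHS]exprNn signr_odd; ring.
  case: (boolP (odd j)) => jo.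
    apply: (@solvable_ext (fun x => 0 * dot a x ^+ 0.*2)); last first.
      by apply: solvableZ; exact: solvable_even_power.
    by move=> x _; rewrite expr1 subrr !mul0r.
  by apply: solvableZ; rewrite -(even_halfK jo); exact: solvable_even_power.
- by apply: solvable_ext (solvableD S S') => x _; ring.
- by apply: solvable_ext (solvableZ k S) => x _; ring.
Qed.

(** The Vandermonde system with nodes [0, ..., n + 1]: the weights read off the linear coefficient
    of a polynomial of degree at most [n + 1]. *)
Lemma first_coefficient_weights n : exists w s : 'I_n.+2 -> R,
  forall k : nat, (k < n.+2)%N -> \sum_i w i * s i ^+ k = (k == 1%N)%:R.
Proof.
pose s := \row_(i < n.+2) (i%:R : R).
have V : Vandermonde n.+2 s \in unitmx.
  rewrite unitmxE det_Vandermonde unitfE; apply/prodf_neq0 => i _.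
  apply/prodf_neq0 => j ij; rewrite !mxE subr_eq0 eqr_nat neq_ltn ij orbT.
  by [].
pose c : 'cV[R]_n.+2 := \col_k ((k == 1%N :> nat)%:R).
exists (fun i => (invmx (Vandermonde n.+2 s) *m c) i 0), (fun i => s 0 i) => k kn.
have := mulKVmx V c => /matrixP/(_ (Ordinal kn) 0); rewrite !mxE => <-.
by apply: eq_bigr => i _; rewrite !mxE mulrC.
Qed.

(* Differentiating [(dot (a + s b) x) ^ j.+1] in [s] at [0] by a finite
   quadrature formula. *)
Lemma power_span_linear b f : power_span f -> power_span (fun x => dot b x * f x).
Proof.
elim=> [a j|g g' _ S _ S'|k g _ S].
- have [w [s ws]] := first_coefficient_weights j.
  have : power_span (fun x => \sum_i (j.+1%:R^-1 * w i) * dot (a + s i *: b) x ^+ j.+1).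
    by apply: power_span_sum => i; apply: power_spanZ; exact: power_span_pow.
  congr power_span; apply/funext => x.
  under eq_bigr => i _ do rewrite dotDl dotZl exprDn mulr_sumr.
  rewrite exchange_big/=.
  have j0 : j.+1%:R != 0 :> R by rewrite pnatr_eq0.
  transitivity (\sum_(k < j.+2) (j.+1%:R^-1 * (dot a x ^+ (j.+1 - k) * dot b x ^+ k *+ 'C(j.+1, k))) * \sum_i w i * s i ^+ k).
    apply: eq_bigr => k _; rewrite mulr_sumr; apply: eq_bigr => i _.
    rewrite exprMn !(mulrnAr, mulrnAl); congr (_ *+ _).
    rewrite -!mulrA; congr (_ * _); rewrite [LHS]mulrCA; congr (_ * _).
    by rewrite [RHS]mulrC -mulrA.
  rewrite (bigD1 (Ordinal (isT : (1 < j.+2)%N)))//= ws// eqxx mulr1 big1 ?addr0; last first.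
    move=> k k1; rewrite ws//; rewrite (_ : (k == 1%N :> nat) = false) ?mulr0//.
    by apply: negbTE; apply: contra k1 => /eqP k1; apply/eqP/val_inj.
  by rewrite subn1 /= expr1 bin1 -mulr_natr; field.
- by have := power_spanD S S'; congr power_span; apply/funext => x; ring.
- by have := power_spanZ k S; congr power_span; apply/funext => x; ring.
Qed.

End Solvable.

(** * Polynomial approximation preserving Lipschitz bounds *)

Section Bernstein.
Context {R : realType}.
Implicit Types (x y z c : 'rV[R]_3) (s t k L d : R) (m n : nat) (i : 'I_3).
Implicit Types (f g : 'rV[R]_3 -> R).

Definition lipschitz_everywhere f L := forall x y, `|f x - f y| <= L * `|x - y|.

(* One step of a random walk on [R^3]: a coordinate is chosen uniformly and
   moved by [s] or [-s], with mean [s x / 3]. *)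
Definition walk s x g y : R :=
  \sum_i ((1 + x 0 i) / 6 * g (y + s *: delta_mx 0 i)
        + (1 - x 0 i) / 6 * g (y - s *: delta_mx 0 i)).

(** The expectation of [g] after [m] steps. For [s = 3 / m] and start at [0] the mean position is
    [x], and the expectation is a Bernstein-type polynomial in [x]. *)
Definition walks s m x g : 'rV[R]_3 -> R := iter m (walk s x) g.

Let sum3 (F : 'I_3 -> R) :
  \sum_i F i = F ord0 + F (lift ord0 ord0) + F (lift ord0 (lift ord0 ord0)).
Proof. by rewrite !big_ord_recl big_ord0 addr0 addrA. Qed.

Section Cube.
Variables (s : R) (s0 : 0 <= s) (x : 'rV[R]_3) (x1 : `|x| <= 1).

Let xi i : -1 <= x 0 i <= 1.
Proof. by rewrite -ler_norml (le_trans (coord_le_norm x i)). Qed.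

Let wp i : 0 <= (1 + x 0 i) / 6.
Proof. by rewrite divr_ge0//; have := xi i; lra. Qed.

Let wm i : 0 <= (1 - x 0 i) / 6.
Proof. by rewrite divr_ge0//; have := xi i; lra. Qed.

Lemma walk_le g g' y : (forall y, g y <= g' y) -> walk s x g y <= walk s x g' y.
Proof. by move=> gg'; apply: ler_sum => i _; rewrite lerD// ler_wpM2l. Qed.

Lemma walks_le m g g' y : (forall y, g y <= g' y) -> walks s m x g y <= walks s m x g' y.
Proof. by move=> gg'; elim: m y => [|m IH] y //=; exact: walk_le. Qed.

Lemma walk_affine k d g y : walk s x (fun y => k + d * g y) y = k + d * walk s x g y.
Proof.
by rewrite /walk mulr_sumr [in LHS]sum3 [in RHS]sum3; field.
Qed.

Lemma walks_affine m k d g y : walks s m x (fun y => k + d * g y) y = k + d * walks s m x g y.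
Proof.
elim: m y => [|m IH] y //=; rewrite /walks /= -walk_affine.
by congr (walk _ _ _ _); apply/funext => z; exact: IH.
Qed.

Lemma walk_bound g d y : (forall y, `|g y| <= d) -> `|walk s x g y| <= d.
Proof.
move=> gd; have gd' z : - d <= g z <= d by rewrite -ler_norml.
have := walk_affine d 0 g y; have := walk_affine (- d) 0 g y.
rewrite !mul0r !addr0 => e1 e2.
rewrite ler_norml -{1}e1 -{2}e2; apply/andP; split; apply: walk_le => z;
  have := gd' z; lra.
Qed.

Lemma walk_lipschitz g L : lipschitz_everywhere g L -> lipschitz_everywhere (walk s x g) L.
Proof.
move=> gL y z.
have -> : walk s x g y - walk s x g z = walk s x (fun v => g (v + y) - g (v + z)) 0.
  rewrite /walk -sumrB; apply: eq_bigr => i _.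
  rewrite add0r sub0r (addrC (s *: delta_mx 0 i)) (addrC (s *: delta_mx 0 i)).
  rewrite (addrC (- (s *: delta_mx 0 i))) (addrC (- (s *: delta_mx 0 i))).
  have fct (p q r1 r2 r3 r4 : R) : p * r1 + q * r2 - (p * r3 + q * r4) = p * (r1 - r3) + q * (r2 - r4) by ring.
  exact: fct.
apply: walk_bound => v.
by rewrite (le_trans (gL _ _))// (_ : v + y - (v + z) = y - z)// opprD addrACA subrr add0r.
Qed.

Lemma walks_lipschitz m g L : lipschitz_everywhere g L -> lipschitz_everywhere (walks s m x g) L.
Proof. by move=> gL; elim: m => [|m IH] //=; exact: walk_lipschitz. Qed.

(** A step has length [s] and mean [s x / 3], so its variance is [s^2 - |s x / 3|^2] in the
    Euclidean norm; the negative term is dropped. *)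
Lemma walk_dist_sq c y :
  walk s x (fun y => dot (y - c) (y - c)) y <=
  dot (y + (s / 3) *: x - c) (y + (s / 3) *: x - c) + s ^+ 2.
Proof.
have dE i : dot (delta_mx 0 i) (delta_mx 0 i) = 1 :> R.
  rewrite dot_sum (bigD1 i)//= !mxE !eqxx mulr1 big1 ?addr0// => j ji.
  by rewrite !mxE (negbTE ji) andbF mul0r.
have dy (v : 'rV[R]_3) i : dot v (delta_mx 0 i) = v 0 i.
  rewrite dot_sum (bigD1 i)//= !mxE !eqxx mulr1 big1 ?addr0// => j ji.
  by rewrite !mxE (negbTE ji) andbF mulr0.
have E : walk s x (fun y => dot (y - c) (y - c)) y = dot (y - c) (y - c) + s ^+ 2 + 2 * (s / 3) * dot (y - c) x.
  rewrite /walk.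
  have T i : (1 + x 0 i) / 6 * dot (y + s *: delta_mx 0 i - c) (y + s *: delta_mx 0 i - c)
        + (1 - x 0 i) / 6 * dot (y - s *: delta_mx 0 i - c) (y - s *: delta_mx 0 i - c)
     = (dot (y - c) (y - c) + s ^+ 2) / 3 + 2 * (s / 3) * ((y - c) 0 i * x 0 i).
    rewrite (_ : y + s *: delta_mx 0 i - c = (y - c) + s *: delta_mx 0 i); last by rewrite addrAC.
    rewrite (_ : y - s *: delta_mx 0 i - c = (y - c) - s *: delta_mx 0 i); last by rewrite addrAC.
    move: (y - c) => v; rewrite !dotDl !dotDr !(dotNl, dotNr) !(dotZl, dotZr) dE (dotC _ v) dy.
    by field.
  under eq_bigr => i _ do rewrite T.
  rewrite big_split/= -[X in _ + X]mulr_sumr -dot_sum.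
  by rewrite big_const_ord /=; field.
rewrite {}E (_ : y + (s / 3) *: x - c = (y - c) + (s / 3) *: x); last by rewrite addrAC.
move: (y - c) => v; rewrite !dotE (dotC x v).
have := dot_ge0 x; have := sqr_ge0 (s / 3); set k := s / 3 => k0 xx.
have : 0 <= k * (k * dot x x) by rewrite mulrA -expr2 mulr_ge0.
lra.
Qed.

Lemma walks_dist_sq m c y :
  walks s m x (fun y => dot (y - c) (y - c)) y <=
  dot (y + (m%:R * (s / 3)) *: x - c) (y + (m%:R * (s / 3)) *: x - c) + m%:R * s ^+ 2.
Proof.
elim: m y => [|m IH] y; first by rewrite /walks /= !mul0r scale0r !addr0.
rewrite /walks /=; apply: le_trans (walk_le _ IH) _.
have -> : walk s x (fun y => dot (y + (m%:R * (s / 3)) *: x - c) (y + (m%:R * (s / 3)) *: x - c) + m%:R * s ^+ 2) y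
   = m%:R * s ^+ 2 + 1 * walk s x (fun y => dot (y - (c - (m%:R * (s / 3)) *: x)) (y - (c - (m%:R * (s / 3)) *: x))) y.
  rewrite -walk_affine; congr (walk _ _ _ _); apply/funext => z.
  by rewrite mul1r addrC opprB addrA addrAC.
rewrite mul1r -(natr1 m).
have := walk_dist_sq (c - (m%:R * (s / 3)) *: x) y.
rewrite (_ : y + (s / 3) *: x - (c - (m%:R * (s / 3)) *: x) = y + ((m%:R + 1) * (s / 3)) *: x - c); last first.
  by apply/rowP => i; rewrite !mxE; ring.
by move=> h; rewrite [(m%:R + 1) * s ^+ 2]mulrDl mul1r [leRHS]addrCA lerD2l.
Qed.

Lemma walk_dist g L x' y : `|x'| <= 1 -> lipschitz_everywhere g L ->
  `|walk s x g y - walk s x' g y| <= s * L * `|x - x'|.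
Proof.
move=> x'1 gL.
have L0 : 0 <= L.
  have := gL (delta_mx 0 0) 0; rewrite subr0.
  have n0 : 0 < `|delta_mx 0 0 : 'rV[R]_3|.
    rewrite normr_gt0; apply/eqP => /matrixP/(_ 0 0); rewrite !mxE !eqxx => /eqP.
    by rewrite oner_eq0.
  by move=> /(le_trans (normr_ge0 _)); rewrite pmulr_lge0.
rewrite /walk -sumrB.
apply: le_trans (ler_norm_sum _ _ _) _.
have -> : s * L * `|x - x'| = \sum_(i < 3) (s * L * `|x - x'|) / 3 by rewrite big_const_ord /=; field.
apply: ler_sum => i _.
have xx : `|x 0 i - x' 0 i| <= `|x - x'| by have := coord_le_norm (x - x') i; rewrite !mxE.
have gg : `|g (y + s *: delta_mx 0 i) - g (y - s *: delta_mx 0 i)| <= L * (2 * s).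
  apply: le_trans (gL _ _) _; rewrite ler_wpM2l//.
  rewrite (_ : _ - _ = (2 * s) *: delta_mx 0 i); last by apply/rowP => j; rewrite !mxE; ring.
  rewrite normrZ ger0_norm ?mulr_ge0// -[leRHS]mulr1 ler_wpM2l ?mulr_ge0//.
  apply: norm_row_le => // j; rewrite mxE eqxx /=.
  by case: (j == i); rewrite ?normr1 ?normr0.
rewrite (_ : _ - _ = (x 0 i - x' 0 i) / 6 * (g (y + s *: delta_mx 0 i) - g (y - s *: delta_mx 0 i))); last by field.
rewrite !normrM (_ : s * L * `|x - x'| / 3 = `|x - x'| * `|6^-1| * (L * (2 * s))); last first.
  by rewrite ger0_norm ?invr_ge0//; field.
by rewrite ler_pM ?mulr_ge0// ler_wpM2r.
Qed.

End Cube.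

(** Telescoping: exchanging [x] for [x'] in one step costs [s L |x - x'|], and the other steps
    enlarge neither Lipschitz constants nor uniform distances. With [s = 3 / m] the total is
    [3 L |x - x'|], whatever the degree. *)
Lemma walks_dist s m g L x x' y : 0 <= s -> `|x| <= 1 -> `|x'| <= 1 -> lipschitz_everywhere g L ->
  `|walks s m x g y - walks s m x' g y| <= m%:R * (s * L * `|x - x'|).
Proof.
move=> s0 x1 x'1 gL; elim: m y => [|m IH] y; first by rewrite /walks /= subrr normr0 mul0r.
rewrite /walks /= -/(walks s m x g) -/(walks s m x' g).
rewrite (_ : _ - _ = (walk s x (walks s m x g) y - walk s x' (walks s m x g) y)
   + (walk s x' (walks s m x g) y - walk s x' (walks s m x' g) y)); last by ring.
rewrite (le_trans (ler_normD _ _))// -natr1 mulrDl mul1r addrC lerD//.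
  have -> : walk s x' (walks s m x g) y - walk s x' (walks s m x' g) y =
      walk s x' (fun y => walks s m x g y - walks s m x' g y) y.
    by rewrite /walk -sumrB; apply: eq_bigr => i _; ring.
  exact: walk_bound.
by apply: walk_dist => //; exact: walks_lipschitz.
Qed.

(** Chebyshev's argument: [|y - x|] is at most [d + |y - x|^2 / d], and after [n] steps of length
    [3 / n] the mean square distance to [x] is at most [9 / n]. *)
Lemma walks_approx n g L x d : (0 < n)%N -> `|x| <= 1 -> 0 < d -> 0 <= L ->
  lipschitz_everywhere g L ->
  `|walks (3 / n%:R) n x g 0 - g x| <= L * (d + 9 / (n%:R * d)).
Proof.
move=> n0 x1 d0 L0 gL.
have nR : 0 < n%:R :> R by rewrite ltr0n.
have s0 : 0 <= 3 / n%:R :> R by rewrite divr_ge0// ltW.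
have V := walks_dist_sq (3 / n%:R) x1 n x 0.
rewrite (_ : n%:R * (3 / n%:R / 3) = 1 :> R) in V; last by field; rewrite gt_eqF.
rewrite scale1r add0r subrr dot0l add0r in V.
have V0 : 0 <= walks (3 / n%:R) n x (fun y => dot (y - x) (y - x)) 0.
  have := @walks_le (3 / n%:R) _ x1 n (fun=> 0) _ 0 (fun y => dot_ge0 (y - x)).
  have := walks_affine (3 / n%:R) x n 0 0 (fun=> 0) 0; rewrite !mul0r !addr0.
  by move=> ->.
have dist y : `|g y - g x| <= L * d + L / d * dot (y - x) (y - x).
  apply: le_trans (gL _ _) _; rewrite -mulrA -mulrDr ler_wpM2l//.
  have nn : `|y - x| ^+ 2 <= dot (y - x) (y - x).
    have [i ->] : exists i, `|y - x| = `|(y - x) 0 i|.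
      have [->|n1] := eqVneq (y - x) 0; first by exists 0; rewrite mxE !normr0.
      have : mx_norm (y - x) != 0 by apply: contra_neq n1; exact: mx_norm_eq0.
      by move=> /mx_norm_neq0[[i j] /= E]; exists j; rewrite [LHS]E ord1.
    rewrite real_normK ?num_real// dot_sum (bigD1 i)//= -expr2 lerDl sumr_ge0// => j _.
    by rewrite -expr2 sqr_ge0.
  rewrite -(ler_pM2l d0) mulrDr mulrA divff ?gt_eqF// mul1r.
  have := normr_ge0 (y - x); nra.
have B : L * d + L / d * walks (3 / n%:R) n x (fun y => dot (y - x) (y - x)) 0 <= L * (d + 9 / (n%:R * d)).
  rewrite mulrDr lerD2l -mulrA ler_wpM2l// (_ : 9 / (n%:R * d) = d^-1 * (n%:R * (3 / n%:R) ^+ 2)).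
    by rewrite ler_wpM2l ?invr_ge0// ltW.
  by field; rewrite !gt_eqF.
rewrite ler_norml; apply/andP; split.
  have : walks (3 / n%:R) n x (fun y => (g x - L * d) + (- (L / d)) * dot (y - x) (y - x)) 0 <= walks (3 / n%:R) n x g 0.
    by apply: walks_le => // y; have := dist y; rewrite ler_norml => /andP[]; lra.
  by rewrite walks_affine; lra.
have : walks (3 / n%:R) n x g 0 <= walks (3 / n%:R) n x (fun y => (g x + L * d) + (L / d) * dot (y - x) (y - x)) 0.
  by apply: walks_le => // y; have := dist y; rewrite ler_norml => /andP[]; lra.
by rewrite walks_affine; lra.
Qed.

Lemma walks_power_span s m g y : power_span (fun x => walks s m x g y).
Proof.
elim: m y => [|m IH] y; first exact: power_span_cst.
apply: power_span_sum => i.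
have E x : x 0 i = dot (delta_mx 0 i) x.
  rewrite dot_sum (bigD1 i)//= !mxE !eqxx mul1r big1 ?addr0// => j ji.
  by rewrite !mxE (negbTE ji) andbF mul0r.
have aff k (F : 'rV[R]_3 -> R) : power_span F -> power_span (fun x => (1 + k * x 0 i) / 6 * F x).
  move=> FP; have := power_spanD (power_spanZ 6^-1 FP) (power_spanZ (k / 6) (power_span_linear (delta_mx 0 i) FP)).
  by congr power_span; apply/funext => x; rewrite E; ring.
apply: power_spanD; first by have := aff 1 _ (IH (y + s *: delta_mx 0 i)); under eq_fun do rewrite mul1r.
by have := aff (-1) _ (IH (y - s *: delta_mx 0 i)); under eq_fun do rewrite mulN1r.
Qed.

(** McShane's extension, made necessary by the walk, whose positions do not lie on the sphere. *)
Lemma sphere_lipschitz_extension f L : 0 <= L -> sphere_lipschitz f L ->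
  exists2 g, lipschitz_everywhere g L & forall x, sphere x -> g x = f x.
Proof.
move=> L0 fL.
have [y0 [y01 _ _]] := @exists_common_tangent R 0 0.
pose A x := [set r : R | exists2 y, sphere y & r = f y - L * `|x - y|].
pose g x := sup (A x).
have Aub x : ubound (A x) (f y0 + L * `|x - y0|).
  move=> r [y y1 ->].
  have := fL y y0 y1 y01; rewrite ler_norml => /andP[_ h1].
  have h2 : L * `|y - y0| <= L * (`|x - y| + `|x - y0|).
    rewrite ler_wpM2l// (_ : y - y0 = - (x - y) + (x - y0)); last by rewrite opprB addrA subrK.
    by rewrite (le_trans (ler_normD _ _))// normrN.
  lra.
have Asup x : has_sup (A x).
  by split; [exists (f y0 - L * `|x - y0|), y0|exists (f y0 + L * `|x - y0|)].
have le_g x y : sphere y -> f y - L * `|x - y| <= g x.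
  by move=> y1; apply: ub_le_sup; [case: (Asup x)|exists y].
exists g.
  have H x y : g x <= g y + L * `|x - y|.
    apply: ge_sup => [|r [z z1 ->]]; first by case: (Asup x).
    have h1 := le_g y z z1.
    have : L * `|y - z| <= L * (`|x - y| + `|x - z|).
      rewrite ler_wpM2l// (_ : y - z = - (x - y) + (x - z)); last by rewrite opprB addrA subrK.
      by rewrite (le_trans (ler_normD _ _))// normrN.
    lra.
  move=> x y; rewrite ler_norml; have := H x y; have := H y x; rewrite (distrC y x).
  by move=> h1 h2; apply/andP; split; lra.
move=> x x1; apply/eqP; rewrite eq_le; apply/andP; split.
  apply: ge_sup => [|r [y y1 ->]]; first by case: (Asup x).
  by have := fL y x y1 x1; rewrite ler_norml distrC => /andP[_]; lra.
by have := le_g x x x1; rewrite subrr normr0 mulr0 subr0.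
Qed.

Lemma solvable_approx f L d : 0 <= L -> sphere_lipschitz f L ->
  (forall x, sphere x -> f (- x) = f x) -> 0 < d ->
  exists f', [/\ solvable f', sphere_lipschitz f' (3 * L)
    & forall x, sphere x -> `|f x - f' x| <= d].
Proof.
move=> L0 fL fN d0.
have [g gL gf] := sphere_lipschitz_extension L0 fL.
(* Once [9 / (n d') <= d'], the error is at most [2 L d' <= d]; the summand [1] covers [L = 0]. *)
pose d' := d / (2 * (L + 1)).
have d'0 : 0 < d' by rewrite divr_gt0// mulr_gt0// ltr_wpDl.
have [n n0 nd] : exists2 n, (0 < n)%N & 9 / (n%:R * d') <= d'.
  exists (Num.truncn (9 / d' ^+ 2)).+1 => //.
  have := truncnS_gt (9 / d' ^+ 2); set N := Num.truncn _ => nb.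
  have nR : 0 < N.+1%:R :> R by rewrite ltr0n.
  rewrite ltr_pdivrMr ?exprn_gt0// expr2 in nb.
  have Nd : 0 < N.+1%:R * d' by rewrite mulr_gt0.
  by rewrite (ler_pdivrMr _ _ Nd) (mulrCA d'); exact: ltW.
pose b x := walks (3 / n%:R) n x g 0.
have nR : 0 < n%:R :> R by rewrite ltr0n.
have s0 : 0 <= 3 / n%:R :> R by rewrite divr_ge0// ltW.
have bl x x' : `|x| <= 1 -> `|x'| <= 1 -> `|b x - b x'| <= 3 * L * `|x - x'|.
  move=> x1 x'1; apply: le_trans (walks_dist n 0 s0 x1 x'1 gL) _.
  by rewrite le_eqVlt; apply/orP; left; apply/eqP; field; rewrite gt_eqF.
have ba x : sphere x -> `|f x - b x| <= d.
  move=> x1; rewrite distrC -gf//.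
  apply: le_trans (walks_approx n0 (sphere_norm_le1 x1) d'0 L0 gL) _.
  apply: (@le_trans _ _ (L * (2 * d'))); first by rewrite ler_wpM2l//; lra.
  rewrite /d' (_ : L * (2 * (d / (2 * (L + 1)))) = d * (L / (L + 1))); last first.
    by field; rewrite gt_eqF// ltr_wpDl.
  have L1 : 0 < L + 1 by rewrite ltr_wpDl.
  rewrite -[leRHS]mulr1 ler_wpM2l ?(ltW d0)// ler_pdivrMr// mul1r; lra.
have sN x : sphere x -> sphere (- x) by rewrite /sphere/= !dotE opprK.
exists (fun x => 2^-1 * (b x + b (- x))); split.
- by apply: solvableZ; apply: solvable_even_part; exact: walks_power_span.
- move=> x y x1 y1.
  have x2 := sphere_norm_le1 x1; have y2 := sphere_norm_le1 y1.
  have h1 := bl x y x2 y2; have h2 : `|b (- x) - b (- y)| <= 3 * L * `|x - y|.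
    by apply: le_trans (bl _ _ _ _) _; rewrite ?normrN// -opprD normrN.
  rewrite (_ : _ - _ = 2^-1 * ((b x - b y) + (b (- x) - b (- y)))); last by ring.
  rewrite normrM ger0_norm ?invr_ge0//.
  have := ler_normD (b x - b y) (b (- x) - b (- y)); lra.
- move=> x x1; have h1 := ba x x1; have h2 := ba (- x) (sN x x1).
  rewrite fN// in h2.
  rewrite (_ : _ - _ = 2^-1 * ((f x - b x) + (f x - b (- x)))); last by field.
  rewrite normrM ger0_norm ?invr_ge0//.
  have := ler_normD (f x - b x) (f x - b (- x)); lra.
Qed.

End Bernstein.

(** * Lipschitz continuity of continuously differentiable functions of flags *)

Section Lipschitz.
Context {R : realType}.
Local Notation V := ('rV[R]_3 * 'rV[R]_3)%type.
Implicit Types (p v : V) (G : V -> R) (F : 'rV[R]_3 -> 'rV[R]_3 -> R).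

(** Continuity of the differential is given direction by direction, so its norm is controlled
    through the values on a basis. *)
Lemma linear_bound (f : {linear V -> R}) v :
  `|f v| <= (\sum_i (`|f (delta_mx 0 i, 0)| + `|f (0, delta_mx 0 i)|)) * `|v|.
Proof.
have vE : v = \sum_i (v.1 0 i *: (delta_mx 0 i, 0) + v.2 0 i *: (0, delta_mx 0 i)).
  rewrite {1}(surjective_pairing v) {1}(row_sum_delta v.1) {1}(row_sum_delta v.2).
  rewrite !big_ord_recl !big_ord0; apply/pair_equal_spec; split => /=;
    by rewrite !scaler0 !(addr0, add0r).
rewrite {1}vE linear_sum mulr_suml; apply: le_trans (ler_norm_sum _ _ _) _.
apply: ler_sum => i _; rewrite linearD !linearZ /= mulrDl.
have v1 : `|v.1 0 i| <= `|v| by rewrite (le_trans (coord_le_norm _ _))// /Num.norm/= le_max lexx.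
have v2 : `|v.2 0 i| <= `|v| by rewrite (le_trans (coord_le_norm _ _))// /Num.norm/= le_max lexx orbT.
rewrite (le_trans (ler_normD _ _))// !normrM lerD// mulrC ler_wpM2l//.
Qed.

Lemma derive_segment G p v t : differentiable G (p + t *: v) ->
  is_derive t (1 : R) (fun s => G (p + s *: v)) ('d G (p + t *: v) v).
Proof.
move=> dG; have dv : derivable G (p + t *: v) v by exact: diff_derivable.
have E : (fun h : R => h^-1 *: (((fun s => G (p + s *: v)) \o shift t) (h *: 1) - G (p + t *: v)))
   = (fun h => h^-1 *: ((G \o shift (p + t *: v)) (h *: v) - G (p + t *: v))).
  apply/funext => h /=; congr (_ *: (G _ - _)).
  by rewrite [h *: 1]mulr1 scalerDl addrCA.
split; first by rewrite /derivable E.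
by rewrite /derive E -deriveE.
Qed.

Lemma C1_on_lipschitz_near (U : set V) G p : open U -> U p -> C1_on U G ->
  exists C r, [/\ 0 <= C, 0 < r & forall v v', `|p - v| < r -> `|p - v'| < r ->
    U v /\ `|G v - G v'| <= C * `|v - v'|].
Proof.
move=> oU Up GU; have [_ Gp] := GU p Up.
pose b (j : bool * 'I_3) : V := if j.1 then (delta_mx 0 j.2, 0) else (0, delta_mx 0 j.2).
pose M := \sum_i ((`|'d G p (b (true, i))| + 1) + (`|'d G p (b (false, i))| + 1)).
have M0 : 0 <= M by rewrite sumr_ge0// => i _; rewrite !addr_ge0.
have : \forall y \near p, U y /\ forall j, `|'d G y (b j)| <= `|'d G p (b j)| + 1.
  near=> y; split; first by near: y; exact: open_nbhs_nbhs.
  near: y; apply: filter_forall => j.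
  have /cvgrPdist_lt/(_ 1 ltr01) := Gp (b j).
  have fct (k l : R) : `|k - l| < 1 -> `|l| <= `|k| + 1.
    by move=> kl; have := ler_normB k (k - l); rewrite subKr; lra.
  by apply: filterS => y; exact: fct.
move=> /nbhs_normP[r /= r0 rU]; exists M, r; split=> // v v' vr v'r.
have inr (t : R) : 0 <= t <= 1 -> `|p - (v' + t *: (v - v'))| < r.
  move=> /andP[t0 t1].
  rewrite (_ : _ - _ = (1 - t) *: (p - v') + t *: (p - v)); last first.
    rewrite opprD addrA (_ : v - v' = (p - v') - (p - v)).
      by rewrite scalerBr scalerBl scale1r opprB addrA addrAC.
    by rewrite opprB [RHS]addrC addrA subrK.
  rewrite (le_lt_trans (ler_normD _ _))// !normrZ !ger0_norm ?subr_ge0//.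
  have : Num.max `|p - v'| `|p - v| < r by rewrite gt_max v'r.
  set m := Num.max _ _; have am : `|p - v'| <= m by rewrite le_max lexx.
  have bm : `|p - v| <= m by rewrite le_max lexx orbT.
  have : (1 - t) * `|p - v'| <= (1 - t) * m by rewrite ler_wpM2l// subr_ge0.
  have : t * `|p - v| <= t * m by rewrite ler_wpM2l.
  lra.
split; first by have [] := rU v vr.
have D (t : R) : 0 <= t <= 1 -> is_derive t (1 : R) (fun s => G (v' + s *: (v - v')))
   ('d G (v' + t *: (v - v')) (v - v')).
  by move=> /inr t1; apply: derive_segment; have [/GU[]] := rU _ t1.
have [t|t t1|t] := @MVT R (fun s => G (v' + s *: (v - v')))
    (fun t => 'd G (v' + t *: (v - v')) (v - v')) 0 1 ltr01.
- by rewrite in_itv/= => /andP[/ltW t0 /ltW t1]; apply: D; rewrite t0.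
- move: t t1; apply: derivable_within_continuous => t; rewrite in_itv/= => t1.
  by case: (D t t1).
rewrite in_itv/= => /andP[/ltW t0 /ltW t1].
rewrite scale0r addr0 scale1r (addrC v') subrK subr0 mulr1 => ->.
apply: le_trans (linear_bound _ _) _; rewrite ler_wpM2r//.
have [|_ H] := rU (v' + t *: (v - v')); first by apply: inr; rewrite t0.
by apply: ler_sum => i _; rewrite lerD//; [exact: (H (true, i))|exact: (H (false, i))].
Unshelve. all: by end_near. Qed.

Lemma continuous_dot (T : topologicalType) (f g : T -> 'rV[R]_3) :
  continuous f -> continuous g -> continuous (fun z => dot (f z) (g z)).
Proof.
move=> cf cg z; rewrite (_ : (fun z => _) = (fun z => \sum_i f z 0 i * g z 0 i)); last first.
  by apply/funext => y; rewrite dot_sum.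
rewrite (_ : (fun z => _) = (fun z => f z 0 ord0 * g z 0 ord0 + (f z 0 (lift ord0 ord0) * g z 0 (lift ord0 ord0) + f z 0 (lift ord0 (lift ord0 ord0)) * g z 0 (lift ord0 (lift ord0 ord0))))); last first.
  by apply/funext => y; rewrite !big_ord_recl big_ord0 addr0.
have c i (h : T -> 'rV[R]_3) : continuous h -> {for z, continuous (fun z => h z 0 i)}.
  move=> ch; apply: (@continuous_comp _ _ _ h (fun x : 'rV[R]_3 => x 0 i)); first exact: ch.
  exact: coord_continuous.
by apply: cvgD; [|apply: cvgD]; apply: cvgM; exact: c.
Qed.

Lemma flag_compact : compact [set p : V | flag p.1 p.2].
Proof.
have sub : [set p : V | flag p.1 p.2] `<=` [set x : 'rV[R]_3 | `|x| <= 1] `*` [set x : 'rV[R]_3 | `|x| <= 1].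
  by move=> [x u] /= [x1 [u1 _]]; split; exact: sphere_norm_le1.
have b1 : compact [set x : 'rV[R]_3 | `|x| <= 1].
  apply: bounded_closed_compact.
    by exists 1; split => // M M1 x /= x1; exact: le_trans x1 (ltW M1).
  rewrite (_ : [set x | _] = (Num.norm : 'rV[R]_3 -> R) @^-1` [set t | t <= 1])//.
  by apply: closed_comp => [x _|]; [exact: norm_continuous|exact: closed_le].
apply: (subclosed_compact _ _ sub); last exact: compact_setX.
have cl (f : V -> R) k : continuous f -> closed [set p | f p = k].
  move=> cf; rewrite (_ : [set p | _] = f @^-1` [set k])//.
  by apply: closed_comp => [x _|]; [exact: cf|exact: closed_eq].
have c1 : continuous (fst : V -> _) by move=> p; exact: cvg_fst.
have c2 : continuous (snd : V -> _) by move=> p; exact: cvg_snd.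
rewrite (_ : [set p | _] = [set p : V | dot p.1 p.1 = 1] `&` ([set p | dot p.2 p.2 = 1] `&` [set p | dot p.1 p.2 = 0])).
  have d11 := continuous_dot c1 c1; have d22 := continuous_dot c2 c2; have d12 := continuous_dot c1 c2.
  by apply: closedI; [exact: (cl _ _ d11)|apply: closedI; [exact: (cl _ _ d22)|exact: (cl _ _ d12)]].
by apply/seteqP; split => p.
Qed.

(** Compactness makes the local Lipschitz constants uniform. Distant flags are treated by the bound
    on [|F|], since the segment joining them need not stay in the flag manifold. *)
Lemma flag_C1_lipschitz F : flag_C1 F -> exists C, flag_lipschitz F C.
Proof.
move=> F1.
pose f (p : V) := F p.1 p.2.
have loc (p : V) : flag p.1 p.2 -> exists C r, [/\ 0 <= C, 0 < r & forall v v',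
    flag v.1 v.2 -> flag v'.1 v'.2 -> `|p - v| < r -> `|p - v'| < r -> `|f v - f v'| <= C * `|v - v'|].
  case: p => x u /= /F1[U [G [oU Uxu GU FG]]].
  have [C [r [C0 r0 H]]] := C1_on_lipschitz_near oU Uxu GU.
  exists C, r; split => // -[y w] [y' w'] /= fy fy' yr y'r.
  have [Uy le] := H _ _ yr y'r; have [Uy' _] := H _ _ y'r yr.
  by rewrite /f/= FG// FG.
(* One number bounds [f], serves as local Lipschitz constant, and has the radius as its inverse. All
   three conditions weaken as [C] grows, which suits a covering argument near [+oo]. *)
pose P (C : R) (p : V) := flag p.1 p.2 -> `|f p| <= C /\
  forall q : V, flag q.1 q.2 -> `|p - q| < C^-1 -> `|f p - f q| <= C * `|p - q|.
have nb p r : 0 < r -> \forall p' \near p, `|p - p'| < r.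
  by move=> r0; apply/nbhs_normP; exists r.
have /compact_near_coveringP cov := flag_compact.
have : \forall C \near +oo, [set p : V | flag p.1 p.2] `<=` P C.
  apply: cov => p fp; have [C [r [C0 r0 H]]] := loc p fp.
  exists ([set p' | `|p - p'| < r / 2], [set D | Num.max (2 / r) (Num.max C (`|f p| + C * r)) < D]).
    split => /=; last by apply: nbhs_pinfty_gt; exact: num_real.
    exact: nb (divr_gt0 r0 _).
  move=> [p' D] /= [pp']; rewrite !gt_max => /and3P[rD CD pD] fp'; split.
    have := H p p' fp fp'; rewrite subrr normr0 => /(_ r0).
    have pr : `|p - p'| < r by lra.
    move=> /(_ pr); rewrite distrC => le.
    have := le_trans (lerB_dist _ _) le.
    have : C * `|p - p'| <= C * r by rewrite ler_wpM2l// ltW.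
    lra.
  move=> q fq qD.
  have D0 : 0 < D by rewrite (lt_trans _ rD)// divr_gt0.
  have Dr : D^-1 < r / 2 by rewrite -(invf_div 2 r) ltf_pV2// posrE divr_gt0.
  apply: le_trans (H p' q fp' fq _ _) _; first lra.
    rewrite (_ : p - q = (p - p') + (p' - q)); last by rewrite addrA subrK.
    have := ler_normD (p - p') (p' - q); lra.
  by rewrite ler_wpM2r// ltW.
move=> /(filterI (nbhs_pinfty_gt (num_real 0)))/filter_ex [D [/= D0 DP]].
(* [D] serves for flags closer than [D^-1]; for the others [2 D <= 2 D^2 (|x - y| + |u - v|)]. *)
exists (D + 2 * D ^+ 2) => x u y v fx fy.
pose p : V := (x, u); pose q : V := (y, v).
have [pD pl] := DP p fx fx; have [qD _] := DP q fy fy.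
have n1 : `|p - q| <= `|x - y| + `|u - v|.
  have -> : `|p - q| = Num.max `|x - y| `|u - v| by [].
  by rewrite ge_max lerDl lerDr !normr_ge0.
have [h|h] := ltP `|p - q| D^-1.
  apply: le_trans (pl q fy h) _.
  have D2 : 0 <= D ^+ 2 := sqr_ge0 D.
  by apply: ler_pM => //; [exact: ltW|lra].
apply: (@le_trans _ _ (D + D)).
  by apply: le_trans (ler_normB _ _) _; exact: lerD.
have h2 : D^-1 <= `|x - y| + `|u - v| by exact: le_trans h n1.
have : 1 <= D * (`|x - y| + `|u - v|) by rewrite -ler_pdivrMl// mulr1.
move: (`|x - y| + `|u - v|) h2 => s h2 h3.
have s0 : 0 <= s by rewrite (le_trans _ h2)// invr_ge0 ltW.
have h4 : D * 1 <= D * (D * s) by rewrite ler_wpM2l// ltW.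
have h5 : 0 <= D * s by rewrite mulr_ge0// ltW.
rewrite mulrDl expr2 -!mulrA; lra.
Qed.

End Lipschitz.

(** * Integrating a function that satisfies the formula *)

Section Converse.
Context {R : realType}.
Implicit Types (x y u v a b omega psi : 'rV[R]_3) (s t d eps : R).

Notation mu := (@lebesgue_measure R).
Notation itg a b f := (\int[mu]_(x in `[a, b]) f x).

(* When the integral of [f] is undefined or infinite, both sides are [0], since
   [fine] sends both infinities to [0]. *)
Lemma Rintegral_opp (D : set R) (f : R -> R) :
  \int[mu]_(x in D) (- f x) = - \int[mu]_(x in D) f x.
Proof.
rewrite /Rintegral [in LHS]integralE [in RHS]integralE.
have -> : (fun r => (- f r)%:E) = (\- (fun r => (f r)%:E))%E :> (R -> \bar R) by [].
rewrite funeposN funenegN.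
by case: (integral _ _ _) => [r| |]; case: (integral _ _ _) => [r'| |] //=; rewrite ?oppr0// opprB.
Qed.

(** [k] is only continuous, so the integrands cannot be differentiated in [t]. The addition formulas
    turn them into integrals of [k sin] and [k cos] over [[t, t + pi]], with [t] in the limits of
    integration and in smooth factors. *)
Lemma half_turn_derive (k : R -> R) t : continuous k -> (forall t, k (t + pi) = k t) ->
  is_derive t (1 : R) (fun t => 2^-1 * itg 0 pi (fun s => k (t + s) * sin s))
    (- 2^-1 * itg 0 pi (fun s => k (t + s) * cos s)) /\
  is_derive t (1 : R) (fun t => - 2^-1 * itg 0 pi (fun s => k (t + s) * cos s))
    (k t - 2^-1 * itg 0 pi (fun s => k (t + s) * sin s)).
Proof.
move=> ck kpi; have cs : continuous (@cos R) by exact: continuous_cos.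
have cn : continuous (@sin R) by exact: continuous_sin.
have [A dA] := primitive (continuous_fM ck cn).
have [B dB] := primitive (continuous_fM ck cs).
have shift (f df : R -> R) (c s : R) : (forall r, is_derive r (1 : R) f (df r)) ->
    is_derive s (1 : R) (fun s => f (c + s)) (df (c + s)).
  move=> fd; apply: (isd_eq _ (isd_comp (isdD (isd_cst c s) (isd_id s)) (fd (c + s)))).
  by rewrite add0r mulr1.
have ckt (c : R) : continuous (fun s => k (c + s)).
  move=> s; apply: (@continuous_comp _ _ _ (fun s => c + s) k); last exact: ck.
  by apply: cvgD; [exact: cvg_cst|exact: cvg_id].
pose S t := A (pi + t) - A t; pose K t := B (pi + t) - B t.
have dS s : is_derive s (1 : R) S (- 2 * (k s * sin s)).
  apply: (isd_eq _ (isdB (shift _ _ pi s dA) (dA s))).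
  by rewrite (addrC pi) kpi sinDpi; ring.
have dK s : is_derive s (1 : R) K (- 2 * (k s * cos s)).
  apply: (isd_eq _ (isdB (shift _ _ pi s dB) (dB s))).
  by rewrite (addrC pi) kpi cosDpi; ring.
have ES s : itg 0 pi (fun r => k (s + r) * sin r) = cos s * S s - sin s * K s.
  have D r : is_derive r (1 : R) (fun r => cos s * A (s + r) - sin s * B (s + r)) (k (s + r) * sin r).
    apply: (isd_eq _ (isdB (isdM (isd_cst (cos s) r) (shift _ _ s r dA)) (isdM (isd_cst (sin s) r) (shift _ _ s r dB)))).
    have -> : sin r = sin (s + r) * cos s - cos (s + r) * sin s by rewrite -sinB addrAC subrr add0r.
    by rewrite /=; ring.
  rewrite (itg_derive (pi_ge0 R) D (continuous_fM (ckt s) cn)) !addr0 /S /K (addrC pi s); ring.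
have EK s : itg 0 pi (fun r => k (s + r) * cos r) = sin s * S s + cos s * K s.
  have D r : is_derive r (1 : R) (fun r => sin s * A (s + r) + cos s * B (s + r)) (k (s + r) * cos r).
    apply: (isd_eq _ (isdD (isdM (isd_cst (sin s) r) (shift _ _ s r dA)) (isdM (isd_cst (cos s) r) (shift _ _ s r dB)))).
    have -> : cos r = cos (s + r) * cos s + sin (s + r) * sin s by rewrite -cosB addrAC subrr add0r.
    by rewrite /=; ring.
  rewrite (itg_derive (pi_ge0 R) D (continuous_fM (ckt s) cs)) !addr0 /S /K (addrC pi s); ring.
have -> : (fun t => 2^-1 * itg 0 pi (fun s => k (t + s) * sin s)) = (fun t => 2^-1 * (cos t * S t - sin t * K t)).
  by apply/funext => s; rewrite ES.
have -> : (fun t => - 2^-1 * itg 0 pi (fun s => k (t + s) * cos s)) = (fun t => - 2^-1 * (sin t * S t + cos t * K t)).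
  by apply/funext => s; rewrite EK.
rewrite EK ES; have ct := cos2Dsin2 t; split.
  apply: (isd_eq _ (isdM (isd_cst 2^-1 t) (isdB (isdM (is_derive_cos t) (dS t)) (isdM (is_derive_sin t) (dK t))))).
  by rewrite /=; field.
apply: (isd_eq _ (isdM (isd_cst (- 2^-1) t) (isdD (isdM (is_derive_sin t) (dS t)) (isdM (is_derive_cos t) (dK t))))).
have -> : k t - 2^-1 * (cos t * S t - sin t * K t) =
    k t * (cos t ^+ 2 + sin t ^+ 2) - 2^-1 * (cos t * S t - sin t * K t) by rewrite ct mulr1.
by rewrite /=; field.
Qed.

(** * Approximation of a solution of the formula by curvatures *)

Section Formula.
Variables (e : 'rV[R]_3 -> 'rV[R]_3 * 'rV[R]_3) (e_longitude : longitude_system e).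
Variables (q : 'rV[R]_3 -> 'rV[R]_3 -> R) (C : R) (qC : flag_lipschitz q C).
Hypothesis q_sym : flag_symmetric q.
Hypothesis q_formula : forall omega t, sphere omega -> 0 <= t < 2 * pi ->
  q omega (sphere_point e omega 0 t) = hemisphere_transform e (flag_average e q) omega t.

(** Perpendicular directions differ by a quarter turn in longitude, which changes the sign of
    [cos (2 (phi - t))]: the integrals in the two instances of the formula cancel. Thus [q] has a
    trace before it is known to be a curvature. *)
Lemma formula_trace x u v : frame x u v -> q x u + q x v = flag_average e q x.
Proof.
move=> [xu xv uv].
have [t t2 ut] := flag_sphere_pointP e_longitude xu.
have [t' t'2 vt] := flag_sphere_pointP e_longitude xv.
have x1 : sphere x by case: xu.
rewrite ut vt !q_formula//.
have [_ /flag_dot[bb _ _ _] /flag_dot[aa bb' ab ba]] := longitude_frame e_longitude x1.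
have c0 : cos (t - t') = 0.
  have /flag_dot[_ _ + _] := uv.
  rewrite ut vt !sphere_point0 /circ !dotE aa ab ba bb' cosB => <-; ring.
have cc phi : cos (2 * (phi - t')) = - cos (2 * (phi - t)).
  have -> : 2 * (phi - t') = 2 * (phi - t) + ((t - t') + (t - t')) by ring.
  have s1 := cos2Dsin2 (t - t').
  rewrite cosD [cos (_ + _)]cosD [sin (t - t' + _)]sinD c0 !mul0r !mulr0 addr0 mulr0 subr0 sub0r.
  move: s1; rewrite c0 !expr2 mul0r add0r => ->.
  by rewrite mulrN1.
rewrite /hemisphere_transform.
have -> : (fun nu => \int[mu]_(phi in `[0, 2 * pi]) (flag_average e q (sphere_point e x nu phi) * cos (2 * (phi - t')) / cos nu))
    = (fun nu => - \int[mu]_(phi in `[0, 2 * pi]) (flag_average e q (sphere_point e x nu phi) * cos (2 * (phi - t)) / cos nu)).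
  apply/funext => nu; rewrite -Rintegral_opp; congr (Rintegral _ _ _).
  by apply/funext => phi; rewrite cc mulrN mulNr.
rewrite Rintegral_opp mulrN; move: (_^-1 * Rintegral _ _ _) (flag_average _ _ _) => r1 r2; lra.
Qed.

Lemma trace_even x : sphere x -> flag_average e q (- x) = flag_average e q x.
Proof.
move=> x1; have fr := longitude_frame e_longitude x1.
have fr' : frame (- x) (e x).1 (e x).2.
  by case: fr => f1 f2 f3; split => //; exact: flag_normN.
rewrite -(formula_trace fr) -(formula_trace fr'); case: fr => f1 f2 _.
by rewrite (q_sym f1).2 (q_sym f2).2.
Qed.

(** The longitude system [e] may be discontinuous, so the averages are computed as traces in frames
    at [x] and [y] sharing a tangent [u]. The other tangent moves by at most [6 |x - y|], and the
    total is [C + 7 C]. *)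
Lemma trace_lipschitz : sphere_lipschitz (flag_average e q) (8 * C).
Proof.
move=> x y x1 y1; have C0 := flag_lipschitz_ge0 qC.
have [u [u1 xu yu]] := exists_common_tangent x y.
have fxu : flag x u by [].
have [v fr] := exists_frame fxu.
have [_ fxv fuv] := fr.
have frU : frame u x v by split => //; exact: flag_sym.
have [t _ yE] := frame_great_circle frU (flag_sym (conj y1 (conj u1 yu))).
have fr' := frame_rot t frU; rewrite -yE in fr'.
have fr2 : frame y u (circ v (- x) t).
  by case: fr' => f1 f2 f3; split => //; exact: flag_sym.
rewrite -(formula_trace fr) -(formula_trace fr2).
have [xx vv xv vx] := flag_dot fxv.
have x2 := sphere_norm_le1 x1; have v2 : `|v| <= 1 by apply: sphere_norm_le1; case: fxv => _ [].
have D : x - y = (1 - cos t) *: x - sin t *: v.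
  by rewrite {1}yE /circ; apply/rowP => i; rewrite !mxE; ring.
have d1 : `|1 - cos t| <= 3 * `|x - y|.
  have -> : 1 - cos t = dot (x - y) x by rewrite D !dotE xx vx; ring.
  by rewrite (le_trans (normr_dot_le _ _))// -[leRHS]mulr1 ler_wpM2l// mulr_ge0.
have d2 : `|sin t| <= 3 * `|x - y|.
  have -> : sin t = - dot (x - y) v by rewrite D !dotE vv xv; ring.
  by rewrite normrN (le_trans (normr_dot_le _ _))// -[leRHS]mulr1 ler_wpM2l// mulr_ge0.
have d3 : `|v - circ v (- x) t| <= 6 * `|x - y|.
  rewrite (_ : _ - _ = (1 - cos t) *: v + sin t *: x); last first.
    by rewrite /circ; apply/rowP => i; rewrite !mxE; ring.
  rewrite (le_trans (ler_normD _ _))// !normrZ.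
  have : `|1 - cos t| * `|v| <= `|1 - cos t| by rewrite -[leRHS]mulr1 ler_wpM2l.
  have : `|sin t| * `|x| <= `|sin t| by rewrite -[leRHS]mulr1 ler_wpM2l.
  move: (`|1 - _| * _) (`|sin _| * _) => r1 r2; lra.
have [fyu fyv _] := fr2.
have h1 := qC fxu fyu; have h2 := qC fxv fyv.
rewrite subrr normr0 addr0 in h1.
have h3 : C * (`|x - y| + `|v - circ v (- x) t|) <= C * (7 * `|x - y|).
  by rewrite ler_wpM2l//; lra.
rewrite opprD addrACA (le_trans (ler_normD _ _))//.
lra.
Qed.

(** Both [q] and the curvature [q'] are transforms of their own traces, so it suffices to
    approximate the trace within [s^2] under the common Lipschitz constant [3 (8 C)]; [K] is the
    resulting constant of [hemisphere_transform_dist]. *)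
Lemma curvature_approx eps : 0 < eps -> exists h q' g, [/\ curvature_pair h q',
  gradient_along h g & forall x u, flag x u -> `|q x u - q' x u| <= eps].
Proof.
move=> eps0; have C0 := flag_lipschitz_ge0 qC.
have L0 : 0 <= 8 * C by rewrite mulr_ge0.
have L30 : 0 <= 3 * (8 * C) by rewrite mulr_ge0.
pose K := 5 + 4 * (3 * (8 * C)).
have K0 : 0 < K by rewrite ltr_pwDl// mulr_ge0.
pose s := Num.min 2^-1 (eps / K).
have s0 : 0 < s by rewrite lt_min invr_gt0 ltr0n divr_gt0.
have s1 : s <= 2^-1 by rewrite ge_min lexx.
have sK : K * s <= eps by rewrite mulrC -ler_pdivlMr// ge_min lexx orbT.
have [f' [[h [q' [g [hq hg tr]]]] f'L f'd]] := solvable_approx L0 trace_lipschitz trace_even (exprn_gt0 2 s0).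
exists h, q', g; split => // x u fxu.
have E y : sphere y -> flag_average e q' y = f' y.
  move=> y1; have fr := longitude_frame e_longitude y1.
  by rewrite (flag_average_trace e_longitude hq fr) (tr _ _ _ fr).
have x1 : sphere x by case: fxu.
have [t t2 ->] := flag_sphere_pointP e_longitude fxu.
rewrite q_formula// (curvature_formula e_longitude t hq x1).
apply: le_trans sK; apply: hemisphere_transform_dist => //.
- move=> y z y1 z1; apply: le_trans (trace_lipschitz y1 z1) _.
  by rewrite ler_wpM2r//; lra.
- by move=> y z y1 z1; rewrite !E//; exact: f'L.
- by rewrite s0.
- by move=> y y1; rewrite E//; exact: f'd.
Qed.

Lemma half_turn_indep x u v : flag x u -> flag x v -> half_turn q x u = half_turn q x v.
Proof.
move=> xu xv; apply/eqP; rewrite -subr_eq0; apply/eqP.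
apply: (@eq0_of_small _ _ 4) => z /andP[z0 _].
have [h [q' [g [hq hg qq]]]] := curvature_approx z0.
have [C' q'C] := curv_lip hq.
have H w : flag x w -> `|half_turn q x w - h x| <= 2 * z.
  move=> xw; have [-> _ _] := curvature_primitive hq xw.
  by apply: (half_turn_dist qC q'C) => // s; apply: qq; exact: flag_circ.
have := H u xu; have := H v xv; rewrite distrC.
have := ler_normD (half_turn q x u - h x) (h x - half_turn q x v).
rewrite addrA subrK; lra.
Qed.

Lemma slope_linear x a b t : frame x a b ->
  slope q x (circ a b t) = cos t * slope q x a + sin t * slope q x b.
Proof.
move=> fr; apply/eqP; rewrite -subr_eq0; apply/eqP.
apply: (@eq0_of_small _ _ 6) => z /andP[z0 _].
have [h [q' [g [hq hg qq]]]] := curvature_approx z0.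
have [C' q'C] := curv_lip hq.
(* For the approximating pair the slope is [dot (g x) w], exactly linear in [w]. *)
have H w : flag x w -> `|slope q x w - dot (g x) w| <= 2 * z.
  move=> xw; have [_ /(_ 0) d1 _] := curvature_primitive hq xw.
  have := isd_unique d1 (hg _ _ xw 0); rewrite !circ0 => <-.
  by apply: (slope_dist qC q'C) => // s; apply: qq; exact: flag_circ.
have h1 := H _ (flag_frame_circ fr t).
have [xa xb _] := fr; have h2 := H _ xa; have h3 := H _ xb.
rewrite /circ !dotE -/(circ a b t) in h1.
have h4 : `|cos t * (dot (g x) a - slope q x a)| <= 2 * z.
  rewrite normrM (le_trans _ h2)// distrC -[leRHS]mul1r ler_wpM2r// ler_norml cos_le1 cos_geN1//.
have h5 : `|sin t * (dot (g x) b - slope q x b)| <= 2 * z.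
  rewrite normrM (le_trans _ h3)// distrC -[leRHS]mul1r ler_wpM2r// ler_norml sin_le1 sin_geN1//.
have fct (r1 r2 r3 r4 r5 r6 r7 : R) : r1 - (r2 * r3 + r4 * r5) =
  (r1 - (r2 * r6 + r4 * r7)) + (r2 * (r6 - r3) + r4 * (r7 - r5)) by ring.
rewrite (fct _ _ _ _ _ (dot (g x) a) (dot (g x) b)).
apply: le_trans (ler_normD _ _) _.
have := ler_normD (cos t * (dot (g x) a - slope q x a)) (sin t * (dot (g x) b - slope q x b)).
lra.
Qed.

(** The tangent is picked by choice; under the formula the value does not depend on it, by
    [half_turn_indep]. *)
Definition half_turn_potential x := half_turn q x (xget 0 [set u | flag x u]).

Lemma half_turn_potentialE x u : flag x u -> half_turn_potential x = half_turn q x u.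
Proof.
move=> xu; apply: half_turn_indep => //.
exact: (@xgetPex _ 0 [set u | flag x u] (ex_intro _ u xu)).
Qed.

Lemma formula_curvature_pair : curvature_pair half_turn_potential q.
Proof.
have qNN x u : flag x u -> q (- x) (- u) = q x u.
  by move=> xu; rewrite -(q_sym (flagN xu)).2 -(q_sym xu).1.
split; last 1 first.
- move=> x u xu; exists (fun t => slope q (circ x u t) (circ u (- x) t)).
  pose k t := q (circ x u t) (circ u (- x) t).
  have ck : continuous k by exact: continuous_flag_circ qC xu.
  have kpi t : k (t + pi) = k t.
    by rewrite /k !circDpi qNN//; exact: flag_circ.
  have E1 : (fun t => half_turn_potential (circ x u t)) = (fun t => 2^-1 * itg 0 pi (fun s => k (t + s) * sin s)).
    apply/funext => t; rewrite (half_turn_potentialE (flag_circ t xu)) /half_turn.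
    by congr (_ * Rintegral _ _ _); apply/funext => s; rewrite /k circD circ_tangentD.
  have E2 : (fun t => slope q (circ x u t) (circ u (- x) t)) = (fun t => - 2^-1 * itg 0 pi (fun s => k (t + s) * cos s)).
    apply/funext => t; rewrite /slope.
    by congr (_ * Rintegral _ _ _); apply/funext => s; rewrite /k circD circ_tangentD.
  split=> t; have [d1 d2] := half_turn_derive t ck kpi.
    by rewrite E1; move/funeqP/(_ t): E2 => ->.
  by rewrite E2 -/(k t); move/funeqP/(_ t): E1 => ->.
- move=> x x1; have [u [u1 xu _]] := exists_common_tangent x x.
  have fxu : flag x u by [].
  rewrite (half_turn_potentialE fxu) (half_turn_potentialE (flag_normN (flagN fxu))) /half_turn.
  congr (_ * Rintegral _ _ _); apply/funext => s; congr (_ * _).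
  by rewrite circN (circN u (- x)) qNN//; exact: flag_circ.
- by exists C.
Qed.

End Formula.
End Converse.

(** * Support functions and bodies *)

Section Body.
Context {R : realType}.
Implicit Types (x y u v a b omega psi : 'rV[R]_3) (s t : R) (B : set 'rV[R]_3).

Definition support B u : R := sup [set dot x u | x in B].

Lemma proj_supportE B omega psi : flag omega psi ->
  proj_support B omega psi = fun t => support B (circ omega psi t).
Proof.
move=> /flag_dot[oo pp op po]; apply/funext => t; congr sup; rewrite image_comp.
apply/seteqP; split => _ [x Bx <-]; exists x => //;
  by rewrite /flag_projection /circ /= !dotE oo pp op po !mulr1 !mulr0 addr0 add0r
     -?(dotC x) [cos t * _]mulrC [sin t * _]mulrC.
Qed.

Lemma support_symmetric B u : origin_symmetric B -> support B (- u) = support B u.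
Proof.
move=> BN; congr sup; apply/seteqP; split => _ [x Bx <-]; exists (- x); rewrite ?dotE//; try exact: BN.
by rewrite opprK.
Qed.

Lemma derive_shift (f : R -> R) c s d :
  is_derive (c + s) (1 : R) f d -> is_derive s (1 : R) (fun s => f (c + s)) d.
Proof.
move=> fd; apply: (isd_eq _ (isd_comp (isdD (isd_cst c s) (isd_id s)) fd)).
by rewrite add0r mulr1.
Qed.

Lemma derive_unshift (f : R -> R) c s d :
  is_derive s (1 : R) (fun s => f (c + s)) d -> is_derive (c + s) (1 : R) f d.
Proof.
move=> fd; have := @derive_shift (fun s => f (c + s)) (- c) (c + s) d.
rewrite addKr => /(_ fd).
by have -> : (fun s0 => f (c + (- c + s0))) = f by apply/funext => r; rewrite addNKr.
Qed.

(** The curvature condition speaks about the angle [0] only. Applied to the flags transported along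
    a great circle, which all span the same plane, it yields the differential equation at every
    angle. *)
Lemma body_curvature_pair B (q : 'rV[R]_3 -> 'rV[R]_3 -> R) C : origin_symmetric B ->
  flag_lipschitz q C ->
  (forall x u, flag x u -> is_proj_curvature_radius B x u (q x u)) ->
  curvature_pair (support B) q.
Proof.
move=> BN qC Bq; split; first by move=> x _; exact: support_symmetric.
  by exists C.
move=> x u xu; pose p t := support B (circ x u t).
have shiftE c : proj_support B (circ x u c) (circ u (- x) c) = fun t => p (c + t).
  by rewrite (proj_supportE _ (flag_circ c xu)); apply/funext => t; rewrite /p circD.
have dp t : is_derive t (1 : R) p (derive1 p t).
  have [/nbhs_singleton/derivableP + _ _] := Bq _ _ (flag_circ t xu).
  rewrite shiftE => /derive_unshift; rewrite addr0 derive1E => -[d _].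
  exact: derivableP.
have derE c : derive1 (fun t => p (c + t)) = fun t => derive1 p (c + t).
  by apply/funext => t; rewrite [LHS]derive1E; have [_ ->] := derive_shift (dp (c + t)).
exists (derive1 p); split => // t.
have [_ + ->] := Bq _ _ (flag_circ t xu).
rewrite shiftE /derive1n /= derE addr0 => /derivableP d.
rewrite derive1E addrAC subrr add0r.
by rewrite -{1}(addr0 t); exact: derive_unshift.
Qed.

(** * The body with a prescribed support function *)

Section Construction.
Variables (h : 'rV[R]_3 -> R) (q : 'rV[R]_3 -> 'rV[R]_3 -> R).
Hypotheses (hq : curvature_pair h q) (q_nonneg : flag_nonneg q).
Hypothesis slope_lin : forall x a b t, frame x a b ->
  slope q x (circ a b t) = cos t * slope q x a + sin t * slope q x b.

Definition wulff_shape : set 'rV[R]_3 := [set x | forall u, sphere u -> dot x u <= h u].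

Lemma wulff_half_turn x : sphere x -> exists2 u, flag x u & h x = half_turn q x u.
Proof.
move=> x1; have [u [u1 xu _]] := exists_common_tangent x x.
have fxu : flag x u by [].
by exists u => //; have [] := curvature_primitive hq fxu.
Qed.

Lemma wulff_ge0 x : sphere x -> 0 <= h x.
Proof.
move=> /wulff_half_turn[u xu ->]; rewrite mulr_ge0 ?invr_ge0// itg_ge0// => s /andP[s0 spi].
by rewrite mulr_ge0 ?sin_ge0_pi ?s0 ?spi//; apply: q_nonneg; exact: flag_circ.
Qed.

Lemma wulff_bound : exists2 M, 0 <= M & forall x, sphere x -> h x <= M.
Proof.
have [C qC] := curv_lip hq.
have [M M0 hM] := flag_lipschitz_bounded (half_turn_lipschitz qC).
exists M => // x /wulff_half_turn[u xu ->].
by rewrite (le_trans (ler_norm _))// hM.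
Qed.

Lemma wulff_touch u : sphere u -> exists2 x, wulff_shape x & dot x u = h u.
Proof.
move=> u1; have [a [a1 ua _]] := exists_common_tangent u u.
have fua : flag u a by [].
have [b fr] := exists_frame fua.
have [_ fub fab] := fr.
have [uu aa ua' au] := flag_dot fua; have [_ bb ub bu] := flag_dot fub; have [_ _ ab ba] := flag_dot fab.
pose x := h u *: u + slope q u a *: a + slope q u b *: b.
have xu : dot x u = h u by rewrite /x !dotE uu au bu; ring.
have xv v : flag u v -> dot x v = slope q u v.
  move=> /(frame_great_circle fr)[t _ ->].
  rewrite (slope_lin _ fr) /x /circ !dotE ua' ub aa bb ab ba; ring.
exists x => // w w1.
have [c [c1 uc wc]] := exists_common_tangent u w.
have [v fr'] := exists_frame (conj u1 (conj c1 uc) : flag u c).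
have [_ fuv fcv] := fr'.
have frc : frame c u v by case: fr' => f1 f2 f3; split => //; exact: flag_sym.
have [t /andP[t0 t2] wE] := frame_great_circle frc (flag_sym (conj w1 (conj c1 wc))).
have main z r : flag u z -> 0 <= r <= pi -> dot x (circ u z r) <= h (circ u z r).
  move=> uz rpi; have [_ d1 d2] := curvature_primitive hq uz.
  have -> : dot x (circ u z r) = cos r * h u + sin r * slope q u z.
    by rewrite dotC dot_circl !(dotC _ x) xu (xv z uz).
  rewrite -subr_ge0.
  (* The subtracted term is the support function of the single point [x] along the circle, a
     solution of [p'' + p = 0]; hence [y'' + y] is the curvature [q]. *)
  pose y s := h (circ u z s) - (cos s * h u + sin s * slope q u z).
  pose y1 s := slope q (circ u z s) (circ z (- u) s) - (- sin s * h u + cos s * slope q u z).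
  pose y2 s := q (circ u z s) (circ z (- u) s) - h (circ u z s) + (cos s * h u + sin s * slope q u z).
  have dc s k : is_derive s (1 : R) (fun s => cos s * k) (- sin s * k).
    apply: (isd_eq _ (isdM (is_derive_cos s) (isd_cst k s))); by rewrite mulr0 add0r mulrC.
  have ds s k : is_derive s (1 : R) (fun s => sin s * k) (cos s * k).
    apply: (isd_eq _ (isdM (is_derive_sin s) (isd_cst k s))); by rewrite mulr0 add0r mulrC.
  have dn s k : is_derive s (1 : R) (fun s => - sin s * k) (- (cos s * k)).
    apply: (isd_eq _ (isdM (isdN (is_derive_sin s)) (isd_cst k s))); by rewrite /= mulr0 add0r mulrC mulNr.
  have dy s : is_derive s (1 : R) y (y1 s) by exact: isdB (d1 s) (isdD (dc _ _) (ds _ _)).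
  have dy1 s : is_derive s (1 : R) y1 (y2 s).
    by apply: (isd_eq _ (isdB (d2 s) (isdD (dn s _) (dc s _)))); rewrite /y2; ring.
  apply: (@oscillator_ge0 _ y y1 y2 r rpi dy dy1).
  - by rewrite /y circ0 cos0 sin0; ring.
  - by rewrite /y1 !circ0 cos0 sin0; ring.
  - move=> s _; rewrite /y2 /y.
    have := q_nonneg (flag_circ s uz); move: (h (circ _ _ _)) (q _ _) => r1 r2; lra.
have [tpi|/ltW pit] := leP t pi; first by rewrite wE; apply: main => //; rewrite t0.
(* [main] covers half a turn; beyond it [w] is reached by going round the circle in the opposite
   direction. *)
have -> : w = circ u (- v) (2 * pi - t).
  rewrite -circ_opp opprB wE; have {1}-> : t = t - 2 * pi + pi + pi by ring.
  by rewrite !circDpi opprK.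
by apply: main; [exact: flagN|apply/andP; split; lra].
Qed.

Lemma wulff_has_sup u : sphere u -> has_sup [set dot x u | x in wulff_shape].
Proof.
move=> u1; have [x Bx _] := wulff_touch u1.
split; first by exists (dot x u), x.
by exists (h u) => _ [y By <-]; exact: By.
Qed.

Lemma support_wulff u : sphere u -> support wulff_shape u = h u.
Proof.
move=> u1; have [x Bx xu] := wulff_touch u1; apply/eqP; rewrite eq_le; apply/andP; split.
  by apply: ge_sup => [|_ [y By <-]]; [exists (dot x u), x|exact: By].
by rewrite -xu; apply: ub_le_sup; [case: (wulff_has_sup u1)|exists x].
Qed.

Lemma wulff_convex : convex_set wulff_shape.
Proof.
move=> x y l; rewrite !inE => Bx By u u1.
have -> : conv l x y = l%:num *: (x : 'rV[R]_3) + (1 - l%:num) *: (y : 'rV[R]_3) by [].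
rewrite !dotE.
have h1 : l%:num * dot x u <= l%:num * h u by rewrite ler_wpM2l//; exact: Bx.
have h2 : (1 - l%:num) * dot y u <= (1 - l%:num) * h u by rewrite ler_wpM2l// ?subr_ge0//; exact: By.
lra.
Qed.

Lemma wulff_symmetric : origin_symmetric wulff_shape.
Proof.
move=> x Bx u u1; rewrite dotNl -dotNr -(curv_even hq)//; apply: Bx.
by rewrite /sphere/= !dotE opprK.
Qed.

Lemma wulff_compact : compact wulff_shape.
Proof.
apply: bounded_closed_compact.
  have [M M0 hM] := wulff_bound; exists M; split; [exact: num_real|move=> N MN x Bx].
  apply: (le_trans _ (ltW MN)); apply: norm_row_le => // i.
  have e1 : sphere (delta_mx 0 i : 'rV[R]_3).
    rewrite /sphere/= dot_sum (bigD1 i)//= !mxE !eqxx mulr1 big1 ?addr0// => j ji.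
    by rewrite !mxE (negbTE ji) andbF mul0r.
  have xe y : dot y (delta_mx 0 i) = y 0 i.
    rewrite dot_sum (bigD1 i)//= !mxE !eqxx mulr1 big1 ?addr0// => j ji.
    by rewrite !mxE (negbTE ji) andbF mulr0.
  have b1 := le_trans (Bx _ e1) (hM _ e1).
  have b2 := le_trans (wulff_symmetric Bx e1) (hM _ e1).
  by rewrite dotNl in b2; rewrite xe in b1 b2; rewrite ler_norml lerNl b2.
have -> : wulff_shape = \bigcap_(u in sphere) [set x | dot x u <= h u] by [].
apply: closed_bigI => u _.
rewrite (_ : [set x | _] = (fun x => dot x u) @^-1` [set t | t <= h u])//.
apply: closed_comp => [x _|]; last exact: closed_le.
have cd : continuous (fun x : 'rV[R]_3 => dot x u).
  by apply: (continuous_dot (f := fun x => x) (g := fun=> u)) => z; [|exact: cst_continuous]; move=> P; exact.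
exact: cd.
Qed.

Lemma wulff_convex_body : convex_body wulff_shape.
Proof.
split; [|exact: wulff_compact|exact: wulff_convex].
by exists 0 => u u1; rewrite dot0l; exact: wulff_ge0.
Qed.

Lemma wulff_curvature x u : flag x u -> is_proj_curvature_radius wulff_shape x u (q x u).
Proof.
move=> xu; have [_ d1 d2] := curvature_primitive hq xu.
rewrite /is_proj_curvature_radius proj_supportE//.
have -> : (fun t => support wulff_shape (circ x u t)) = (fun t => h (circ x u t)).
  by apply/funext => t; rewrite support_wulff//; exact: sphere_circ.
have E : derive1 (fun t => h (circ x u t)) = fun t => slope q (circ x u t) (circ u (- x) t).
  by apply/funext => t; rewrite derive1E; have [_ ->] := d1 t.
have [d20 e20] := d2 0.
split; first by near=> t; case: (d1 t).
  by rewrite E.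
by rewrite /derive1n /= E derive1E e20 !circ0 (support_wulff xu.1) addrC subrK.
Unshelve. all: by end_near. Qed.

End Construction.
End Body.

Theorem theorem1p1 (R : realType)
    (e : 'rV[R]_3 -> 'rV[R]_3 * 'rV[R]_3) (e_longitude : longitude_system e)
    (F : 'rV[R]_3 -> 'rV[R]_3 -> R)
    (F_nonneg : flag_nonneg F) (F_sym : flag_symmetric F) (F_C1 : flag_C1 F) :
  (exists B : set 'rV[R]_3,
     [/\ convex_body B, origin_symmetric B
       & forall omega psi, flag omega psi ->
           is_proj_curvature_radius B omega psi (F omega psi)])
  <->
  (forall omega psi : 'rV[R]_3, flag omega psi ->
   forall t : R, 0 <= t < 2 * pi -> psi = sphere_point e omega 0 t ->
     F omega psi =
       flag_average e F omega / 2
       - (2 * pi)^-1 *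
         \int[lebesgue_measure]_(nu in `[0, pi / 2])
           \int[lebesgue_measure]_(phi in `[0, 2 * pi])
             (flag_average e F (sphere_point e omega nu phi)
              * cos (2 * (phi - t)) / cos nu)).
Proof.
have [C FC] := flag_C1_lipschitz F_C1.
split=> [[B [_ BN BF]] omega psi [sph _] t _ ->|F_formula].
  exact: (curvature_formula e_longitude t (body_curvature_pair BN FC BF) sph).
have Ff omega t : sphere omega -> 0 <= t < 2 * pi ->
    F omega (sphere_point e omega 0 t) = hemisphere_transform e (flag_average e F) omega t.
  by move=> o1 t2; apply: F_formula => //; exact: flag_sphere_point.
have hF := formula_curvature_pair e_longitude FC F_sym Ff.
have sF := slope_linear e_longitude FC F_sym Ff.
exists (wulff_shape (half_turn_potential F)); split.
- exact: wulff_convex_body hF F_nonneg.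
- exact: wulff_symmetric hF.
- by move=> omega psi fl; exact: (wulff_curvature hF F_nonneg sF fl).
Qed.
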